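(* Let $d\ge1$. The space $Y_0\cap L^\infty(\mathbb{T}_t\times\mathbb{T}^d_x)$ is a closed subalgebra of $L^\infty(\mathbb{T}_t\times\mathbb{T}^d_x)$ (a closed linear subspace stable under multiplication), and it contains all bounded functions on $\mathbb{T}_t\times\mathbb{T}^d_x$ that are either Riemann integrable or dependent on at most two of the space-time variables $t,x_1,\dots,x_d$.
   Context: $\mathbb{T}=\mathbb{R}/2\pi\mathbb{Z}$; $\mathbb{T}_t=\mathbb{T}$ and $\mathbb{T}^d_x=\mathbb{T}^d$ are the temporal and spatial tori. Let $\mathscr{S}=\{u:t\mapsto e^{it\Delta}u_0: u_0\in L^2(\mathbb{T}^d_x)\}$ be the space of free Schrödinger waves, regarded (by time periodicity) as a closed subspace of $L^2(\mathbb{T}_t\times\mathbb{T}^d_x)$. Let $Y=\mathfrak{L}(\mathscr{S},L^2(\mathbb{T}_t\times\mathbb{T}^d_x))$ be the space of bounded linear operators; functions in $L^\infty(\mathbb{T}_t\times\mathbb{T}^d_x)$ embed in $Y$ as multiplication operators. $Y_0$ is the closure of $C^0(\mathbb{T}_t\times\mathbb{T}^d_x)$ in $Y$; since $1\in\mathscr{S}$ it embeds continuously in $L^2(\mathbb{T}_t\times\mathbb{T}^d_x)$, so that its elements are identified with functions (acting by multiplication). *)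

(* Defs.v *)
(* Functions on the torus T^(1+d) = T_t x T^d_x, with T = R / 2 pi Z, are
   represented by functions on R x R^d.  Lebesgue measure on the torus becomes
   Lebesgue measure concentrated on the fundamental cell [0, 2 pi)^(1+d), so in
   the L^p spaces only the values on that cell matter.  Where pointwise values
   are significant, 2 pi-periodicity is required ([torus_periodic]). *)
From HB Require Import structures.
From mathcomp Require Import all_boot all_order all_algebra.
From mathcomp Require Import complex.
From mathcomp Require Import all_classical all_reals all_analysis.

Set Implicit Arguments.
Unset Strict Implicit.
Unset Printing Implicit Defensive.

Import Order.TTheory GRing.Theory Num.Theory.
Import numFieldNormedType.Exports.

Local Open Scope classical_set_scope.
Local Open Scope ring_scope.

Section circle_measure.
Variable R : realType.

Local Notation mR := (measurableTypeR R).

Lemma measurable_fundamental_cell : measurable (`[0, 2 * pi[ : set mR).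
Proof. exact: measurable_itv. Qed.

Definition circle_measure : set mR -> \bar R :=
  mrestr (@lebesgue_measure R) measurable_fundamental_cell.

HB.instance Definition _ := Measure.on circle_measure.

Let circle_measure_fin : fin_num_fun circle_measure.
Proof.
move=> A mA; rewrite ge0_fin_numE ?measure_ge0//.
apply: (@le_lt_trans _ _ (lebesgue_measure (`[0, 2 * pi[ : set mR))).
  by apply: le_measure; rewrite ?inE//; exact: measurableI.
by rewrite lebesgue_measure_itv/=; case: ifPn => _; rewrite ?ltry.
Qed.

HB.instance Definition _ := @Measure_isFinite.Build _ mR R circle_measure
  circle_measure_fin.

End circle_measure.

Section cons_measure.
Variables (R : realType) (n : nat).

Local Notation mR := (measurableTypeR R).

Variables (m1 : {finite_measure set mR -> \bar R})
          (m2 : {finite_measure set (n.-tuple mR) -> \bar R}).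

Definition cons_pair (p : mR * n.-tuple mR) : n.+1.-tuple mR :=
  [tuple of p.1 :: p.2].

Lemma measurable_cons_pair : measurable_fun setT cons_pair.
Proof. exact: measurable_cons. Qed.

Definition cons_measure : set (n.+1.-tuple mR) -> \bar R :=
  pushforward (m1 \x m2)%E cons_pair.

HB.instance Definition _ := Measure.copy cons_measure
  (measure_function_pushforward__canonical__measure_function_Measure
     (m1 \x m2)%E measurable_cons_pair).

Let cons_measure_fin : fin_num_fun cons_measure.
Proof.
move=> A mA; rewrite ge0_fin_numE ?measure_ge0//.
apply: (@le_lt_trans _ _ ((m1 \x m2)%E setT)).
  rewrite /cons_measure /pushforward; apply: le_measure; rewrite ?inE//.
  by rewrite -[X in measurable X]setTI; exact: measurable_cons_pair.
rewrite -setXTT product_measure1E// lte_mul_pinfty ?measure_ge0//.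
  exact: fin_num_measure.
by rewrite ltey_eq fin_num_measure.
Qed.

HB.instance Definition _ := @Measure_isFinite.Build _ _ R cons_measure
  cons_measure_fin.

End cons_measure.

Arguments cons_pair {R n}.

(* Lebesgue measure on [0, 2 pi)^n, as an iterated product. *)
Fixpoint torus_measure (R : realType) (n : nat) :
    {finite_measure set (n.-tuple (measurableTypeR R)) -> \bar R} :=
  match n with
  | 0 => dirac ([tuple] : 0.-tuple (measurableTypeR R))
  | n'.+1 => cons_measure (@circle_measure R) (torus_measure R n')
  end.

Definition spacetime_measure (R : realType) (d : nat) :
    set (measurableTypeR R * d.-tuple (measurableTypeR R)) -> \bar R :=
  (@circle_measure R \x torus_measure R d)%E.

HB.instance Definition _ (R : realType) (d : nat) :=
  Measure.on (@spacetime_measure R d).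

Notation spacetime R d := (measurableTypeR R * d.-tuple (measurableTypeR R))%type.

Section complex_Lp.
Variables (R : realType) (dT : measure_display) (T : measurableType dT).
Variable mu : {measure set T -> \bar R}.
Implicit Types f g : T -> R[i].

Definition ae_equal f g := {ae mu, forall z, f z = g z}.

(* Measurability with respect to the completion of [mu], i.e. Lebesgue
   measurability when [mu] is Lebesgue measure on the Borel sets. *)
Definition Lmeasurable f := exists g : T -> R[i],
  [/\ measurable_fun setT (fun z => complex.Re (g z)),
      measurable_fun setT (fun z => complex.Im (g z)) & ae_equal f g].

Definition cLnorm (p : \bar R) f : \bar R :=
  Lnorm mu p (fun z => (Normc.normc (f z))%:E).

Definition in_Lp (p : \bar R) f := Lmeasurable f /\ (cLnorm p f < +oo)%E.

Definition cintegral f : R[i] :=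
  ((\int[mu]_z complex.Re (f z)) +i* (\int[mu]_z complex.Im (f z)))%C.

End complex_Lp.

Section schrodinger.
Variables (R : realType) (d : nat).

Local Notation mR := (measurableTypeR R).
Local Notation space := (d.-tuple mR).
Local Notation dx := (torus_measure R d).
Local Notation dtdx := (@spacetime_measure R d).

Definition expi (a : R) : R[i] := (cos a +i* sin a)%C.

Definition dotp (k : d.-tuple int) (x : space) : R :=
  \sum_(i < d) (tnth k i)%:~R * tnth x i.

Definition sqnorm (k : d.-tuple int) : R := \sum_(i < d) (tnth k i)%:~R ^+ 2.

Definition fourier_coef (v : space -> R[i]) (k : d.-tuple int) : R[i] :=
  ((2 * pi) ^- d)%:C%C * cintegral dx (fun x => v x * expi (- dotp k x)).

(* [v] is (a representative of) e^{it Delta} u0, the Fourier multiplier with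
   symbol e^{-it|k|^2}. *)
Definition is_propagated (t : R) (u0 v : space -> R[i]) : Prop :=
  in_Lp dx 2%:E v /\
  forall k, fourier_coef v k = expi (- (t * sqnorm k)) * fourier_coef u0 k.

(* The space S of free Schrodinger waves inside L^2(T_t x T^d_x). *)
Definition free_wave (u : spacetime R d -> R[i]) : Prop :=
  in_Lp dtdx 2%:E u /\
  exists u0 : space -> R[i], in_Lp dx 2%:E u0 /\
    {ae @circle_measure R, forall t, is_propagated t u0 (fun x => u (t, x))}.

Definition operator := (spacetime R d -> R[i]) -> spacetime R d -> R[i].

(* Y = L(S, L^2(T_t x T^d_x)).  Elements of L^2 are functions up to a.e.
   equality, so that an operator has to respect it and is linear up to it; its
   values outside S are irrelevant. *)
Definition bounded_operator (A : operator) : Prop :=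
  [/\ forall u, free_wave u -> in_Lp dtdx 2%:E (A u),
      forall u v, free_wave u -> free_wave v -> ae_equal dtdx u v ->
        ae_equal dtdx (A u) (A v),
      forall (c : R[i]) u v, free_wave u -> free_wave v ->
        ae_equal dtdx (A (fun z => c * u z + v z))
                      (fun z => c * A u z + A v z)
    & exists M : R, forall u, free_wave u ->
        (cLnorm dtdx 2%:E (A u) <= M%:E * cLnorm dtdx 2%:E u)%E].

Definition operator_norm (A : operator) : \bar R :=
  ereal_sup [set cLnorm dtdx 2%:E (A u) |
    u in [set u | free_wave u /\ (cLnorm dtdx 2%:E u <= 1)%E]].

Definition mul_operator (f : spacetime R d -> R[i]) : operator :=
  fun u z => f z * u z.

(* The coordinates (t, x_1, ..., x_d), indexed from 0. *)
Definition st_coord (z : spacetime R d) (i : 'I_d.+1) : R := tnth (cons_pair z) i.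

Definition of_row (w : 'rV[R]_d.+1) : spacetime R d :=
  (w ord0 ord0, [tuple w ord0 (lift ord0 i) | i < d]).

Definition torus_periodic (f : spacetime R d -> R[i]) : Prop :=
  forall z z',
    (forall i, exists m : int,
       st_coord z' i = st_coord z i + m%:~R * (2 * pi)) ->
    f z' = f z.

(* C^0(T_t x T^d_x); continuity is stated on R^(1+d), and [R[i]^o] is the
   complex plane with its usual topology. *)
Definition continuous_on_torus (f : spacetime R d -> R[i]) : Prop :=
  torus_periodic f /\ continuous (fun w : 'rV[R]_d.+1 => f (of_row w) : R[i]^o).

(* Closure in Y of the multiplications by continuous functions. *)
Definition Y0 (A : operator) : Prop :=
  bounded_operator A /\
  forall e : R, 0 < e -> exists g, continuous_on_torus g /\
    (operator_norm (fun u z => (A u z - mul_operator g u z)%R) <= e%:E)%E.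

(* Bounded functions are regarded as elements of Y through multiplication. *)
Definition Y0_Linfty (f : spacetime R d -> R[i]) : Prop :=
  Y0 (mul_operator f) /\ in_Lp dtdx +oo%E f.

(* A set of functions that is a closed subalgebra of L^oo(T_t x T^d_x); the
   second condition says that it is a set of classes for a.e. equality. *)
Definition closed_subalgebra_Linfty (B : (spacetime R d -> R[i]) -> Prop) : Prop :=
  [/\ forall f, B f -> in_Lp dtdx +oo%E f,
      forall f g, in_Lp dtdx +oo%E g -> ae_equal dtdx f g -> B f -> B g,
      [/\ B (fun=> 0),
          forall (c : R[i]) f g, B f -> B g -> B (fun z => c * f z + g z)
        & forall f g, B f -> B g -> B (fun z => f z * g z)]
    & forall f, in_Lp dtdx +oo%E f ->
        (forall e : R, 0 < e -> exists g, B g /\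
          (cLnorm dtdx +oo%E (fun z => (f z - g z)%R) <= e%:E)%E) -> B f].

Definition bounded_function (f : spacetime R d -> R[i]) : Prop :=
  exists M : R, forall z, Normc.normc (f z) <= M.

(* At most two variables, as [i = j] is allowed. *)
Definition depends_on_at_most_two_variables (f : spacetime R d -> R[i]) : Prop :=
  exists i j : 'I_d.+1, forall z z',
    st_coord z i = st_coord z' i -> st_coord z j = st_coord z' j -> f z = f z'.

Section darboux.

(* A partition of the box [0, 2 pi]^(1+d): along each axis i, the nodes are
   0 followed by the list [P i], which increases strictly up to 2 pi. *)
Definition grid (P : 'I_d.+1 -> seq R) : Prop :=
  forall i, itv_partition 0 (2 * pi) (P i).

Variable P : 'I_d.+1 -> seq R.

Definition node (i : 'I_d.+1) (k : nat) : R := nth 0 (0 :: P i) k.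

Definition cell_index := {dffun forall i : 'I_d.+1, 'I_(size (P i))}.

Definition cell (k : cell_index) : set (spacetime R d) :=
  [set z | forall i, node i (k i) <= st_coord z i <= node i (k i).+1].

Definition cell_volume (k : cell_index) : R :=
  \prod_(i < d.+1) (node i (k i).+1 - node i (k i)).

Definition upper_sum (h : spacetime R d -> R) : R :=
  \sum_(k : cell_index) sup (h @` cell k) * cell_volume k.

Definition lower_sum (h : spacetime R d -> R) : R :=
  \sum_(k : cell_index) inf (h @` cell k) * cell_volume k.

End darboux.

(* Equality of the upper and lower Darboux integrals; meaningful for [h]
   bounded, as otherwise [sup] and [inf] take default values. *)
Definition darboux_integrable (h : spacetime R d -> R) : Prop :=
  inf [set upper_sum P h | P in grid] = sup [set lower_sum P h | P in grid].

Definition riemann_integrable (f : spacetime R d -> R[i]) : Prop :=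
  [/\ bounded_function f,
      darboux_integrable (fun z => complex.Re (f z))
    & darboux_integrable (fun z => complex.Im (f z))].

End schrodinger.

(* Main.v *)
(* Call a bounded function h approximable if multiplication by h is a limit of
   multiplications by trigonometric polynomials, in the norm of operators on the
   trigonometric polynomials with frequencies (-|k|^2, k).  The approximable
   functions form a closed algebra, and they belong to Y_0 because the free waves
   are the L^2 limits of those polynomials.

   If h depends on two variables, an approximant of h in L^4 may be averaged so as
   to depend on the same variables.  The frequencies (-|k|^2, k) then fall into
   classes, according to the other coordinates; different classes give orthogonal
   contributions, and a class lies on a parabola or on a circle, where the L^4 norm
   is dominated by the L^2 norm (two points of a circle are determined by their sum
   unless they are antipodal).

   If h is Riemann integrable, there are step functions l_j <= h <= u_j, made of
   boxes and therefore approximable, with gaps w_j = u_j - l_j that decrease as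
   fast as desired.  With g = max_(j < J) l_j one has 0 <= h - g <= w_j for all
   j < J.  Fix an increasing sequence of scales N_j and let V_j(k) be the span of
   the integer vectors of size at most N_j whose product with k is at most N_j^2.
   Since dim V_j(k) <= d, the frequencies k with V_j(k) <> V_(j+1)(k) carry, for
   some j < J, at most the fraction d / J of the L^2 mass of a given wave v; they
   are harmless as w_j is bounded.  The remaining frequencies are sorted according
   to the values of k on the generators of V_j(k).  Two frequencies of the same
   kind are equal if their difference is so small that it lies in V_(j+1)(k) =
   V_j(k), hence |w_j v|^2 has integral at most the number of kinds times the
   product of the integrals of |w_j|^2 and |v|^2, up to a constant. *)
Require Import Defs.
From HB Require Import structures.
From mathcomp Require Import all_boot all_order all_algebra.
From mathcomp Require Import complex.
From mathcomp Require Import all_classical all_reals all_analysis.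
From mathcomp Require Import measurable_realfun ess_sup_inf.
From mathcomp Require Import zify ring lra.

Set Implicit Arguments.
Unset Strict Implicit.
Unset Printing Implicit Defensive.

Import Order.TTheory GRing.Theory Num.Theory.
Import numFieldNormedType.Exports.

Local Open Scope classical_set_scope.
Local Open Scope ring_scope.

(** In general the L^4 norm of a wave is not dominated by its L^2 norm, so in the Riemann case only
    the L^2 smallness of the gaps is available, and it has to beat the number of kinds. This is
    circular: the number of kinds grows with N, a gap small compared with it has an approximating
    polynomial with larger frequencies, and two frequencies of one kind are separated only if V(k)
    does not change up to a size beyond those. Hence the order of choices: N_j, then w_j, then a
    polynomial close to w_j, whose frequencies dictate N_(j+1). The frequencies k for which V(k)
    changes between N_j and N_(j+1) are what this order leaves uncontrolled; they can be many for
    one j, but not for all.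

    The bound N_j^2 on the product with k comes from the paraboloid: if k and k - n both occur and
    |k|^2 and |k - n|^2 differ by at most D, then 2 k.n equals |n|^2 up to D. Thus the spatial
    difference of two interacting frequencies is nearly orthogonal to k. *)

Section squared_modulus.
Variable R : realType.
Implicit Types (x y : R[i]) (a : R).

(** All L^2 and L^4 bounds are stated for squares, which avoids square roots; the triangle
    inequality then costs the factor 2 of [sqnD], the source of most constants 2, 4 and 8 below. *)
Definition sqn x : R := complex.Re x ^+ 2 + complex.Im x ^+ 2.

Lemma sqn_ge0 x : 0 <= sqn x.
Proof. by rewrite addr_ge0 ?sqr_ge0. Qed.

Lemma sqn_normc x : Normc.normc x ^+ 2 = sqn x.
Proof. by case: x => a b; rewrite /= sqr_sqrtr// addr_ge0 ?sqr_ge0. Qed.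

Lemma normc_ge0 x : 0 <= Normc.normc x.
Proof. by case: x => a b /=; exact: sqrtr_ge0. Qed.

Lemma sqnM x y : sqn (x * y) = sqn x * sqn y.
Proof. by rewrite -!sqn_normc Normc.normcM exprMn. Qed.

Lemma sqnN x : sqn (- x) = sqn x.
Proof. by case: x => a b; rewrite /sqn /= !sqrrN. Qed.

Lemma sqnJ x : sqn (conjc x) = sqn x.
Proof. by case: x => a b; rewrite /sqn /= !sqrrN. Qed.

Lemma sqn0 : sqn 0 = 0.
Proof. by rewrite /sqn /= expr0n addr0. Qed.

Lemma sqnC a : sqn a%:C%C = a ^+ 2.
Proof. by rewrite /sqn /= expr0n addr0. Qed.

Lemma sqn1 : sqn 1 = 1.
Proof. by rewrite (_ : 1 = 1%:C%C)// sqnC expr1n. Qed.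

Lemma sqnD x y : sqn (x + y) <= 2 * sqn x + 2 * sqn y.
Proof.
case: x y => a b [c e]; rewrite /sqn /=.
have := sqr_ge0 (a - c); have := sqr_ge0 (b - e); nra.
Qed.

Lemma sqnB x y : sqn (x - y) <= 2 * sqn x + 2 * sqn y.
Proof. by rewrite (le_trans (sqnD _ _))// sqnN. Qed.

Lemma sqnE x : (sqn x)%:C%C = x * conjc x.
Proof.
by case: x => a b; rewrite /sqn /=; simpc; congr (_ +i* _)%C; ring.
Qed.

Lemma sqn_Re x : sqn x = complex.Re (x * conjc x).
Proof. by rewrite -sqnE. Qed.

Lemma cReD x y : complex.Re (x + y) = complex.Re x + complex.Re y.
Proof. by case: x y => ? ? []. Qed.

Lemma cImD x y : complex.Im (x + y) = complex.Im x + complex.Im y.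
Proof. by case: x y => ? ? []. Qed.

Lemma cReM x y : complex.Re (x * y) =
  complex.Re x * complex.Re y - complex.Im x * complex.Im y.
Proof. by case: x y => ? ? []. Qed.

Lemma cImM x y : complex.Im (x * y) =
  complex.Re x * complex.Im y + complex.Im x * complex.Re y.
Proof. by case: x y => ? ? []. Qed.

Lemma cReN x : complex.Re (- x) = - complex.Re x.
Proof. by case: x. Qed.

Lemma cImN x : complex.Im (- x) = - complex.Im x.
Proof. by case: x. Qed.

Lemma cReJ x : complex.Re (conjc x) = complex.Re x.
Proof. by case: x. Qed.

Lemma cImJ x : complex.Im (conjc x) = - complex.Im x.
Proof. by case: x. Qed.

Lemma ReIm_inj x y : complex.Re x = complex.Re y ->
  complex.Im x = complex.Im y -> x = y.
Proof. by case: x y => ? ? [] ? ? /= -> ->. Qed.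

End squared_modulus.

(** * Integration of complex-valued functions *)

Section ae_integral.
Context d (T : measurableType d) (R : realType).
Variable mu : {measure set T -> \bar R}.
Local Open Scope ereal_scope.
Import HBNNSimple.

(* No measurability is needed: the integral of a nonnegative function is defined
   as a supremum over simple functions. *)
Lemma ge0_ae_le_nonmeasurable_integral (f g : T -> \bar R) :
  (forall x, 0 <= f x) -> (forall x, 0 <= g x) ->
  {ae mu, forall x, f x <= g x} -> \int[mu]_x f x <= \int[mu]_x g x.
Proof.
move=> f0 g0 [N [mN N0 fgN]].
rewrite !ge0_integralTE//; apply: ge_ereal_sup => _ [h /= hf <-].
pose h' := proj_nnsfun h (measurableC mN).
have h'E x : h' x = (h x * \1_(~` N) x)%R by [].
rewrite -integralT_nnsfun.
have -> : \int[mu]_x (EFin \o h) x = \int[mu]_x (EFin \o h') x.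
  apply: ge0_ae_eq_integral => //.
  - by apply/measurable_EFinP; exact: measurable_funP.
  - by apply/measurable_EFinP; exact: measurable_funP.
  - by move=> x _; rewrite lee_fin.
  - by move=> x _; rewrite lee_fin.
  - exists N; split => // x; apply: contra_notP => Nx _.
    rewrite -[RHS]/(h' x)%:E -[LHS]/(h x)%:E.
    by rewrite h'E indicE mem_set// mulr1.
rewrite integralT_nnsfun; apply: ereal_sup_ubound; exists h' => // x.
rewrite -[X in (X <= _)%E]/(h' x)%:E h'E indicE.
case: (boolP (x \in ~` N)); rewrite ?inE => Nx; last first.
  by rewrite mulr0.
rewrite mulr1; apply: (le_trans (hf x)).
by apply: contra_notP Nx => fgx; exact: fgN.
Qed.

Lemma ge0_ae_eq_nonmeasurable_integral (f g : T -> \bar R) :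
  (forall x, 0 <= f x) -> (forall x, 0 <= g x) ->
  {ae mu, forall x, f x = g x} -> \int[mu]_x f x = \int[mu]_x g x.
Proof.
move=> f0 g0 fg; apply/eqP; rewrite eq_le; apply/andP; split;
  apply: ge0_ae_le_nonmeasurable_integral => //;
  by apply: filterS fg => x ->.
Qed.

Lemma ae_eq_nonmeasurable_integral (f g : T -> \bar R) :
  {ae mu, forall x, f x = g x} -> \int[mu]_x f x = \int[mu]_x g x.
Proof.
move=> fg; rewrite (integralE _ _ f) (integralE _ _ g); congr (_ - _);
  apply: ge0_ae_eq_nonmeasurable_integral => //;
  by apply: filterS fg => x; rewrite ?funeposE ?funenegE => ->.
Qed.

End ae_integral.

Section borel_complex.
Context dT (T : measurableType dT) (R : realType).
Implicit Types f g : T -> R[i].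

Definition Borel_complex f :=
  measurable_fun setT (fun z => complex.Re (f z)) /\
  measurable_fun setT (fun z => complex.Im (f z)).

Lemma Borel_cst c : Borel_complex (fun=> c).
Proof. by split; exact: measurable_cst. Qed.

Lemma BorelD f g : Borel_complex f -> Borel_complex g ->
  Borel_complex (fun z => f z + g z).
Proof.
move=> [fR fI] [gR gI]; split.
  by under eq_fun do rewrite cReD; exact: measurable_funD.
by under eq_fun do rewrite cImD; exact: measurable_funD.
Qed.

Lemma BorelM f g : Borel_complex f -> Borel_complex g ->
  Borel_complex (fun z => f z * g z).
Proof.
move=> [fR fI] [gR gI]; split.
  by under eq_fun do rewrite cReM; apply: measurable_funB; exact: measurable_funM.
by under eq_fun do rewrite cImM; apply: measurable_funD; exact: measurable_funM.
Qed.

Lemma BorelJ f : Borel_complex f -> Borel_complex (fun z => conjc (f z)).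
Proof.
move=> [fR fI]; split; first by under eq_fun do rewrite cReJ.
by under eq_fun do rewrite cImJ; exact: measurable_funN.
Qed.

Lemma BorelC (h : T -> R) : measurable_fun setT h ->
  Borel_complex (fun z => (h z)%:C%C).
Proof. by move=> mh; split => //=; exact: measurable_cst. Qed.

Lemma measurable_sqn f : Borel_complex f ->
  measurable_fun setT (fun z => sqn (f z)).
Proof.
by move=> [fR fI]; apply: measurable_funD; exact: measurable_funX.
Qed.

Lemma measurable_sqnE f : Borel_complex f ->
  measurable_fun setT (fun z => (sqn (f z))%:E).
Proof. by move=> /measurable_sqn mf; exact/measurable_EFinP. Qed.

End borel_complex.

Section complex_integration.
Context dT (T : measurableType dT) (R : realType).
Variable mu : {measure set T -> \bar R}.
Implicit Types f g h : T -> R[i].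

Local Notation Lm := (@Lmeasurable R dT T mu).
Local Notation cI := (@cintegral R dT T mu).
Local Notation "f =ae g" := (ae_equal mu f g) (at level 70).

Lemma ae_sym f g : f =ae g -> g =ae f.
Proof. by apply: filterS => z ->. Qed.

Lemma ae_trans f g h : f =ae g -> g =ae h -> f =ae h.
Proof. by apply: filterS2 => z -> ->. Qed.

Lemma LmP f : Lm f <-> exists g, Borel_complex g /\ f =ae g.
Proof. by split => [[g []]|[g [[]]]]; exists g. Qed.

Lemma Borel_Lm f : Borel_complex f -> Lm f.
Proof. by move=> bf; apply/LmP; exists f; split => //; exact: aeW. Qed.

Lemma Lm_ae f g : f =ae g -> Lm f -> Lm g.
Proof.
move=> fg /LmP[k [bk fk]]; apply/LmP; exists k; split => //.
exact: ae_trans (ae_sym fg) fk.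
Qed.

Lemma Lm_cst c : Lm (fun=> c).
Proof. exact/Borel_Lm/Borel_cst. Qed.

Lemma LmD f g : Lm f -> Lm g -> Lm (fun z => f z + g z).
Proof.
move=> /LmP[f' [bf ff]] /LmP[g' [bg gg]]; apply/LmP.
exists (fun z => f' z + g' z); split; first exact: BorelD.
by apply: filterS2 ff gg => z -> ->.
Qed.

Lemma LmM f g : Lm f -> Lm g -> Lm (fun z => f z * g z).
Proof.
move=> /LmP[f' [bf ff]] /LmP[g' [bg gg]]; apply/LmP.
exists (fun z => f' z * g' z); split; first exact: BorelM.
by apply: filterS2 ff gg => z -> ->.
Qed.

Lemma LmZ c f : Lm f -> Lm (fun z => c * f z).
Proof. by apply: LmM; exact: Lm_cst. Qed.

Lemma LmN f : Lm f -> Lm (fun z => - f z).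
Proof. by move=> mf; under eq_fun do rewrite -mulN1r; exact: LmZ. Qed.

Lemma LmB f g : Lm f -> Lm g -> Lm (fun z => f z - g z).
Proof. by move=> mf mg; apply: LmD => //; exact: LmN. Qed.

Lemma LmJ f : Lm f -> Lm (fun z => conjc (f z)).
Proof.
move=> /LmP[f' [bf ff]]; apply/LmP.
exists (fun z => conjc (f' z)); split; first exact: BorelJ.
by apply: filterS ff => z ->.
Qed.

Lemma Lm_sum (I : Type) (r : seq I) (P : pred I) (F : I -> T -> R[i]) :
  (forall i, Lm (F i)) -> Lm (fun z => \sum_(i <- r | P i) F i z).
Proof.
move=> mF; elim: r => [|i r ih].
  by under eq_fun do rewrite big_nil; exact: Lm_cst.
under eq_fun do rewrite big_cons; case: (P i) => //.
exact: LmD.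
Qed.

(** The squared L^2 norm. Being a supremum over simple functions it makes sense for every f, so that
    [nn_le] follows from a comparison almost everywhere. *)
Definition nn f : \bar R := (\int[mu]_z (sqn (f z))%:E)%E.

Lemma nn_ge0 f : (0 <= nn f)%E.
Proof. by apply: integral_ge0 => z _; rewrite lee_fin sqn_ge0. Qed.

Lemma nn_le f g : {ae mu, forall z, sqn (f z) <= sqn (g z)} ->
  (nn f <= nn g)%E.
Proof.
move=> fg; apply: ge0_ae_le_nonmeasurable_integral => [z|z|].
- by rewrite lee_fin sqn_ge0.
- by rewrite lee_fin sqn_ge0.
- by apply: filterS fg => z; rewrite lee_fin.
Qed.

Lemma nn_ae f g : f =ae g -> nn f = nn g.
Proof.
move=> fg; apply/eqP; rewrite eq_le; apply/andP; split; apply: nn_le;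
  by apply: filterS fg => z ->.
Qed.

Lemma nn0 : nn (fun=> 0) = 0%E.
Proof. by apply: integral0_eq => z _; rewrite sqn0. Qed.

Lemma nn_leZ (c : R) f g : 0 <= c -> Lm g ->
  {ae mu, forall z, sqn (f z) <= c * sqn (g z)} -> (nn f <= c%:E * nn g)%E.
Proof.
move=> c0 /LmP[g' [bg gg]] fg.
rewrite (nn_ae gg) /nn -ge0_integralZl//; first last.
- by move=> z _; rewrite lee_fin sqn_ge0.
- exact: measurable_sqnE.
apply: ge0_ae_le_nonmeasurable_integral => [z|z|].
- by rewrite lee_fin sqn_ge0.
- by rewrite -EFinM lee_fin mulr_ge0 ?sqn_ge0.
- by apply: filterS2 fg gg => z + <-; rewrite -EFinM lee_fin.
Qed.

(** The common source of the two-term bounds: triangle inequality, convexity, Young's inequality and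
    Cauchy-Schwarz are obtained from suitable a and b. *)
Lemma nn_leZ2 (a b : R) f g h : 0 <= a -> 0 <= b -> Lm g -> Lm h ->
  {ae mu, forall z, sqn (f z) <= a * sqn (g z) + b * sqn (h z)} ->
  (nn f <= a%:E * nn g + b%:E * nn h)%E.
Proof.
move=> a0 b0 /LmP[g' [bg gg]] /LmP[h' [bh hh]] fg.
rewrite (nn_ae gg) (nn_ae hh) /nn -!ge0_integralZl//; first last.
- by move=> z _; rewrite lee_fin sqn_ge0.
- exact: measurable_sqnE.
- by move=> z _; rewrite lee_fin sqn_ge0.
- exact: measurable_sqnE.
rewrite -ge0_integralD//; first last.
- by apply: measurable_funeM; exact: measurable_sqnE.
- by move=> z _; rewrite -EFinM lee_fin mulr_ge0 ?sqn_ge0.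
- by apply: measurable_funeM; exact: measurable_sqnE.
- by move=> z _; rewrite -EFinM lee_fin mulr_ge0 ?sqn_ge0.
apply: ge0_ae_le_nonmeasurable_integral => [z|z|].
- by rewrite lee_fin sqn_ge0.
- by rewrite -!EFinM -EFinD lee_fin addr_ge0// mulr_ge0 ?sqn_ge0.
- apply: filterS3 fg gg hh => z + <- <-.
  by rewrite -!EFinM -EFinD lee_fin.
Qed.

Lemma nnD f g : Lm f -> Lm g ->
  (nn (fun z => f z + g z)%R <= 2%:E * nn f + 2%:E * nn g)%E.
Proof. by move=> mf mg; apply: nn_leZ2 => //; apply: aeW => z; exact: sqnD. Qed.

Lemma nnB f g : Lm f -> Lm g ->
  (nn (fun z => f z - g z)%R <= 2%:E * nn f + 2%:E * nn g)%E.
Proof. by move=> mf mg; apply: nn_leZ2 => //; apply: aeW => z; exact: sqnB. Qed.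

Lemma nnM_le (M : R) f g : 0 <= M -> {ae mu, forall z, sqn (f z) <= M} ->
  Lm g -> (nn (fun z => f z * g z)%R <= M%:E * nn g)%E.
Proof.
move=> M0 fM mg; apply: nn_leZ => //; apply: filterS fM => z fM.
by rewrite sqnM ler_wpM2r ?sqn_ge0.
Qed.

Definition L2 f := Lm f /\ (nn f < +oo)%E.

Lemma L2D f g : L2 f -> L2 g -> L2 (fun z => f z + g z).
Proof.
move=> [mf nf] [mg ng]; split; first exact: LmD.
rewrite (le_lt_trans (nnD mf mg))// lte_add_pinfty//;
  by rewrite lte_mul_pinfty// ?fin_numE.
Qed.

Lemma L2M_bounded (M : R) f g : {ae mu, forall z, sqn (f z) <= M} ->
  Lm f -> L2 g -> L2 (fun z => f z * g z).
Proof.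
move=> fM mf [mg ng]; split; first exact: LmM.
apply: (@le_lt_trans _ _ (`|M|%:E * nn g)%E); last first.
  by rewrite lte_mul_pinfty.
apply: nnM_le => //; apply: filterS fM => z /le_trans; apply; exact: ler_norm.
Qed.

Lemma L2Z c f : L2 f -> L2 (fun z => c * f z).
Proof.
apply: (@L2M_bounded (sqn c)); [exact: aeW|exact: Lm_cst].
Qed.

Lemma L2N f : L2 f -> L2 (fun z => - f z).
Proof. by move=> mf; under eq_fun do rewrite -mulN1r; exact: L2Z. Qed.

Lemma L2B f g : L2 f -> L2 g -> L2 (fun z => f z - g z).
Proof. by move=> mf mg; apply: L2D => //; exact: L2N. Qed.

Lemma L2_0 : L2 (fun=> 0).
Proof. by split; [exact: Lm_cst|rewrite nn0]. Qed.

Lemma L2_sum (I : Type) (r : seq I) (P : pred I) (F : I -> T -> R[i]) :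
  (forall i, L2 (F i)) -> L2 (fun z => \sum_(i <- r | P i) F i z).
Proof.
move=> mF; elim: r => [|i r ih].
  by under eq_fun do rewrite big_nil; exact: L2_0.
under eq_fun do rewrite big_cons; case: (P i) => //.
exact: L2D.
Qed.

Lemma L2J f : L2 f -> L2 (fun z => conjc (f z)).
Proof.
move=> [mf nf]; split; first exact: LmJ.
by rewrite (le_lt_trans _ nf)//; apply: nn_le; apply: aeW => z; rewrite sqnJ.
Qed.

(** [integrable] demands measurability, whereas [Lmeasurable] functions only have a Borel
    representative; hence the condition is put on the representative. *)
Definition cintegrable f := exists g, [/\ f =ae g,
  mu.-integrable setT (EFin \o (fun z => complex.Re (g z))) &
  mu.-integrable setT (EFin \o (fun z => complex.Im (g z)))].

Lemma cintegral_ae f g : f =ae g -> cI f = cI g.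
Proof.
move=> fg; rewrite /cintegral /Rintegral; congr (_ +i* _)%C; congr fine;
  by apply: ae_eq_nonmeasurable_integral; apply: filterS fg => z ->.
Qed.

Lemma cintegrableM f g : L2 f -> L2 g -> cintegrable (fun z => f z * g z).
Proof.
have intg f' : Borel_complex f' -> (nn f' < +oo)%E ->
    mu.-integrable setT (EFin \o (fun z => sqn (f' z))).
  move=> bf ff; apply/integrableP; split; first exact: measurable_sqnE.
  under eq_integral do rewrite /= ger0_norm ?sqn_ge0//.
  exact: ff.
have bnd (x y : R[i]) : `|complex.Re (x * y)| <= sqn x + sqn y /\
    `|complex.Im (x * y)| <= sqn x + sqn y.
  case: x y => a b [c e]; rewrite /sqn /= !ler_norml.
  have := sqr_ge0 (a - c); have := sqr_ge0 (a + c);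
  have := sqr_ge0 (b - e); have := sqr_ge0 (b + e);
  have := sqr_ge0 (a - e); have := sqr_ge0 (a + e);
  have := sqr_ge0 (b - c); have := sqr_ge0 (b + c) => *.
  by split; apply/andP; split; nra.
move=> [/LmP[f' [bf ff]] nf] [/LmP[g' [bg gg]] ng].
rewrite (nn_ae ff) in nf; rewrite (nn_ae gg) in ng.
have fgS := integrableD measurableT (intg _ bf nf) (intg _ bg ng).
have [mR mI] := BorelM bf bg.
have intk (k : T -> R) : measurable_fun setT k ->
    (forall z, `|k z| <= sqn (f' z) + sqn (g' z)) ->
    mu.-integrable setT (EFin \o k).
  move=> mk kS.
  have H := @le_integrable _ _ _ mu setT measurableT (EFin \o k) _ _ _ fgS.
  apply: H; first by apply/measurable_EFinP.
  move=> z _.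
  rewrite -[leRHS]/(`|sqn (f' z) + sqn (g' z)|%:E) -[leLHS]/(`|k z|%:E) lee_fin.
  by apply: (le_trans (kS z)); exact: ler_norm.
exists (fun z => f' z * g' z); split.
- by apply: filterS2 ff gg => z -> ->.
- by apply: intk => // z; case: (bnd (f' z) (g' z)).
- by apply: intk => // z; case: (bnd (f' z) (g' z)).
Qed.

Lemma cintegrableD f g : cintegrable f -> cintegrable g ->
  cintegrable (fun z => f z + g z).
Proof.
move=> [f' [ff fR fI]] [g' [gg gR gI]]; exists (fun z => f' z + g' z); split.
- by apply: filterS2 ff gg => z -> ->.
- rewrite [X in integrable _ _ X](_ : _ = fun z => ((complex.Re (f' z))%:E +
    (complex.Re (g' z))%:E)%E); last by apply/funext => z /=; rewrite cReD.
  exact: integrableD.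
- rewrite [X in integrable _ _ X](_ : _ = fun z => ((complex.Im (f' z))%:E +
    (complex.Im (g' z))%:E)%E); last by apply/funext => z /=; rewrite cImD.
  exact: integrableD.
Qed.

Lemma cintegralD f g : cintegrable f -> cintegrable g ->
  cI (fun z => f z + g z) = cI f + cI g.
Proof.
move=> [f' [ff fR fI]] [g' [gg gR gI]].
rewrite (cintegral_ae ff) (cintegral_ae gg).
rewrite (@cintegral_ae _ (fun z => f' z + g' z)); last first.
  by apply: filterS2 ff gg => z -> ->.
apply: ReIm_inj; rewrite ?cReD ?cImD /cintegral /=.
  by rewrite -RintegralD//; apply: eq_Rintegral => z _; rewrite cReD.
by rewrite -RintegralD//; apply: eq_Rintegral => z _; rewrite cImD.
Qed.

Lemma cintegrableZ c f : cintegrable f -> cintegrable (fun z => c * f z).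
Proof.
move=> [f' [ff fR fI]]; exists (fun z => c * f' z); split.
- by apply: filterS ff => z ->.
- rewrite [X in integrable _ _ X](_ : _ = fun z =>
    ((complex.Re c)%:E * (complex.Re (f' z))%:E -
     (complex.Im c)%:E * (complex.Im (f' z))%:E)%E); last first.
    by apply/funext => z /=; rewrite cReM.
  by apply: integrableB => //; exact: integrableZl.
- rewrite [X in integrable _ _ X](_ : _ = fun z =>
    ((complex.Re c)%:E * (complex.Im (f' z))%:E +
     (complex.Im c)%:E * (complex.Re (f' z))%:E)%E); last first.
    by apply/funext => z /=; rewrite cImM.
  by apply: integrableD => //; exact: integrableZl.
Qed.

Lemma cintegralZ c f : cintegrable f -> cI (fun z => c * f z) = c * cI f.
Proof.
move=> [f' [ff fR fI]]; rewrite (cintegral_ae ff).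
rewrite (@cintegral_ae _ (fun z => c * f' z)); last first.
  by apply: filterS ff => z ->.
have ZR (a : R) := integrableZl measurableT a fR.
have ZI (a : R) := integrableZl measurableT a fI.
apply: ReIm_inj; rewrite ?cReM ?cImM /cintegral /=.
  rewrite -!RintegralZl// -RintegralB//.
    by apply: eq_Rintegral => z _; rewrite cReM.
  - exact: ZR.
  - exact: ZI.
rewrite -!RintegralZl// -RintegralD//.
  by apply: eq_Rintegral => z _; rewrite cImM.
- exact: ZI.
- exact: ZR.
Qed.

Lemma cintegralJ f : cintegrable f -> cI (fun z => conjc (f z)) = conjc (cI f).
Proof.
move=> [f' [ff fR fI]]; rewrite (cintegral_ae ff).
rewrite (@cintegral_ae _ (fun z => conjc (f' z))); last first.
  by apply: filterS ff => z ->.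
apply: ReIm_inj; rewrite ?cReJ ?cImJ /cintegral /=.
  by apply: eq_Rintegral => z _; rewrite cReJ.
rewrite -mulN1r -RintegralZl//.
by apply: eq_Rintegral => z _; rewrite cImJ mulN1r.
Qed.

Lemma cintegral0 : cI (fun=> 0) = 0.
Proof. by rewrite /cintegral /= /Rintegral integral0. Qed.

Lemma cintegrable0 : cintegrable (fun=> 0).
Proof.
by exists (fun=> 0); split; [exact: aeW|exact: integrable0|exact: integrable0].
Qed.

Lemma cintegrable_sum (I : Type) (r : seq I) (P : pred I) (F : I -> T -> R[i]) :
  (forall i, cintegrable (F i)) ->
  cintegrable (fun z => \sum_(i <- r | P i) F i z).
Proof.
move=> mF; elim: r => [|i r ih].
  by under eq_fun do rewrite big_nil; exact: cintegrable0.
under eq_fun do rewrite big_cons; case: (P i) => //.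
exact: cintegrableD.
Qed.

Lemma cintegral_sum (I : Type) (r : seq I) (P : pred I) (F : I -> T -> R[i]) :
  (forall i, cintegrable (F i)) ->
  cI (fun z => \sum_(i <- r | P i) F i z) = \sum_(i <- r | P i) cI (F i).
Proof.
move=> mF; elim: r => [|i r ih].
  by under eq_fun do rewrite big_nil; rewrite big_nil cintegral0.
under eq_fun do rewrite big_cons; rewrite big_cons; case: (P i) => //.
by rewrite cintegralD ?ih//; exact: cintegrable_sum.
Qed.

Lemma nn_cintegral f : (nn f < +oo)%E ->
  nn f = (complex.Re (cI (fun z => f z * conjc (f z))))%:E.
Proof.
move=> nf; rewrite /cintegral /= /Rintegral fineK.
  by apply: eq_integral => z _; rewrite sqn_Re.
rewrite (_ : (\int[mu]_x _)%E = nn f).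
  by rewrite ge0_fin_numE ?nn_ge0.
by apply: eq_integral => z _; rewrite sqn_Re.
Qed.

Lemma nn_sum (I : finType) (P : pred I) (F : I -> T -> R[i]) :
  (forall i, L2 (F i)) ->
  nn (fun z => \sum_(i | P i) F i z) =
  (complex.Re (\sum_(i | P i) \sum_(j | P j)
     cI (fun z => F i z * conjc (F j z))))%:E.
Proof.
move=> mF; rewrite nn_cintegral; last exact: (L2_sum _ _ mF).2.
congr (complex.Re _)%:E.
have mFF i j : cintegrable (fun z => F i z * conjc (F j z)).
  by apply: cintegrableM => //; exact: L2J.
transitivity (cI (fun z => \sum_(i | P i) \sum_(j | P j)
    (F i z * conjc (F j z)))).
  congr cintegral; apply/funext => z.
  rewrite raddf_sum mulr_suml; apply: eq_bigr => i _.
  by rewrite mulr_sumr.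
rewrite cintegral_sum//; last by move=> i; exact: cintegrable_sum.
by apply: eq_bigr => i _; rewrite cintegral_sum.
Qed.

Lemma nn_dominated_approx (F : nat -> T -> R[i]) f g (e : R) :
  (forall n, Borel_complex (F n)) -> Borel_complex f -> Borel_complex g ->
  (nn g < +oo)%E -> (forall n z, sqn (f z - F n z) <= sqn (g z)) ->
  (forall z, (fun n => sqn (f z - F n z)) @ \oo --> (0 : R)) -> 0 < e ->
  exists n, (nn (fun z => f z - F n z)%R <= e%:E)%E.
Proof.
move=> bF bf bg ng Fg Ff e0.
have bD n : Borel_complex (fun z => f z - F n z).
  apply: BorelD => //; under eq_fun do rewrite -mulN1r.
  by apply: BorelM => //; exact: Borel_cst.
have : (fun n => nn (fun z => f z - F n z)) @ \oo -->
    (\int[mu]_z (cst 0%E : T -> \bar R) z)%E.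
  apply: (@dominated_cvg _ _ _ mu setT measurableT
    (fun n z => (sqn (f z - F n z))%:E) (cst 0%E) (fun z => (sqn (g z))%:E)) => //.
  - by move=> n; exact: measurable_sqnE.
  - by move=> z _; apply/fine_cvgP; split; [exact: nearW|exact: Ff].
  - apply/integrableP; split; first exact: measurable_sqnE.
    by under eq_integral do rewrite /= ger0_norm ?sqn_ge0//.
  - by move=> n z _ /=; rewrite ger0_norm ?sqn_ge0// lee_fin.
rewrite integral0 => /fine_cvgP[[n1 _ fin] /cvgr_lt/(_ _ e0)[n2 _ lt]].
exists (maxn n1 n2); have h1 := fin _ (leq_maxl n1 n2).
by have := lt _ (leq_maxr n1 n2); rewrite /= -lte_fin fineK// => /ltW.
Qed.

Definition LB f := Lm f /\ exists M : R, {ae mu, forall z, sqn (f z) <= M}.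

Lemma LBP f : LB f <->
  Lm f /\ exists2 M : R, 0 <= M & {ae mu, forall z, sqn (f z) <= M}.
Proof.
split=> [[mf [M fM]]|[mf [M _ fM]]]; split => //; last by exists M.
exists `|M| => //; apply: filterS fM => z /le_trans; apply; exact: ler_norm.
Qed.

Lemma LB_ae f g : f =ae g -> LB f -> LB g.
Proof.
move=> fg [mf [M fM]]; split; first exact: Lm_ae mf.
by exists M; apply: filterS2 fg fM => z ->.
Qed.

Lemma LBD f g : LB f -> LB g -> LB (fun z => f z + g z).
Proof.
move=> [mf [M fM]] [mg [N gN]]; split; first exact: LmD.
exists (2 * M + 2 * N); apply: filterS2 fM gN => z fM gN.
by rewrite (le_trans (sqnD _ _))// lerD// ler_wpM2l.
Qed.

Lemma LBM f g : LB f -> LB g -> LB (fun z => f z * g z).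
Proof.
move=> [mf [M fM]] [mg [N gN]]; split; first exact: LmM.
exists (M * N); apply: filterS2 fM gN => z fM gN.
by rewrite sqnM ler_pM ?sqn_ge0.
Qed.

Lemma LB_cst c : LB (fun=> c).
Proof. by split; [exact: Lm_cst|exists (sqn c); exact: aeW]. Qed.

Lemma LBZ c f : LB f -> LB (fun z => c * f z).
Proof. by apply: LBM; exact: LB_cst. Qed.

Lemma LBN f : LB f -> LB (fun z => - f z).
Proof. by move=> mf; under eq_fun do rewrite -mulN1r; exact: LBZ. Qed.

Lemma LBB f g : LB f -> LB g -> LB (fun z => f z - g z).
Proof. by move=> mf mg; apply: LBD => //; exact: LBN. Qed.

Lemma LBJ f : LB f -> LB (fun z => conjc (f z)).
Proof.
move=> [mf [M fM]]; split; first exact: LmJ.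
by exists M; apply: filterS fM => z; rewrite sqnJ.
Qed.

Lemma LB_sum (I : Type) (r : seq I) (P : pred I) (F : I -> T -> R[i]) :
  (forall i, LB (F i)) -> LB (fun z => \sum_(i <- r | P i) F i z).
Proof.
move=> mF; elim: r => [|i r ih].
  by under eq_fun do rewrite big_nil; exact: LB_cst.
under eq_fun do rewrite big_cons; case: (P i) => //.
exact: LBD.
Qed.

Lemma L2M f g : LB f -> L2 g -> L2 (fun z => f z * g z).
Proof. by move=> [mf [M fM]]; exact: L2M_bounded fM mf. Qed.

Hypothesis mu_fin : (mu setT < +oo)%E.

Lemma LB_L2 f : LB f -> L2 f.
Proof.
move=> /LBP[mf [M M0 fM]]; split => //.
apply: (@le_lt_trans _ _ (M%:E * nn (fun=> 1%R))%E).
  by apply: nn_leZ => //; [exact: Lm_cst|apply: filterS fM => z; rewrite sqn1 mulr1].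
rewrite lte_mul_pinfty// /nn.
by under eq_integral do rewrite sqn1; rewrite integral_cst// mul1e.
Qed.

Lemma cintegrable_L2 f : L2 f -> cintegrable f.
Proof.
move=> mf; rewrite (_ : f = fun z => f z * 1).
  by apply: cintegrableM => //; exact/LB_L2/LB_cst.
by apply/funext => z; rewrite mulr1.
Qed.

End complex_integration.

Local Notation pushforward_measure :=
  measure_function_pushforward__canonical__measure_function_Measure.

(** * Translations of the torus *)

Section reduction.
Variable R : realType.
Local Notation mR := (measurableTypeR R).
Implicit Types x s : R.

Definition red x : R := x - (Num.floor (x / (2 * pi)))%:~R * (2 * pi).

Lemma twopi_gt0 : 0 < 2 * pi :> R.
Proof. by rewrite mulr_gt0// pi_gt0. Qed.

Lemma twopi_neq0 : 2 * pi != 0 :> R.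
Proof. by rewrite gt_eqF// twopi_gt0. Qed.

Lemma redE x : red x = x - (Num.floor (x / (2 * pi)))%:~R * (2 * pi).
Proof. by []. Qed.

Lemma red_itv x : 0 <= red x < 2 * pi.
Proof.
have /andP[h1 h2] := floor_itv (x / (2 * pi)).
rewrite /red subr_ge0 -ler_pdivlMr ?twopi_gt0// h1/=.
move: h2; rewrite ltr_pdivrMr ?twopi_gt0// intrD mulrDl mul1r => h2.
by rewrite ltrBlDr addrC.
Qed.

Lemma red_uniq x y (m : int) : 0 <= y < 2 * pi -> x = y + m%:~R * (2 * pi) ->
  red x = y.
Proof.
move=> /andP[y0 y1] ->; rewrite /red.
have -> : Num.floor ((y + m%:~R * (2 * pi)) / (2 * pi)) = m.
  rewrite mulrDl mulfK ?twopi_neq0//; apply: floor_def.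
  rewrite lerDr divr_ge0//= ?(ltW twopi_gt0)// intrD addrC ltrD2l.
  by rewrite ltr_pdivrMr ?twopi_gt0// mul1r.
by rewrite addrK.
Qed.

Lemma red_id x : 0 <= x < 2 * pi -> red x = x.
Proof. by move=> hx; apply: (@red_uniq _ _ 0) => //; rewrite mul0r addr0. Qed.

Lemma redD x (m : int) : red (x + m%:~R * (2 * pi)) = red x.
Proof.
apply: (@red_uniq _ _ (m + Num.floor (x / (2 * pi)))); first exact: red_itv.
by rewrite redE intrD; ring.
Qed.

Lemma red_int x : exists m : int, red x = x + m%:~R * (2 * pi).
Proof.
by exists (- Num.floor (x / (2 * pi))); rewrite redE mulrNz mulNr.
Qed.

Lemma red_red x s : red (x + red s) = red (x + s).
Proof. by have [m ->] := red_int s; rewrite addrA redD. Qed.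

Lemma measurable_red : measurable_fun setT (red : mR -> mR).
Proof.
apply: measurable_funB => //; apply: measurable_funM; last exact: measurable_cst.
apply: (nondecreasing_measurable measurableT) => x y xy.
by rewrite ler_int le_floor// ler_pM2r// invr_gt0 twopi_gt0.
Qed.

Lemma measurable_addr s : measurable_fun setT (fun x : mR => x + s : mR).
Proof. by apply: measurable_funD => //; exact: measurable_cst. Qed.

Lemma lebesgue_measure_preimage_addr s (A : set mR) : measurable A ->
  lebesgue_measure ((fun x => x + s) @^-1` A) = lebesgue_measure A.
Proof.
move=> mA; pose m' : {measure set mR -> \bar R} :=
  pushforward_measure (@lebesgue_measure R) (measurable_addr s).
apply/esym; apply: (@lebesgue_measure_unique _ m') => // _ [[a b] _ <-].
rewrite /m' /= /pushforward.
rewrite (_ : _ @^-1` _ = `]a - s, b - s]%classic); last first.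
  by apply/seteqP; split => x /=; rewrite !in_itv/= ltrBlDr lerBrDr.
by rewrite !lebesgue_measure_itv /= !lte_fin ltrD2r -!EFinB opprB addrA subrK.
Qed.

Definition measure_preserving d (T : measurableType d)
    (m : set T -> \bar R) (f : T -> T) :=
  measurable_fun setT f /\ forall A, measurable A -> m (f @^-1` A) = m A.

Lemma circle_measureE (A : set mR) :
  circle_measure A = lebesgue_measure (A `&` `[0, 2 * pi[).
Proof. by []. Qed.

(** Modulo 2 pi, a translation by s in [0, 2 pi) exchanges two arcs, and on each of them it is a
    translation of the line. *)
Lemma circle_rotation s :
  measure_preserving (@circle_measure R) (fun x => red (x + s)).
Proof.
split; first by apply: (measurableT_comp measurable_red); exact: measurable_addr.
move=> A mA.
wlog /andP[s0 s1] : s / 0 <= s < 2 * pi.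
  move=> /(_ (red s) (red_itv s)) <-.
  by congr circle_measure; apply/seteqP; split => x /=; rewrite red_red.
have mi (i : interval R) : measurable ([set` i] : set mR).
  exact: measurable_itv.
rewrite !circle_measureE.
(* Either x + s stays below 2 pi and lies in [s, 2 pi), or it wraps around and x + s - 2 pi lies in
   [0, s). *)
rewrite (_ : _ `&` _ = ((fun x => x + s) @^-1` (A `&` `[s, 2 * pi[)) `|`
   ((fun x => x + (s - 2 * pi)) @^-1` (A `&` `[0, s[))); last first.
  apply/seteqP; split => x /=; rewrite !in_itv /=.
    move=> [Ax /andP[x0 x1]].
    have [h|h] := ltP (x + s) (2 * pi).
      rewrite red_id ?h ?addr_ge0// in Ax; left; split => //.
      by rewrite lerDr x0.
    have e : red (x + s) = x + (s - 2 * pi).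
      by apply: (@red_uniq _ _ 1); [lra|rewrite mul1r; lra].
    rewrite e in Ax; right; split => //; lra.
  move=> [] [Ax hx].
    by rewrite red_id; [split => //; lra|lra].
  have -> : red (x + s) = x + (s - 2 * pi).
    by apply: (@red_uniq _ _ 1); [lra|rewrite mul1r; lra].
  by split => //; lra.
have mp c B : measurable B -> measurable ((fun x : mR => x + c : mR) @^-1` B).
  by move=> mB; rewrite -[X in measurable X]setTI; exact: measurable_addr.
have m1 : measurable (A `&` (`[s, 2 * pi[ : set mR)) by exact: measurableI.
have m2 : measurable (A `&` (`[0, s[ : set mR)) by exact: measurableI.
rewrite measureU; first last.
- apply/seteqP; split => x //=; rewrite !in_itv/= => -[[_ h1] [_ h2]]; lra.
- exact: mp.
- exact: mp.
have e1 := lebesgue_measure_preimage_addr s m1.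
have e2 := lebesgue_measure_preimage_addr (s - 2 * pi) m2.
apply: (etrans (congr2 adde e1 e2)).
have dis : (A `&` `[s, 2 * pi[) `&` (A `&` `[0, s[) = set0.
  apply/seteqP; split => x //=; rewrite !in_itv/= => -[[_ h1] [_ h2]]; lra.
apply: (etrans (esym (measureU lebesgue_measure m1 m2 dis))).
rewrite -setIUr; congr (lebesgue_measure (_ `&` _)).
apply/seteqP; split => x /=; rewrite !in_itv/=; last first.
  by move=> hx; case: (ltP x s) => h; [right|left]; lra.
by move=> []; lra.
Qed.

End reduction.

Section product_preserving.
Context d1 d2 (T1 : measurableType d1) (T2 : measurableType d2) (R : realType).
Variable m1 : {finite_measure set T1 -> \bar R}.
Variable m2 : {finite_measure set T2 -> \bar R}.

(** A product measure is determined by its values on rectangles, and the preimage of a rectangle is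
    a rectangle. *)
Lemma product_measure_preserving (f1 : T1 -> T1) (f2 : T2 -> T2) :
  measure_preserving m1 f1 -> measure_preserving m2 f2 ->
  measure_preserving (m1 \x m2)%E (fun z => (f1 z.1, f2 z.2)).
Proof.
move=> [mf1 p1] [mf2 p2].
have mf : measurable_fun setT (fun z : T1 * T2 => (f1 z.1, f2 z.2)).
  apply: measurable_fun_pair.
    exact: (measurableT_comp mf1 measurable_fst).
  exact: (measurableT_comp mf2 measurable_snd).
split => // A mA.
pose m' : {measure set (T1 * T2) -> \bar R} :=
    pushforward_measure (m1 \x m2)%E mf.
apply/esym; apply: (@product_measure_unique _ _ _ _ _ m1 m2 m') => // B C mB mC.
rewrite /m' /= /pushforward (_ : _ @^-1` _ = (f1 @^-1` B) `*` (f2 @^-1` C))//.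
have mB' : measurable (f1 @^-1` B) by rewrite -[X in measurable X]setTI; exact: mf1.
have mC' : measurable (f2 @^-1` C) by rewrite -[X in measurable X]setTI; exact: mf2.
apply: (etrans (product_measure1E m1 m2 mB' mC')).
exact: (congr2 mule (p1 _ mB) (p2 _ mC)).
Qed.

End product_preserving.

Section torus_rotation.
Variable R : realType.
Local Notation mR := (measurableTypeR R).

Definition rotate n (s : 'I_n -> R) (x : n.-tuple mR) : n.-tuple mR :=
  [tuple red (tnth x i + s i) | i < n].

Lemma measurable_rotate n (s : 'I_n -> R) : measurable_fun setT (rotate s).
Proof.
apply/measurable_fun_tnthP => i.
rewrite (_ : _ \o _ = (fun y : mR => red (y + s i) : mR) \o (@tnth n mR ^~ i)).
  apply: measurableT_comp; last exact: measurable_tnth.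
  by apply: (measurableT_comp (@measurable_red R)); exact: measurable_addr.
by apply/funext => x /=; rewrite tnth_mktuple.
Qed.

Lemma torus_rotation n (s : 'I_n -> R) :
  measure_preserving (torus_measure R n) (rotate s).
Proof.
elim: n s => [|n IH] s.
  split; first exact: measurable_rotate.
  move=> A mA; congr (torus_measure R 0 _); apply/seteqP.
  by split => x /=; rewrite (tuple0 x) (tuple0 (rotate _ _)).
split; first exact: measurable_rotate.
move=> A mA /=; rewrite /cons_measure /pushforward.
have [_ p] := product_measure_preserving (circle_rotation (s ord0))
  (IH (fun i => s (lift ord0 i))).
have mA' : measurable (cons_pair @^-1` A).
  by rewrite -[X in measurable X]setTI; exact: measurable_cons_pair.
apply: (etrans _ (p _ mA')).
congr ((_ \x _)%E _); apply/seteqP.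
suff E (z : mR * n.-tuple mR) : rotate s (cons_pair z) =
    cons_pair (red (z.1 + s ord0), rotate (fun i => s (lift ord0 i)) z.2).
  by split => z /=; rewrite E.
apply: eq_from_tnth => i; rewrite tnth_mktuple.
case: (unliftP ord0 i) => [j|] ->; last by rewrite !tnth0.
by rewrite !tnthS tnth_mktuple.
Qed.

Variable d : nat.

Definition shift_st (s : 'I_d.+1 -> R) (z : spacetime R d) : spacetime R d :=
  (red (z.1 + s ord0), rotate (fun i => s (lift ord0 i)) z.2).

Lemma spacetime_rotation s :
  measure_preserving (@spacetime_measure R d) (shift_st s).
Proof.
exact: product_measure_preserving (circle_rotation _) (torus_rotation _).
Qed.

Lemma st_coord0 (z : spacetime R d) : st_coord z ord0 = z.1.
Proof. by rewrite /st_coord tnth0. Qed.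

Lemma st_coordS (z : spacetime R d) i : st_coord z (lift ord0 i) = tnth z.2 i.
Proof. by rewrite /st_coord tnthS. Qed.

Lemma st_coord_shift s z i : st_coord (shift_st s z) i = red (st_coord z i + s i).
Proof.
case: (unliftP ord0 i) => [j|] ->; last by rewrite !st_coord0.
by rewrite !st_coordS tnth_mktuple.
Qed.

Lemma spacetime_measure_fin : (@spacetime_measure R d setT < +oo)%E.
Proof.
rewrite /spacetime_measure -setXTT product_measure1E//.
by rewrite lte_mul_pinfty// -?ge0_fin_numE// fin_num_measure.
Qed.

End torus_rotation.

Section preserving_integral.
Context dT (T : measurableType dT) (R : realType).
Variable mu : {measure set T -> \bar R}.
Variable tau : T -> T.
Hypothesis ptau : measure_preserving mu tau.
Implicit Types f g : T -> R[i].

Lemma preserving_ae (P : T -> Prop) : {ae mu, forall z, P z} ->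
  {ae mu, forall z, P (tau z)}.
Proof.
move=> [N [mN N0 PN]]; exists (tau @^-1` N); split.
- by rewrite -[X in measurable X]setTI; exact: ptau.1.
- by rewrite ptau.2.
- by move=> z /= /PN.
Qed.

Lemma Borel_preserving f : Borel_complex f -> Borel_complex (f \o tau).
Proof.
move=> [fR fI]; split; first exact: (measurableT_comp fR ptau.1).
exact: (measurableT_comp fI ptau.1).
Qed.

Lemma Lm_preserving f : Lmeasurable mu f -> Lmeasurable mu (f \o tau).
Proof.
move=> /LmP[g [bg fg]]; apply/LmP; exists (g \o tau); split.
  exact: Borel_preserving.
exact: (@preserving_ae (fun z => f z = g z)).
Qed.

Lemma LB_preserving f : LB mu f -> LB mu (f \o tau).
Proof.
move=> [mf [M fM]]; split; first exact: Lm_preserving.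
by exists M; exact: (@preserving_ae (fun z => sqn (f z) <= M)).
Qed.

Lemma ge0_integral_preserving (p : T -> \bar R) : measurable_fun setT p ->
  (forall z, (0 <= p z)%E) -> (\int[mu]_z p (tau z) = \int[mu]_z p z)%E.
Proof.
move=> mp p0; have mE A : measurable A -> A `<=` setT ->
    pushforward_measure mu ptau.1 A = mu A by move=> mA _; exact: ptau.2.
apply: (etrans _ (@eq_measure_integral _ _ _ setT mu _ p mE)).
have := @ge0_integral_pushforward _ _ _ _ _ _ ptau.1 mu setT p measurableT mp.
by move=> ->.
Qed.

Lemma nn_preserving f : Lmeasurable mu f -> nn mu (f \o tau) = nn mu f.
Proof.
move=> /LmP[g [bg fg]]; rewrite (nn_ae fg).
rewrite (@nn_ae _ _ _ _ _ (g \o tau)); last first.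
  exact: (@preserving_ae (fun z => f z = g z)).
apply: (@ge0_integral_preserving (fun z => (sqn (g z))%:E)).
  exact: measurable_sqnE.
by move=> z; rewrite lee_fin sqn_ge0.
Qed.

Lemma cintegral_preserving f : cintegrable mu f ->
  cintegral mu (f \o tau) = cintegral mu f.
Proof.
move=> [g [fg gR gI]]; rewrite (cintegral_ae fg).
rewrite (@cintegral_ae _ _ _ _ _ (g \o tau)); last first.
  exact: (@preserving_ae (fun z => f z = g z)).
have E (k : T -> R) : mu.-integrable setT (EFin \o k) ->
    (\int[mu]_z k (tau z) = \int[mu]_z k z)%R.
  move=> ik; rewrite /Rintegral; congr fine.
  have mk : measurable_fun setT (EFin \o k) by exact: measurable_int ik.
  rewrite (integralE _ _ (fun z => (k (tau z))%:E)) [RHS]integralE.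
  congr (_ - _)%E.
    rewrite -(ge0_integral_preserving (measurable_funepos mk))//.
    by apply: eq_integral => z _; rewrite !funeposE.
  rewrite -(ge0_integral_preserving (measurable_funeneg mk))//.
  by apply: eq_integral => z _; rewrite !funenegE.
by rewrite /cintegral; congr (_ +i* _)%C; [exact: (E _ gR)|exact: (E _ gI)].
Qed.

End preserving_integral.

(** * Trigonometric polynomials *)

Section blocks.
Context dT (T : measurableType dT) (R : realType).
Variable mu : {measure set T -> \bar R}.
Local Notation cI := (@cintegral R dT T mu).

(** In the double sum of [nn_sum] only the pairs inside one class survive. Within a class the terms
    may interact, as they do for functions of two variables. *)
Lemma nn_blocks (I J : finType) (P : pred I) (cls : I -> J) (F : I -> T -> R[i]) :
  (forall i, L2 mu (F i)) ->
  (forall i j, P i -> P j -> cls i != cls j ->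
    cI (fun z => F i z * conjc (F j z)) = 0) ->
  nn mu (fun z => \sum_(i | P i) F i z) =
  (\sum_(g : J) nn mu (fun z => \sum_(i | P i && (cls i == g)) F i z)%R)%E.
Proof.
move=> mF F0; rewrite nn_sum//.
under [RHS]eq_bigr do rewrite nn_sum//.
rewrite sumEFin -raddf_sum; congr (complex.Re _)%:E.
rewrite (partition_big cls predT)//=; apply: eq_bigr => g _.
apply: eq_bigr => i /andP[Pi /eqP ig]; rewrite (bigID (fun j => cls j == g))/=.
rewrite [X in _ + X]big1 ?addr0// => j /andP[Pj jg].
by apply: F0 => //; rewrite ig eq_sym.
Qed.

Lemma nn_orthogonal (I : finType) (P : pred I) (F : I -> T -> R[i]) :
  (forall i, L2 mu (F i)) ->
  (forall i j, P i -> P j -> i != j -> cI (fun z => F i z * conjc (F j z)) = 0) ->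
  nn mu (fun z => \sum_(i | P i) F i z) = (\sum_(i | P i) nn mu (F i))%E.
Proof.
move=> mF F0; rewrite (nn_blocks (cls := id))//.
rewrite [RHS]big_mkcond/=; apply: eq_bigr => i _.
case: ifPn => Pi.
  congr nn; apply/funext => z; rewrite (big_pred1 i)// => j /=.
  by case: eqP => [->|]; rewrite ?Pi ?andbT ?andbF.
rewrite (_ : (fun z => _) = fun=> 0); first by rewrite nn0.
apply/funext => z; rewrite big_pred0// => j.
by case: eqP => [->|]; rewrite ?(negbTE Pi) ?andbF.
Qed.

(** Applied to f = u - v and to the part r of a polynomial v + r off the paraboloid: dropping r does
    not increase the distance to u. *)
Lemma nn_pythagoras f r : L2 mu f -> L2 mu r ->
  cI (fun z => f z * conjc (r z)) = 0 -> (nn mu f <= nn mu (fun z => f z - r z)%R)%E.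
Proof.
move=> f2 r2 fr; pose F (b : bool) z := if b then f z else - r z.
have F2 b : L2 mu (F b) by case: b => //; exact: L2N.
have Ifr : cintegrable mu (fun z => f z * conjc (r z)).
  by apply: cintegrableM => //; exact: L2J.
have tf : cI (fun z => F true z * conjc (F false z)) = 0.
  transitivity (cI (fun z => -1 * (f z * conjc (r z)))).
    by congr cintegral; apply/funext => z; rewrite /F rmorphN; ring.
  by rewrite cintegralZ// fr mulr0.
have ft : cI (fun z => F false z * conjc (F true z)) = 0.
  rewrite -[RHS](conjc0 R) -tf -cintegralJ.
    congr cintegral; apply/funext => z; rewrite /F.
    by case: (f z) (r z) => a b [a' b']; apply: ReIm_inj => /=; ring.
  by apply: cintegrableM => //; exact: L2J.
have E : nn mu (fun z => f z - r z) = (\sum_b nn mu (F b))%E.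
  rewrite -(@nn_orthogonal _ predT F)//.
    by congr nn; apply/funext => z; rewrite big_bool.
  by move=> [] [].
by rewrite E big_bool /= leeDl// nn_ge0.
Qed.

End blocks.

Section exponentials.
Variable R : realType.
Implicit Types a b : R.

Lemma expiD a b : expi (a + b) = expi a * expi b.
Proof. by rewrite /expi cosD sinD; apply: ReIm_inj => //=; rewrite addrC. Qed.

Lemma expi0 : expi 0 = 1 :> R[i].
Proof. by rewrite /expi cos0 sin0. Qed.

Lemma expiJ a : conjc (expi a) = expi (- a).
Proof. by rewrite /expi cosN sinN. Qed.

Lemma sqn_expi a : sqn (expi a) = 1.
Proof. by rewrite /sqn /= cos2Dsin2. Qed.

Lemma expi_pi : expi pi = - 1 :> R[i].
Proof. by rewrite /expi cospi sinpi; apply: ReIm_inj => //=; rewrite oppr0. Qed.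

Lemma expi_2pi : expi (2 * pi) = 1 :> R[i].
Proof. by rewrite mulr2n mulrDl mul1r expiD expi_pi mulrNN mulr1. Qed.

Lemma expi_nat2pi (n : nat) : expi (n%:R * (2 * pi)) = 1 :> R[i].
Proof.
elim: n => [|n ih]; first by rewrite mul0r expi0.
by rewrite -addn1 natrD mulrDl mul1r expiD ih expi_2pi mulr1.
Qed.

Lemma expi_int2pi (m : int) : expi (m%:~R * (2 * pi)) = 1 :> R[i].
Proof.
case: m => n; first exact: expi_nat2pi.
by rewrite NegzE mulrNz mulNr -expiJ expi_nat2pi conjc1.
Qed.

Lemma expiD2pi a (m : int) : expi (a + m%:~R * (2 * pi)) = expi a.
Proof. by rewrite expiD expi_int2pi mulr1. Qed.

Lemma measurable_cos : measurable_fun setT (@cos R).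
Proof. by apply: continuous_measurable_fun; exact: continuous_cos. Qed.

Lemma measurable_sin : measurable_fun setT (@sin R).
Proof. by apply: continuous_measurable_fun; exact: continuous_sin. Qed.

Lemma Borel_expi dT (T : measurableType dT) (h : T -> R) :
  measurable_fun setT h -> Borel_complex (fun z => expi (h z)).
Proof.
move=> mh; split => /=; first exact: (measurableT_comp measurable_cos).
exact: (measurableT_comp measurable_sin).
Qed.

End exponentials.

Section trigonometric_polynomials.
Variables (R : realType) (d : nat).
Local Notation Z := (spacetime R d).
Local Notation mu := (@spacetime_measure R d).
Local Notation cI := (cintegral mu).

Definition freq := {ffun 'I_d.+1 -> int}.
HB.instance Definition _ := GRing.Zmodule.on freq.
Implicit Types (m n : freq) (s : 'I_d.+1 -> R) (f g : Z -> R[i]).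

Definition dot m s : R := \sum_i (m i)%:~R * s i.

Definition ee m (z : Z) : R[i] := expi (dot m (st_coord z)).

Lemma dotD m n s : dot (m + n) s = dot m s + dot n s.
Proof.
by rewrite /dot -big_split; apply: eq_bigr => i _; rewrite ffunE intrD mulrDl.
Qed.

Lemma dotN m s : dot (- m) s = - dot m s.
Proof.
by rewrite /dot -sumrN; apply: eq_bigr => i _; rewrite ffunE mulrNz mulNr.
Qed.

Lemma dot0 s : dot 0 s = 0.
Proof. by rewrite /dot big1// => i _; rewrite ffunE mul0r. Qed.

Lemma eeD m n z : ee (m + n) z = ee m z * ee n z.
Proof. by rewrite /ee dotD expiD. Qed.

Lemma eeJ m z : conjc (ee m z) = ee (- m) z.
Proof. by rewrite /ee dotN expiJ. Qed.

Lemma eeB m n z : ee (m - n) z = ee m z * conjc (ee n z).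
Proof. by rewrite eeD eeJ. Qed.

Lemma ee0 z : ee 0 z = 1.
Proof. by rewrite /ee dot0 expi0. Qed.

Lemma sqn_ee m z : sqn (ee m z) = 1.
Proof. exact: sqn_expi. Qed.

Lemma ee_periodic m z z' :
  (forall i, exists k : int, st_coord z' i = st_coord z i + k%:~R * (2 * pi)) ->
  ee m z' = ee m z.
Proof.
move=> h; have [k hk] := choice h.
rewrite /ee (_ : dot m (st_coord z') =
    dot m (st_coord z) + (\sum_i m i * k i)%:~R * (2 * pi)).
  by rewrite expiD2pi.
rewrite /dot rmorph_sum mulr_suml -big_split; apply: eq_bigr => i _ /=.
by rewrite hk mulrDr intrM mulrA.
Qed.

Lemma st_coord_shift_int s z i : exists k : int,
  st_coord (shift_st s z) i = st_coord z i + s i + k%:~R * (2 * pi).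
Proof. by rewrite st_coord_shift; exact: red_int. Qed.

Lemma ee_shift m s z : ee m (shift_st s z) = expi (dot m s) * ee m z.
Proof.
have [k hk] := choice (st_coord_shift_int s z).
rewrite /ee (_ : dot m (st_coord (shift_st s z)) =
   dot m s + dot m (st_coord z) + (\sum_i m i * k i)%:~R * (2 * pi)).
  by rewrite expiD2pi expiD.
rewrite /dot rmorph_sum mulr_suml -!big_split; apply: eq_bigr => i _ /=.
by rewrite hk intrM; ring.
Qed.

Lemma measurable_st_coord i :
  measurable_fun setT (fun z : Z => st_coord z i : measurableTypeR R).
Proof.
by apply: (measurableT_comp (measurable_tnth i)); exact: measurable_cons_pair.
Qed.

Lemma Borel_ee m : Borel_complex (ee m).
Proof.
apply: Borel_expi; apply: measurable_sum => i.
apply: measurable_funM; first exact: measurable_cst.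
exact: measurable_st_coord.
Qed.

Lemma LB_ee m : LB mu (ee m).
Proof.
by split; [exact/Borel_Lm/Borel_ee|exists 1; apply: aeW => z; rewrite sqn_ee].
Qed.

Let mu_fin := @spacetime_measure_fin R d.

Lemma LB_L2_st f : LB mu f -> L2 mu f.
Proof. exact: LB_L2 mu_fin _. Qed.

Lemma cintegrable_LB f : LB mu f -> cintegrable mu f.
Proof. by move=> /LB_L2_st; exact: cintegrable_L2. Qed.

(** Half a period of the exponential of frequency m, taken along a single coordinate so that
    functions constant in that coordinate are left invariant. *)
Definition half_shift m (i : 'I_d.+1) : 'I_d.+1 -> R :=
  fun j => if j == i then pi / (m i)%:~R else 0.

Lemma dot_half_shift m i : m i != 0 -> dot m (half_shift m i) = pi.
Proof.
move=> mi; rewrite /dot (bigD1 i)//= /half_shift eqxx big1 ?addr0.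
  by rewrite mulrC divfK// intr_eq0.
by move=> j /negbTE ->; rewrite mulr0.
Qed.

(* Translating by [half_shift m i] preserves the measure and changes the sign
   of the integrand. *)
Lemma cintegral_invariant f m i : L2 mu f -> m i != 0 ->
  ae_equal mu (f \o shift_st (half_shift m i)) f ->
  cI (fun z => f z * ee m z) = 0.
Proof.
move=> f2 mi fs.
have ig : cintegrable mu (fun z => f z * ee m z).
  by apply: cintegrableM => //; exact/LB_L2_st/LB_ee.
have e : cI (fun z => f z * ee m z) = - cI (fun z => f z * ee m z).
  rewrite -mulN1r -cintegralZ//.
  rewrite -(cintegral_preserving (spacetime_rotation (half_shift m i)) ig).
  apply: cintegral_ae; apply: filterS fs => z /= ->.
  by rewrite ee_shift dot_half_shift// expi_pi; ring.
by apply/eqP; rewrite -eqNr -e.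
Qed.

Definition mass : R := fine (mu setT).

Lemma mass_ge0 : 0 <= mass.
Proof. by rewrite fine_ge0. Qed.

Lemma massE : mass%:E = mu setT.
Proof. by rewrite fineK// ge0_fin_numE. Qed.

Lemma nn1 : nn mu (fun=> 1) = mass%:E.
Proof.
by rewrite /nn; under eq_integral do rewrite sqn1; rewrite integral_cst// mul1e massE.
Qed.

Lemma cintegral1 : cI (fun=> 1) = mass%:C%C.
Proof.
rewrite /cintegral /= /Rintegral integral0; apply: ReIm_inj => //=.
by rewrite integral_cst// mul1e.
Qed.

Lemma cintegral_ee m : cI (ee m) = if m == 0 then mass%:C%C else 0.
Proof.
case: eqP => [->|/eqP m0].
  by rewrite -cintegral1; congr cintegral; apply/funext => z; rewrite ee0.
have [i mi] : exists i, m i != 0.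
  apply: contrapT => h; case/eqP : m0; apply/ffunP => i; rewrite ffunE.
  by apply: contrapT => /eqP mi; apply: h; exists i.
rewrite -[RHS](@cintegral_invariant (fun=> 1) m i)//.
- by congr cintegral; apply/funext => z; rewrite mul1r.
- exact/LB_L2_st/LB_cst.
- exact: aeW.
Qed.

Definition trig (P : pred freq) f := exists s : seq (R[i] * freq),
  all (P \o snd) s /\ f = fun z => \sum_(a <- s) a.1 * ee a.2 z.

Lemma trig_ee (P : pred freq) c m : P m -> trig P (fun z => c * ee m z).
Proof.
move=> Pm; exists [:: (c, m)]; split; first by rewrite /= Pm.
by apply/funext => z; rewrite big_seq1.
Qed.

Lemma trig_cst c : trig predT (fun=> c).
Proof.
have [s [ss e]] := @trig_ee predT c 0 isT; exists s; split => //.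
by rewrite -e; apply/funext => z; rewrite ee0 mulr1.
Qed.

Lemma trigW (P Q : pred freq) f : (forall m, P m -> Q m) -> trig P f -> trig Q f.
Proof. by move=> PQ [s [ss ->]]; exists s; split => //; apply: sub_all ss => a /PQ. Qed.

Lemma trigT (P : pred freq) f : trig P f -> trig predT f.
Proof. exact: trigW. Qed.

Lemma trigD P f g : trig P f -> trig P g -> trig P (fun z => f z + g z).
Proof.
move=> [s [ss ->]] [t [tt ->]]; exists (s ++ t); split; first by rewrite all_cat ss.
by apply/funext => z; rewrite big_cat.
Qed.

Lemma trigZ P c f : trig P f -> trig P (fun z => c * f z).
Proof.
move=> [s [ss ->]]; exists [seq (c * a.1, a.2) | a <- s]; split.
  by rewrite all_map.
apply/funext => z; rewrite big_map mulr_sumr.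
by apply: eq_bigr => a _; rewrite mulrA.
Qed.

Lemma trig0 P : trig P (fun=> 0).
Proof. by exists [::]; split => //; apply/funext => z; rewrite big_nil. Qed.

Lemma trig_sum (P : pred freq) (I : Type) (r : seq I) (Q : pred I)
  (F : I -> Z -> R[i]) : (forall i, Q i -> trig P (F i)) ->
  trig P (fun z => \sum_(i <- r | Q i) F i z).
Proof.
move=> tF; elim: r => [|i r ih].
  by under eq_fun do rewrite big_nil; exact: trig0.
under eq_fun do rewrite big_cons; case Qi : (Q i) => //.
by apply: trigD => //; exact: tF.
Qed.

Lemma trigM f g : trig predT f -> trig predT g -> trig predT (fun z => f z * g z).
Proof.
move=> [s [ss ->]] [t [tt ->]].
exists [seq (a.1 * b.1, a.2 + b.2) | a <- s, b <- t]; split.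
  exact: all_predT.
apply/funext => z; rewrite big_allpairs_dep mulr_suml; apply: eq_bigr => a _.
by rewrite mulr_sumr; apply: eq_bigr => b _ /=; rewrite eeD; ring.
Qed.

Lemma LB_trig P f : trig P f -> LB mu f.
Proof.
by move=> [s [_ ->]]; apply: LB_sum => a; apply: LBZ; exact: LB_ee.
Qed.

(** A list with possible repetitions makes sums and products of polynomials immediate; orthogonality
    needs the equal frequencies to be collected. *)
Lemma trig_normal P f : trig P f ->
  exists N (k : 'I_N -> freq) (c : 'I_N -> R[i]),
  [/\ injective k, forall i, P (k i) & f = fun z => \sum_i c i * ee (k i) z].
Proof.
move=> [s [Ps ->]]; pose t := undup (map snd s).
exists (size t), (fun i => tnth (in_tuple t) i).
exists (fun i => \sum_(a <- s | a.2 == tnth (in_tuple t) i) a.1); split.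
- move=> i j; rewrite !(tnth_nth 0) /= => /eqP.
  by rewrite nth_uniq ?undup_uniq ?ltn_ord// => /eqP/val_inj.
- move=> i; have := mem_tnth i (in_tuple t).
  rewrite mem_undup => /mapP[a /(allP Ps) Pa ->]; exact: Pa.
apply/funext => z.
transitivity (\sum_(m <- t) (\sum_(a <- s | a.2 == m) a.1) * ee m z); last first.
  by rewrite big_tnth.
rewrite -[RHS](big_mkcond xpredT)/=.
under [RHS]eq_bigr do rewrite mulr_suml.
rewrite (exchange_big_dep xpredT)//= big_seq [RHS]big_seq.
apply: eq_bigr => a ain.
have at_ : a.2 \in t by rewrite mem_undup map_f.
rewrite (big_rem _ at_)/= eqxx big_seq_cond big1 ?addr0// => m /andP[mt /eqP e].
by move: mt; rewrite -e mem_rem_uniqF// undup_uniq.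
Qed.

End trigonometric_polynomials.

(** * Density of trigonometric polynomials in L^4 *)

Section fourth_power.
Context dT (T : measurableType dT) (R : realType).
Variable mu : {measure set T -> \bar R}.
Implicit Types f g h : T -> R[i].

(** The fourth power of the L^4 norm, written as [nn] of a square so that the results on [nn]
    apply. *)
Definition n4 f : \bar R := nn mu (fun z => f z * f z).

Lemma n4_ae f g : ae_equal mu f g -> n4 f = n4 g.
Proof. by move=> fg; apply: nn_ae; apply: filterS fg => z ->. Qed.

Lemma n4_ge0 f : (0 <= n4 f)%E.
Proof. exact: nn_ge0. Qed.

(** The constant 8 = 2 * 2^2 comes from using (a + b)^2 <= 2 a^2 + 2 b^2 twice. *)
Lemma n4D f g : Lmeasurable mu f -> Lmeasurable mu g ->
  (n4 (fun z => f z + g z)%R <= 8%:E * n4 f + 8%:E * n4 g)%E.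
Proof.
move=> mf mg; apply: nn_leZ2 => //; try exact: LmM.
apply: aeW => z; rewrite !sqnM -!expr2.
have a0 := sqn_ge0 (f z); have b0 := sqn_ge0 (g z).
have s0 := sqn_ge0 (f z + g z).
apply: (@le_trans _ _ ((2 * sqn (f z) + 2 * sqn (g z)) ^+ 2)).
  have := sqnD (f z) (g z); rewrite ler_sqr ?nnegrE//; lra.
rewrite -subr_ge0 (_ : _ - _ = 4 * (sqn (f z) - sqn (g z)) ^+ 2); last by ring.
by rewrite mulr_ge0// sqr_ge0.
Qed.

Lemma n4M_le (M : R) f g : 0 <= M -> {ae mu, forall z, sqn (f z) <= M} ->
  Lmeasurable mu g -> (n4 (fun z => f z * g z)%R <= (M ^+ 2)%:E * n4 g)%E.
Proof.
move=> M0 fM mg; apply: nn_leZ => //; [exact: sqr_ge0|exact: LmM|].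
apply: filterS fM => z fM; rewrite !sqnM mulrACA -!expr2 ler_wpM2r ?sqr_ge0//.
by rewrite ler_sqr ?nnegrE ?sqn_ge0.
Qed.

Lemma n4_le_bound (e : R) f : 0 <= e ->
  {ae mu, forall z, sqn (f z) <= e} -> (n4 f <= (e ^+ 2)%:E * mu setT)%E.
Proof.
move=> e0 fe; apply: (@le_trans _ _ ((e ^+ 2)%:E * nn mu (fun=> 1%R))%E).
  apply: nn_leZ; [exact: sqr_ge0|exact: Lm_cst|].
  apply: filterS fe => z fe; rewrite sqn1 mulr1 sqnM -expr2.
  by rewrite ler_sqr ?nnegrE ?sqn_ge0.
by rewrite /nn; under eq_integral do rewrite sqn1; rewrite integral_cst// mul1e.
Qed.

Hypothesis mu_fin : (mu setT < +oo)%E.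

Lemma n4_bounded_approx (M : R) (F : nat -> T -> R[i]) f (e : R) :
  (forall n, Borel_complex (F n)) -> Borel_complex f ->
  (forall n z, sqn (f z - F n z) <= M) ->
  (forall z, (fun n => sqn (f z - F n z)) @ \oo --> (0 : R)) -> 0 < e ->
  exists n, (n4 (fun z => f z - F n z)%R <= e%:E)%E.
Proof.
move=> bF bf FM Ff e0.
have bD n : Borel_complex (fun z => f z - F n z).
  apply: BorelD => //; under eq_fun do rewrite -mulN1r.
  by apply: BorelM => //; exact: Borel_cst.
have sq0 n z : sqn (0 - (f z - F n z) * (f z - F n z)) = sqn (f z - F n z) ^+ 2.
  by rewrite sub0r sqnN sqnM.
have [n ne] : exists n, (nn mu (fun z => 0 - (f z - F n z) * (f z - F n z))%R
    <= e%:E)%E.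
  apply: (@nn_dominated_approx _ _ _ mu (fun n z => (f z - F n z) * (f z - F n z))
    (fun=> 0) (fun=> (M%:C)%C) e) => //.
  - by move=> n; exact: BorelM.
  - by have [] := LB_L2 mu_fin (LB_cst mu (M%:C)%C).
  - move=> n z; rewrite sq0 sqnC ler_sqr ?nnegrE ?sqn_ge0//.
    exact: le_trans (sqn_ge0 _) (FM n z).
  - move=> z; have H : (fun n => sqn (f z - F n z) * sqn (f z - F n z)) @ \oo -->
        (0 * 0 : R) by apply: cvgM; exact: Ff.
    rewrite mulr0 in H; apply: (cvg_trans _ H); apply: near_eq_cvg; near=> n.
    by rewrite sq0 expr2.
exists n; apply: le_trans ne; apply: nn_le; apply: aeW => z.
by rewrite sq0 sqnM expr2.
Unshelve. all: by end_near. Qed.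

(** With x = |f|^2, pointwise x <= a + x^2 / a: either x <= a, or x <= x^2 / a. The parameter a is
    free to balance the two terms. *)
Lemma nn_le_n4 (a : R) f : 0 < a -> Lmeasurable mu f ->
  (nn mu f <= a%:E * mu setT + a^-1%:E * n4 f)%E.
Proof.
move=> a0 mf.
have -> : mu setT = nn mu (fun=> 1).
  by rewrite /nn; under eq_integral do rewrite sqn1; rewrite integral_cst// mul1e.
apply: nn_leZ2; rewrite ?invr_ge0 ?(ltW a0)//; [exact: Lm_cst|exact: LmM|].
apply: aeW => z; rewrite sqn1 mulr1 sqnM; set x := sqn _.
have x0 : 0 <= x by exact: sqn_ge0.
have [h|h] := leP x a.
  by rewrite (le_trans h)// lerDl mulr_ge0 ?mulr_ge0 ?invr_ge0 ?(ltW a0).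
rewrite ler_wpDl ?(ltW a0)// mulrA ler_peMl// mulrC ler_pdivlMr// mul1r.
exact: ltW.
Qed.

End fourth_power.

Section bernoulli.
Variable R : realType.
Implicit Types (x y : R) (n j : nat).

Lemma bernoulli_ge x n : 0 <= x <= 1 -> 1 - n%:R * x <= (1 - x) ^+ n.
Proof.
move=> /andP[x0 x1]; elim: n => [|n ih]; first by rewrite mul0r subr0.
rewrite exprS; apply: (@le_trans _ _ ((1 - x) * (1 - n%:R * x))).
  have n0 : 0 <= n%:R :> R by [].
  rewrite -addn1 natrD -subr_ge0.
  rewrite (_ : _ - _ = n%:R * x ^+ 2); last by ring.
  by rewrite mulr_ge0 ?sqr_ge0.
by rewrite ler_wpM2l// subr_ge0.
Qed.

(** The bound (1 - x)^n <= 1 / (1 + n x), which yields decay once n x is large; each factor gains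
    since (1 - x) (1 + (n + 1) x) <= 1 + n x. *)
Lemma bernoulli_le x n : 0 <= x <= 1 -> (1 - x) ^+ n * (1 + n%:R * x) <= 1.
Proof.
move=> /andP[x0 x1]; elim: n => [|n ih]; first by rewrite mul0r addr0 mulr1.
apply: le_trans ih; rewrite exprSr -mulrA ler_wpM2l ?exprn_ge0 ?subr_ge0//.
have n0 : 0 <= n%:R :> R by [].
rewrite -addn1 natrD -subr_ge0.
rewrite (_ : _ - _ = (n%:R + 1) * x ^+ 2); last by ring.
by rewrite mulr_ge0 ?sqr_ge0 ?addr_ge0.
Qed.

(* These polynomials converge on [0, 1] to the indicator of [0, 1/2]: with
   n = j^2 and N = 2^(j^2 - j), the quantity N y^n tends to 0 for y <= 1/2 and
   to infinity for y > 1/2. *)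
Definition threshold j y : R := (1 - y ^+ (j * j)) ^+ (2 ^ (j * j - j)).

Lemma threshold_itv j y : 0 <= y <= 1 -> 0 <= threshold j y <= 1.
Proof.
move=> /andP[y0 y1]; have h1 : y ^+ (j * j) <= 1 by rewrite exprn_ile1.
by rewrite /threshold exprn_ge0 ?subr_ge0//= exprn_ile1 ?subr_ge0// gerBl exprn_ge0.
Qed.

Lemma expr2_split j : (2 : R) ^+ (j * j) = 2 ^+ (j * j - j) * 2 ^+ j.
Proof. by rewrite -exprD subnK//; case: j => // j; rewrite leq_pmull. Qed.

Lemma threshold_low j y : 0 <= y <= 2^-1 -> 1 - (2^-1) ^+ j <= threshold j y.
Proof.
move=> /andP[y0 y1]; have yle1 : y <= 1 by lra.
apply: (le_trans _ (bernoulli_ge _ _)); last first.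
  by rewrite exprn_ge0//= exprn_ile1.
rewrite lerD2l lerN2 natrX.
apply: (@le_trans _ _ (2 ^+ (j * j - j) * (2^-1) ^+ (j * j))).
  by rewrite ler_wpM2l ?exprn_ge0// lerXn2r ?nnegrE.
by rewrite !exprVn expr2_split invfM mulrA divff ?mul1r// expf_neq0.
Qed.

(** Raising the hypothesis to the power j gives (2 y)^(j^2) >= 4^j, so that 2^(j^2 - j) y^(j^2) = (2
    y)^(j^2) / 2^j >= 2^j, and [bernoulli_le] applies. *)
Lemma threshold_high j y : 2^-1 < y <= 1 -> 4 <= (2 * y) ^+ j ->
  threshold j y <= (2^-1) ^+ j.
Proof.
move=> /andP[y0 y1] hj.
have yy : 0 <= y by apply: le_trans (ltW y0); rewrite invr_ge0.
have yi : 0 <= y <= 1 by rewrite yy.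
have /andP[ty _] := threshold_itv j yi.
have yn : 0 <= y ^+ (j * j) <= 1 by rewrite exprn_ge0//= exprn_ile1.
have := bernoulli_le (2 ^ (j * j - j)) yn; rewrite -/(threshold j y).
move=> /(le_trans _) H; rewrite exprVn -[leRHS]mul1r.
rewrite ler_pdivlMr ?exprn_gt0//; apply: H; rewrite ler_wpM2l// natrX.
suff h : 2 ^+ j <= 2 ^+ (j * j - j) * y ^+ (j * j) :> R.
  by rewrite (le_trans h)// lerDr.
rewrite -(ler_pM2r (_ : 0 < 2 ^+ j)) ?exprn_gt0// mulrAC -expr2_split.
rewrite -exprMn -exprMn (_ : 2 * 2 = 4); last by ring.
by rewrite exprM lerXn2r ?nnegrE ?exprn_ge0 ?mulr_ge0.
Qed.

Lemma threshold_near y : 0 <= y <= 1 -> exists j0, forall j, (j0 <= j)%N ->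
  `|threshold j y - (y <= 2^-1)%R%:R| <= (2^-1) ^+ j.
Proof.
move=> yi; have /andP[y0 y1] := yi; have [h|h] := leP y 2^-1.
  exists 0%N => j _; have /andP[_ t1] := threshold_itv j yi.
  rewrite (_ : true%:R = 1)// ler0_norm ?subr_le0// opprB.
  have := @threshold_low j y; rewrite y0 h => /(_ isT); lra.
have [j0 hj0] : exists j0, 4 <= (2 * y) ^+ j0.
  (* The bound (1 + x)^n >= n x shows that every integer n > 4 / x is suitable. *)
  pose x := 2 * y - 1.
  have x0 : 0 < x by rewrite /x; lra.
  exists (Num.truncn (4 / x)).+1.
  have := truncnS_gt (4 / x); rewrite ltr_pdivrMr// => h4.
  apply: (le_trans (ltW h4)); rewrite (_ : 2 * y = 1 + x); last by rewrite /x; ring.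
  elim: (Num.truncn _).+1 => [|n ih]; first by rewrite mul0r.
  have -> : n.+1%:R * x = n%:R * x + x by rewrite -addn1 natrD mulrDl mul1r.
  have -> : (1 + x) ^+ n.+1 = (1 + x) ^+ n + (1 + x) ^+ n * x.
    by rewrite exprSr mulrDr mulr1.
  rewrite lerD//.
  by rewrite ler_peMl ?(ltW x0)// exprn_ege1// lerDl ltW.
exists j0 => j jj; have /andP[t0 _] := threshold_itv j yi.
rewrite (_ : false%:R = 0)// subr0 ger0_norm// threshold_high ?h//.
apply: (le_trans hj0); rewrite ler_weXn2l//; lra.
Qed.

End bernoulli.

Section fundamental_cell.
Variable R : realType.
Local Notation mR := (measurableTypeR R).

(* The reduction map preserves the measure and takes its values in the
   fundamental cell. *)
Lemma ae_fundamental_cell d : {ae @spacetime_measure R d, forall z : spacetime R d,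
  forall i, 0 <= st_coord z i < 2 * pi}.
Proof.
pose A := [set z : spacetime R d | forall i, 0 <= st_coord z i < 2 * pi].
have mA : measurable A.
  rewrite (_ : A = \bigcap_(i in [set: 'I_d.+1])
      ((fun z => st_coord z i : mR) @^-1` `[0, 2 * pi[)); last first.
    apply/seteqP; split => z h i; first by move=> _; rewrite /= in_itv/=; exact: h.
    by have := h i I; rewrite /= in_itv.
  apply: fin_bigcap_measurable => // i _.
  by rewrite -[X in measurable X]setTI; exact: measurable_st_coord.
have [_ p] := @spacetime_rotation R d (fun=> 0).
exists (~` A); split => //; first exact: measurableC.
rewrite -p; last exact: measurableC.
rewrite (_ : _ @^-1` _ = set0) ?measure0//.
apply/seteqP; split => z //=; apply => i.
by rewrite st_coord_shift; exact: red_itv.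
Qed.

(** [0, a] is the arc with midpoint a / 2, and the cosine decreases with the angular distance to the
    midpoint. An interval is thus a superlevel set of a trigonometric polynomial of degree one. *)
Lemma cos_arc (a x : R) : 0 <= a < 2 * pi -> 0 <= x < 2 * pi ->
  (cos (a / 2) <= cos (x - a / 2)) = (x <= a).
Proof.
move=> /andP[a0 a1] /andP[x0 x1].
have hp := pi_gt0 R.
have ha : a / 2 \in `[0, pi]%R by rewrite in_itv /=; lra.
have [h|h] := leP (x - a / 2) pi.
  rewrite -(cos_norm (x - a / 2)).
  have hx : `|x - a / 2| \in `[0, pi]%R.
    by rewrite in_itv /= normr_ge0 ler_norml; lra.
  rewrite leNgt (ltr_cos ha hx) -leNgt ler_norml.
  by apply/idP/idP; lra.
(* Past pi, the shorter way to the midpoint goes around the circle in the other direction. *)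
have -> : cos (x - a / 2) = cos (2 * pi - (x - a / 2)).
  have -> : 2 * pi - (x - a / 2) = - (x - a / 2) + pi *+ 2 by rewrite mulr2n; ring.
  by rewrite cosD2pi cosN.
have hx : 2 * pi - (x - a / 2) \in `[0, pi]%R by rewrite in_itv /=; lra.
by rewrite leNgt (ltr_cos ha hx) -leNgt; apply/idP/idP; lra.
Qed.

End fundamental_cell.

Section density.
Variables (R : realType) (d : nat).
Local Notation Z := (spacetime R d).
Local Notation mu := (@spacetime_measure R d).
Local Notation mR := (measurableTypeR R).
Implicit Types f g : Z -> R[i].

Let mu_fin := @spacetime_measure_fin R d.

Definition trig_dense f := LB mu f /\ forall e : R, 0 < e ->
  exists p, trig predT p /\ (n4 mu (fun z => f z - p z)%R <= e%:E)%E.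

Lemma dense_ae f g : ae_equal mu f g -> trig_dense f -> trig_dense g.
Proof.
move=> fg [bf df]; split; first exact: LB_ae fg bf.
move=> e /df[p [tp fp]]; exists p; split => //.
rewrite (n4_ae (g := fun z => f z - p z))//.
by apply: filterS fg => z ->.
Qed.

Lemma dense_close f : LB mu f ->
  (forall e : R, 0 < e -> exists g, trig_dense g /\
     (n4 mu (fun z => f z - g z)%R <= e%:E)%E) -> trig_dense f.
Proof.
move=> bf df; split => // e e0.
have e16 : 0 < e / 16 by rewrite divr_gt0.
have [g [[bg dg] fg]] := df _ e16; have [p [tp gp]] := dg _ e16.
exists p; split => //.
rewrite (_ : (fun z => f z - p z) = fun z => (f z - g z) + (g z - p z)); last first.
  by apply/funext => z; rewrite addrA subrK.
apply: le_trans (n4D (LBB bf bg).1 (LBB bg (LB_trig tp)).1) _.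
rewrite (_ : e%:E = 8%:E * (e / 16)%:E + 8%:E * (e / 16)%:E)%E; last first.
  by rewrite -!EFinM -EFinD; congr EFin; lra.
by rewrite leeD// lee_pmul2l.
Qed.

Lemma dense_trig f : trig predT f -> trig_dense f.
Proof.
move=> tf; split; first exact: LB_trig tf.
move=> e e0; exists f; split => //.
rewrite (_ : (fun z => f z - f z) = fun=> 0); last first.
  by apply/funext => z; rewrite subrr.
by rewrite /n4 mulr0 nn0 lee_fin ltW.
Qed.

Lemma denseD f g : trig_dense f -> trig_dense g ->
  trig_dense (fun z => f z + g z).
Proof.
move=> [bf df] [bg dg]; split; first exact: LBD.
move=> e e0; have e16 : 0 < e / 16 by rewrite divr_gt0.
have [p [tp fp]] := df _ e16; have [q [tq gq]] := dg _ e16.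
exists (fun z => p z + q z); split; first exact: trigD.
rewrite (_ : (fun z => _) = fun z => (f z - p z) + (g z - q z)); last first.
  by apply/funext => z; ring.
apply: le_trans (n4D (LBB bf (LB_trig tp)).1 (LBB bg (LB_trig tq)).1) _.
rewrite (_ : e%:E = 8%:E * (e / 16)%:E + 8%:E * (e / 16)%:E)%E; last first.
  by rewrite -!EFinM -EFinD; congr EFin; lra.
by rewrite leeD// lee_pmul2l.
Qed.

Lemma denseM f g : trig_dense f -> trig_dense g ->
  trig_dense (fun z => f z * g z).
Proof.
move=> [bf df] [bg dg]; split; first exact: LBM.
move=> e e0; have [mf [M M0 fM]] := (LBP mu f).1 bf.
have M1 : 0 < M ^+ 2 + 1 by rewrite ltr_wpDl// sqr_ge0.
have [q [tq gq]] := dg (e / (16 * (M ^+ 2 + 1))) ltac:(by rewrite divr_gt0// mulr_gt0).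
have [mq [N N0 qN]] := (LBP mu q).1 (LB_trig tq).
have N1 : 0 < N ^+ 2 + 1 by rewrite ltr_wpDl// sqr_ge0.
(* The accuracy of p depends on the bound N of q, so p comes after q; accordingly f g - p q is split
   as f (g - q) + q (f - p), where p does not appear as a factor. *)
have [p [tp fp]] := df (e / (16 * (N ^+ 2 + 1))) ltac:(by rewrite divr_gt0// mulr_gt0).
exists (fun z => p z * q z); split; first exact: trigM.
have bfp := LBB bf (LB_trig tp); have bgq := LBB bg (LB_trig tq).
rewrite (_ : (fun z => _) = fun z => f z * (g z - q z) + q z * (f z - p z));
  last by apply/funext => z; ring.
apply: le_trans (n4D (LBM bf bgq).1 (LBM (LB_trig tq) bfp).1) _.
have bound (K : R) x : 0 <= K -> (x <= (e / (16 * (K ^+ 2 + 1)))%:E)%E ->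
    ((K ^+ 2)%:E * x <= (e / 16)%:E)%E.
  move=> K0 xe; apply: (@le_trans _ _ ((K ^+ 2)%:E * (e / (16 * (K ^+ 2 + 1)))%:E)%E).
    by rewrite lee_wpmul2l// lee_fin sqr_ge0.
  have K1 : 0 < K ^+ 2 + 1 by rewrite ltr_wpDl// sqr_ge0.
  rewrite -EFinM lee_fin.
  have -> : K ^+ 2 * (e / (16 * (K ^+ 2 + 1))) = e / 16 * (K ^+ 2 / (K ^+ 2 + 1)).
    by field; rewrite gt_eqF.
  by rewrite ger_pMr ?divr_gt0// ler_pdivrMr// mul1r lerDl.
rewrite (_ : e%:E = 8%:E * (e / 16)%:E + 8%:E * (e / 16)%:E)%E; last first.
  by rewrite -!EFinM -EFinD; congr EFin; lra.
rewrite leeD// lee_pmul2l//.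
  exact: le_trans (n4M_le M0 fM bgq.1) (bound _ _ M0 gq).
exact: le_trans (n4M_le N0 qN bfp.1) (bound _ _ N0 fp).
Qed.

End density.

Section density_theorem.
Variables (R : realType) (d : nat).
Local Notation Z := (spacetime R d).
Local Notation mu := (@spacetime_measure R d).
Local Notation mR := (measurableTypeR R).
Implicit Types f g : Z -> R[i].

Let mu_fin := @spacetime_measure_fin R d.

Definition ind (A : set Z) : Z -> R[i] := fun z => ((\1_A z : R)%:C)%C.

Lemma Borel_ind (A : set Z) : measurable A -> Borel_complex (ind A).
Proof. by move=> mA; apply: BorelC; exact: measurable_indic. Qed.

Lemma ind01 (A : set Z) z : 0 <= (\1_A z : R) <= 1.
Proof. by rewrite indicE; case: (_ \in _); rewrite ?lexx ?ler01. Qed.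

Lemma sqn_ind_le1 (A : set Z) z : sqn (ind A z) <= 1.
Proof.
by rewrite sqnC; have /andP[h0 h1] := ind01 A z; rewrite exprn_ile1.
Qed.

Lemma LB_ind (A : set Z) : measurable A -> LB mu (ind A).
Proof.
move=> mA; split; first exact/Borel_Lm/Borel_ind.
by exists 1; apply: aeW; exact: sqn_ind_le1.
Qed.

Lemma indC (A : set Z) : ind (~` A) = fun z => 1 + (-1) * ind A z.
Proof.
apply/funext => z; rewrite /ind !indicE in_setC.
by case: (z \in A); rewrite /= ?mulr0 ?addr0// mulN1r subrr.
Qed.

Lemma indI (A B : set Z) : ind (A `&` B) = fun z => ind A z * ind B z.
Proof.
apply/funext => z; rewrite /ind !indicE in_setI.
by case: (z \in A); case: (z \in B); rewrite /= ?mulr0 ?mul0r ?mulr1.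
Qed.

Lemma dense_cst (c : R[i]) : trig_dense ((fun=> c) : Z -> R[i]).
Proof. exact/dense_trig/trig_cst. Qed.

Definition dense_set (A : set Z) := measurable A /\ trig_dense (ind A).

Lemma dense_setC A : dense_set A -> dense_set (~` A).
Proof.
move=> [mA dA]; split; first exact: measurableC.
rewrite indC; apply: denseD; first exact: dense_cst.
by apply: denseM => //; exact: dense_cst.
Qed.

Lemma dense_setI A B : dense_set A -> dense_set B -> dense_set (A `&` B).
Proof.
move=> [mA dA] [mB dB]; split; first exact: measurableI.
by rewrite indI; exact: denseM.
Qed.

Lemma dense_set0 : dense_set set0.
Proof.
split; first exact: measurable0.
rewrite (_ : ind set0 = fun=> 0); first exact: dense_cst.
by apply/funext => z; rewrite /ind indic0.
Qed.

Lemma dense_setU A B : dense_set A -> dense_set B -> dense_set (A `|` B).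
Proof.
move=> sA sB; rewrite -(setCK (A `|` B)) setCU.
by apply: dense_setC; apply: dense_setI; exact: dense_setC.
Qed.

Lemma dense_set_ae (A B : set Z) : measurable B -> {ae mu, forall z, A z <-> B z} ->
  dense_set A -> dense_set B.
Proof.
move=> mB AB [mA dA]; split => //; apply: dense_ae dA.
apply: filterS AB => z AB; rewrite /ind !indicE.
by rewrite (_ : (z \in A) = (z \in B))//; apply/idP/idP; rewrite !inE => /AB.
Qed.

Lemma dense_bounded_cvg (M : R) (F : nat -> Z -> R[i]) f :
  (forall n, Borel_complex (F n)) -> Borel_complex f -> LB mu f ->
  (forall n, trig_dense (F n)) ->
  (forall n z, sqn (f z - F n z) <= M) ->
  (forall z, (fun n => sqn (f z - F n z)) @ \oo --> (0 : R)) ->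
  trig_dense f.
Proof.
move=> bF bf lf dF FM Ff; apply: dense_close => // e e0.
by have [n ne] := n4_bounded_approx mu_fin bF bf FM Ff e0; exists (F n).
Qed.

(** Finite unions come from products of indicators; a countable union is the increasing limit of
    finite ones, and dominated convergence applies. *)
Lemma sigma_algebra_dense_set : sigma_algebra setT dense_set.
Proof.
split => [|A|A sA]; first exact: dense_set0.
  by rewrite setTD; exact: dense_setC.
pose B n := \bigcup_(k < n) A k.
have sB n : dense_set (B n).
  elim: n => [|n ih]; first by rewrite /B bigcup_mkord big_ord0; exact: dense_set0.
  rewrite /B bigcup_mkord big_ord_recr /= -bigcup_mkord; exact: dense_setU.
have mA : measurable (\bigcup_k A k) by apply: bigcup_measurable => k _; exact: (sA k).1.
split => //.
have E n z : ind (B n) z = ind (\bigcup_k A k) z \/ ind (\bigcup_k A k) z - ind (B n) z = 1.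
  rewrite /ind !indicE; case: (boolP (z \in B n)) => zB.
    left; rewrite (_ : z \in \bigcup_k A k)//.
    by move: zB; rewrite !inE => -[k _ Akz]; exists k.
  by case: (z \in \bigcup_k A k); [right; rewrite subr0|left].
apply: (@dense_bounded_cvg 1 (fun n => ind (B n))) => //.
- by move=> n; apply: Borel_ind; exact: (sB n).1.
- exact: Borel_ind.
- exact: LB_ind.
- by move=> n; exact: (sB n).2.
- move=> n z; have [->|->] := E n z; first by rewrite subrr sqn0.
  by rewrite sqn1.
- move=> z; apply: cvg_near_cst; have [[k _ Akz]|nA] := pselect ((\bigcup_k A k) z).
    exists k.+1 => // n /= kn; rewrite /ind !indicE.
    have -> : z \in B n by rewrite inE; exists k.
    have -> : z \in \bigcup_k A k by rewrite inE; exists k.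
    by rewrite subrr sqn0.
  exists 0%N => // n _ /=; rewrite /ind !indicE.
  have -> : z \in B n = false.
    by apply/negbTE; rewrite notin_setE => -[k _ Akz]; apply: nA; exists k.
  have -> : z \in \bigcup_k A k = false by apply/negbTE; rewrite notin_setE.
  by rewrite subrr sqn0.
Qed.

Lemma dense_exp f n : trig_dense f -> trig_dense (fun z => f z ^+ n).
Proof.
move=> df; elim: n => [|n ih]; first exact: dense_cst.
by under eq_fun do rewrite exprS; exact: denseM.
Qed.

Lemma dense_superlevel (g : Z -> R) (c : R) : measurable_fun setT g ->
  trig_dense (fun z => ((g z)%:C)%C) -> (forall z, `|g z| <= 1) -> `|c| <= 1 ->
  dense_set [set z | c <= g z].
Proof.
(* The affine change of variable sends g to [0, 1], as |c - g| <= 2, and turns c <= g into y <= 1/2,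
   the cut of [threshold]. *)
move=> mg dg g1 c1; pose y z := 2^-1 + (c - g z) / 4.
have y01 z : 0 <= y z <= 1.
  by have := g1 z; move: c1; rewrite !ler_norml /y; lra.
have dy : trig_dense (fun z => ((y z)%:C)%C).
  rewrite (_ : (fun z => _) = fun z =>
      ((2^-1 + c / 4)%:C)%C + ((- 4^-1)%:C)%C * ((g z)%:C)%C); last first.
    apply/funext => z; rewrite -rmorphM -rmorphD /y; congr (_%:C)%C; lra.
  by apply: denseD; [exact: dense_cst|apply: denseM => //; exact: dense_cst].
have my : measurable_fun setT y.
  apply: measurable_funD; first exact: measurable_cst.
  by apply: measurable_funM => //; apply: measurable_funB.
have mA : measurable [set z | c <= g z].
  rewrite (_ : [set z | _] = g @^-1` `[c, +oo[%classic); last first.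
    by apply/seteqP; split => z /=; rewrite in_itv/= andbT.
  by rewrite -[X in measurable X]setTI; apply: mg => //; exact: measurable_itv.
have mq j : measurable_fun setT (fun z => threshold j (y z)).
  apply: measurable_funX; apply: measurable_funB; first exact: measurable_cst.
  exact: measurable_funX.
have indE z : (\1_[set z | c <= g z] z : R) = (y z <= 2^-1)%R%:R.
  rewrite indicE; congr ((nat_of_bool _)%:R).
  by apply/idP/idP; rewrite inE /= /y; lra.
split => //.
apply: (@dense_bounded_cvg 1 (fun j z => ((threshold j (y z))%:C)%C)).
- by move=> j; exact: BorelC.
- exact: Borel_ind.
- exact: LB_ind.
- move=> j; rewrite (_ : (fun z => _) = fun z =>
      (1 + (-1) * ((y z)%:C)%C ^+ (j * j)) ^+ (2 ^ (j * j - j))).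
    apply: dense_exp; apply: denseD; first exact: dense_cst.
    by apply: denseM; [exact: dense_cst|exact: dense_exp].
  by apply/funext => z; rewrite /threshold rmorphXn rmorphB rmorphXn rmorph1 mulN1r.
- move=> j z; rewrite /ind -rmorphB sqnC.
  have /andP[t0 t1] := threshold_itv j (y01 z).
  have /andP[i0 i1] := ind01 [set z | c <= g z] z.
  set w := _ - threshold j (y z).
  have : 0 <= (1 - w) * (1 + w) by apply: mulr_ge0; rewrite /w; lra.
  by rewrite (_ : (1 - w) * (1 + w) = 1 - w ^+ 2) ?subr_ge0//; ring.
- move=> z; have [j0 hj] := threshold_near (y01 z).
  apply: (@squeeze_cvgr _ _ _ _ (fun=> 0) (fun j => (2^-1) ^+ j)).
  + exists j0 => // j /= /hj; rewrite /ind -rmorphB sqnC indE sqr_ge0/= distrC.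
    set w := _ - _; set q := _ ^+ j => wq; rewrite -real_normK ?num_real//.
    have q0 : 0 <= q by apply: le_trans wq.
    have q1 : q <= 1 by rewrite exprn_ile1//; lra.
    by apply: (@le_trans _ _ (q ^+ 2)); [rewrite lerXn2r|rewrite expr2 ler_piMr].
  + exact: cvg_cst.
  + by apply: cvg_expr; rewrite ger0_norm; lra.
Qed.

Lemma measurable_dense_set_coord i (B : set mR) : measurable B ->
  dense_set [set z : Z | B (st_coord z i)].
Proof.
have mc : measurable_fun setT (fun z : Z => st_coord z i : mR).
  exact: measurable_st_coord.
(* Up to a null set a ray is empty, everything, or an arc of the circle; arcs are superlevel sets by
   [cos_arc]. *)
have ray (a : R) : dense_set [set z : Z | st_coord z i <= a].
  have mray : measurable [set z : Z | st_coord z i <= a].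
    rewrite (_ : [set z | _] = (fun z : Z => st_coord z i : mR) @^-1`
        `]-oo, a]%classic); last by apply/seteqP; split => z /=; rewrite in_itv.
    by rewrite -[X in measurable X]setTI; apply: mc => //; exact: measurable_itv.
  have [a0|a0] := ltP a 0.
    apply: dense_set_ae dense_set0 => //.
    apply: filterS (@ae_fundamental_cell R d) => z /(_ i)/andP[z0 z1] /=.
    by split => //; lra.
  have [a1|a1] := ltP a (2 * pi); last first.
    apply: (@dense_set_ae (~` set0)) => //; last first.
      by apply: dense_setC; exact: dense_set0.
    apply: filterS (@ae_fundamental_cell R d) => z /(_ i)/andP[z0 z1] /=.
    by split => // _; lra.
  pose g (z : Z) := cos (st_coord z i - a / 2).
  apply: (@dense_set_ae [set z | cos (a / 2) <= g z]) => //.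
    apply: filterS (@ae_fundamental_cell R d) => z /(_ i) hz /=.
    by rewrite /g cos_arc ?a0 ?a1.
  apply: dense_superlevel; [| |by move=> z; exact: cos_max|exact: cos_max].
    apply: (measurableT_comp (@measurable_cos R)).
    by apply: measurable_funB => //; exact: measurable_cst.
  pose m : freq d := [ffun j => (j == i)%:Z].
  apply: dense_trig.
  rewrite (_ : (fun z => _) = fun z => (expi (- (a / 2)) / 2) * ee m z +
      (expi (a / 2) / 2) * ee (- m) z); last first.
    apply/funext => z; rewrite -eeJ /ee.
    have -> : dot m (st_coord z) = st_coord z i.
      rewrite /dot (bigD1 i)//= ffunE eqxx mul1r big1 ?addr0// => j ji.
      by rewrite ffunE (negbTE ji) mul0r.
    rewrite mulrAC -expiD mulrAC expiJ -expiD -mulrDl.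
    rewrite (_ : a / 2 + - _ = - (- (a / 2) + st_coord z i)); last by ring.
    rewrite -expiJ addcJ mulrC mulKf ?pnatr_eq0//.
    by rewrite /g /= addrC.
  by apply: trigD; exact: trig_ee.
move=> mB; have := mB; rewrite /measurable /= => mB'.
(* The sets with a dense preimage form a sigma-algebra, so it suffices to treat half-open intervals,
   which are differences of rays. *)
suff : measurable `<=` image_set_system setT (fun z : Z => st_coord z i : mR) dense_set.
  by move=> /(_ _ mB); rewrite /image_set_system /= setTI.
apply: smallest_sub.
  exact: sigma_algebra_image sigma_algebra_dense_set.
move=> _ [[a b] _ <-]; rewrite /image_set_system /= setTI.
rewrite (_ : _ @^-1` _ = [set z | st_coord z i <= b] `&`
    ~` [set z | st_coord z i <= a]); last first.
  apply/seteqP; split => z /=; rewrite in_itv/=.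
    by move=> /andP[h1 h2]; split => //; apply/negP; rewrite -ltNge.
  by move=> [h2 /negP]; rewrite -ltNge => ->.
by apply: dense_setI => //; exact: dense_setC.
Qed.

Lemma measurable_dense_set (A : set Z) : measurable A -> dense_set A.
Proof.
move=> mA; suff : measurable `<=` dense_set by exact.
apply: smallest_sub; first exact: sigma_algebra_dense_set.
move=> _ [] [B mB <-]; rewrite setTI.
  rewrite (_ : _ @^-1` _ = [set z : Z | B (st_coord z ord0)]).
    exact: measurable_dense_set_coord.
  by apply/seteqP; split => z /=; rewrite st_coord0.
suff : measurable `<=` image_set_system setT (snd : Z -> d.-tuple mR) dense_set.
  by move=> /(_ _ mB); rewrite /image_set_system /= setTI.
apply: smallest_sub.
  exact: sigma_algebra_image sigma_algebra_dense_set.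
move=> E; rewrite /= -bigcup_seq => -[i _ [C mC <-]].
rewrite /image_set_system /= !setTI.
rewrite (_ : _ @^-1` _ = [set z : Z | C (st_coord z (lift ord0 i))]).
  exact: measurable_dense_set_coord.
by apply/seteqP; split => z /=; rewrite st_coordS.
Qed.

Lemma dense_sum (I : Type) (r : seq I) (F : I -> Z -> R[i]) :
  (forall i, trig_dense (F i)) -> trig_dense (fun z => \sum_(i <- r) F i z).
Proof.
move=> dF; elim: r => [|i r ih].
  by under eq_fun do rewrite big_nil; exact: dense_cst.
by under eq_fun do rewrite big_cons; exact: denseD.
Qed.

(* A bounded measurable function is uniformly close to a finite combination
   of the indicators of its level sets. *)
Lemma dense_bounded_measurable (h : Z -> R) (K : R) : measurable_fun setT h ->
  (forall z, `|h z| <= K) -> trig_dense (fun z => ((h z)%:C)%C).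
Proof.
move=> mh hK; have K0 : 0 <= K.
  exact: le_trans (normr_ge0 _) (hK point).
apply: dense_close.
  split; first exact/Borel_Lm/BorelC.
  exists (K ^+ 2); apply: aeW => z; rewrite sqnC -real_normK ?num_real//.
  by rewrite lerXn2r ?nnegrE.
move=> e e0; have m0 := @mass_ge0 R d.
(* Levels of width q = 1 / (n + 1) give an error of at most q^4 times the mass, hence at most q
   times the mass, which is at most e. *)
have [n nP] : exists n : nat, mass R d <= e * n.+1%:R.
  exists (Num.truncn (mass R d / e)); rewrite -ler_pdivrMl// mulrC ltW//.
  exact: truncnS_gt.
have n0 : 0 < n.+1%:R :> R by [].
have n1 : 1 <= n.+1%:R :> R by rewrite ler1n.
pose H z := n.+1%:R * (h z + K).
pose A j := [set z | j%:R <= H z] `&` [set z | H z < j.+1%:R].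
have mH : measurable_fun setT H.
  apply: measurable_funM; first exact: measurable_cst.
  by apply: measurable_funD => //; exact: measurable_cst.
have mA j : measurable (A j).
  rewrite (_ : A j = H @^-1` `[j%:R, j.+1%:R[%classic); last first.
    apply/seteqP; split => z /=; rewrite in_itv/=; first by move=> [-> ->].
    by move=> /andP[].
  by rewrite -[X in measurable X]setTI; apply: mH => //; exact: measurable_itv.
pose N := (Num.truncn (n.+1%:R * (K + K))).+1.
pose g z : R[i] := \sum_(j < N) ((j%:R / n.+1%:R - K)%:C)%C * ind (A j) z.
have gE z : exists2 r : R, g z = (r%:C)%C & 0 <= h z - r <= n.+1%:R^-1.
  have H0 : 0 <= H z.
    by rewrite mulr_ge0//; have := hK z; rewrite ler_norml; lra.
  have HN : (Num.truncn (H z) < N)%N.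
    rewrite ltnS le_truncn// ler_wpM2l//.
    by have := hK z; rewrite ler_norml; lra.
  have /andP[t1 t2] := truncn_itv H0.
  exists ((Num.truncn (H z))%:R / n.+1%:R - K).
    rewrite /g (bigD1 (Ordinal HN))//= big1 ?addr0.
      rewrite /ind indicE (_ : z \in _); last by rewrite inE.
      by rewrite mulr1.
    move=> j jN; rewrite /ind indicE (_ : z \in A j = false) ?mulr0//.
    apply/negbTE; rewrite notin_setE => -[/= j1 j2].
    case/eqP : jN; apply/val_inj => /=.
    by apply/esym/truncn_def; rewrite j1 j2.
  have hH : h z = H z / n.+1%:R - K by rewrite /H mulrC mulKf ?gt_eqF// addrK.
  set t := (Num.truncn (H z))%:R in t1 *.
  have -> : h z - (t / n.+1%:R - K) = (H z - t) / n.+1%:R by rewrite {1}hH; ring.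
  rewrite mulr_ge0 ?invr_ge0 ?subr_ge0//= ler_pdivrMr// mulVf ?gt_eqF//.
  by move: t2; rewrite -natr1 -/t; lra.
exists g; split.
  apply: dense_sum => j; apply: denseM; first exact: dense_cst.
  exact: (measurable_dense_set (mA j)).2.
pose q : R := n.+1%:R^-1; have q0 : 0 <= q by rewrite invr_ge0.
have q1 : q <= 1 by rewrite invf_le1.
apply: (@le_trans _ _ (((q ^+ 2) ^+ 2)%:E * mu setT)%E).
  apply: n4_le_bound; first exact: sqr_ge0.
  apply: aeW => z; have [r -> /andP[h0 h1]] := gE z.
  by rewrite -rmorphB sqnC lerXn2r ?nnegrE.
rewrite -massE -EFinM lee_fin; apply: (@le_trans _ _ (q * mass R d)).
  rewrite ler_wpM2r// -exprM exprS ler_piMr//.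
  by rewrite exprn_ile1.
by rewrite /q mulrC ler_pdivrMr.
Qed.

Theorem trig_density f : LB mu f -> trig_dense f.
Proof.
move=> /LBP[/LmP[g [[gR gI] fg]] [M M0 fM]].
(* The Borel representative g is cut off where it is too large, so that the bound holds everywhere
   and not only almost everywhere. *)
pose S := [set z | sqn (g z) <= M].
have mS : measurable S.
  rewrite (_ : S = (fun z => sqn (g z)) @^-1` `]-oo, M]%classic); last first.
    by apply/seteqP; split => z /=; rewrite in_itv.
  rewrite -[X in measurable X]setTI.
  exact: (measurable_sqn (conj gR gI) measurableT (measurable_itv `]-oo, M])).
pose k z := ind S z * g z.
have bk : Borel_complex k by apply: BorelM => //; exact: Borel_ind.
have kM z : sqn (k z) <= M.
  rewrite /k sqnM sqnC indicE; case: (boolP (z \in S)) => /=.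
    by rewrite inE expr1n mul1r.
  by rewrite expr0n mul0r.
apply: (@dense_ae _ _ k).
  apply: filterS2 fg fM => z fg fM; rewrite /k /ind indicE (_ : z \in S) ?mul1r//.
  by rewrite inE /S /= -fg.
have kR z : `|complex.Re (k z)| <= M + 1 /\ `|complex.Im (k z)| <= M + 1.
  have := kM z; rewrite /sqn !ler_norml; set a := complex.Re _; set b := complex.Im _.
  have := sqr_ge0 a; have := sqr_ge0 b.
  have := sqr_ge0 (a - 1); have := sqr_ge0 (b - 1).
  have := sqr_ge0 (a + 1); have := sqr_ge0 (b + 1).
  by split; nra.
have dR := dense_bounded_measurable bk.1 (fun z => (kR z).1).
have dI := dense_bounded_measurable bk.2 (fun z => (kR z).2).
rewrite (_ : k = fun z => ((complex.Re (k z))%:C)%C + 'i%C * ((complex.Im (k z))%:C)%C).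
  by apply: denseD => //; apply: denseM => //; exact: dense_cst.
by apply/funext => z; exact: complexE.
Qed.

End density_theorem.

(** * Free waves *)

Section Lnorms.
Context dT (T : measurableType dT) (R : realType).
Variable mu : {measure set T -> \bar R}.
Implicit Types f g : T -> R[i].

Lemma cLnorm2E f : cLnorm mu 2%:E f = (nn mu f `^ (2^-1))%E.
Proof.
rewrite /cLnorm unlock; congr (_ `^ _)%E; apply: eq_integral => z _.
by rewrite /= ger0_norm ?normc_ge0// powR_mulrn ?normc_ge0// sqn_normc.
Qed.

Lemma sqrt_leE (r c : R) : 0 <= c -> (Num.sqrt r <= c) = (r <= c ^+ 2).
Proof.
by move=> c0; rewrite -[X in _ <= X](ger0_norm c0) -sqrtr_sqr ler_sqrt ?sqr_ge0.
Qed.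

Lemma cLnorm2_le (c : R) f : 0 <= c ->
  (cLnorm mu 2%:E f <= c%:E)%E = (nn mu f <= (c ^+ 2)%:E)%E.
Proof.
move=> c0; rewrite cLnorm2E; have := nn_ge0 mu f.
case: (nn mu f) => [r|_|//].
  by rewrite lee_fin => r0; rewrite poweR_EFin powR12_sqrt// !lee_fin sqrt_leE.
by rewrite poweRyr.
Qed.

Lemma cLnorm2_leM (M : R) f g : 0 <= M -> (nn mu g < +oo)%E ->
  (nn mu f <= (M ^+ 2)%:E * nn mu g)%E ->
  (cLnorm mu 2%:E f <= M%:E * cLnorm mu 2%:E g)%E.
Proof.
move=> M0; rewrite (cLnorm2E g); have := nn_ge0 mu g.
case: (nn mu g) => [r r0 _|//|//]; rewrite lee_fin in r0.
rewrite poweR_EFin powR12_sqrt// -!EFinM => h.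
by rewrite cLnorm2_le ?mulr_ge0 ?sqrtr_ge0// exprMn sqr_sqrtr.
Qed.

Lemma in_L2P f : in_Lp mu 2%:E f <-> L2 mu f.
Proof.
rewrite /in_Lp /L2 cLnorm2E; split => -[mf nf]; split => //.
  exact: (lty_poweRy _ nf).
exact: poweR_lty.
Qed.

Lemma cLnormy_le (c : R) f : 0 <= c ->
  (cLnorm mu +oo%E f <= c%:E)%E <-> {ae mu, forall z, Normc.normc (f z) <= c}.
Proof.
move=> c0; rewrite /cLnorm unlock; case: ifPn => [_|].
  split=> [/ess_supP|h]; last apply/ess_supP; last move: h; apply: filterS => z;
  by rewrite /= lee_fin ger0_norm ?normc_ge0.
(* If the whole space is null, [Lnorm] at infinity has the default value 0, and every property holds
   almost everywhere. *)
rewrite -leNgt measure_le0 => /eqP mu0; split => _; last by rewrite lee_fin.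
exact: measure0_ae.
Qed.

Lemma normc_le (c : R) (x : R[i]) : 0 <= c ->
  (Normc.normc x <= c) = (sqn x <= c ^+ 2).
Proof. by move=> c0; rewrite -sqn_normc ler_sqr ?nnegrE ?normc_ge0. Qed.

Lemma in_LyP f : in_Lp mu +oo%E f <-> LB mu f.
Proof.
split => [[mf]|/LBP[mf [M M0 fM]]].
  move=> nf; split => //.
  have [c c0 fc] : exists2 c : R, 0 <= c & (cLnorm mu +oo%E f <= c%:E)%E.
    move: nf; have := Lnorm_ge0 mu +oo%E (fun z => (Normc.normc (f z))%:E).
    by rewrite -/(cLnorm mu +oo%E f); case: (cLnorm mu +oo%E f) => // r; exists r.
  exists (c ^+ 2); move/(cLnormy_le f c0) : fc; apply: filterS => z.
  by rewrite normc_le.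
split => //; apply: (@le_lt_trans _ _ (Num.sqrt M)%:E); last exact: ltry.
apply/cLnormy_le; first exact: sqrtr_ge0.
by apply: filterS fM => z fM; rewrite normc_le ?sqrtr_ge0// sqr_sqrtr.
Qed.

End Lnorms.

Section sections.
Context d1 d2 (T1 : measurableType d1) (T2 : measurableType d2) (R : realType).
Variable m1 : {finite_measure set T1 -> \bar R}.
Variable m2 : {finite_measure set T2 -> \bar R}.

Lemma ae_sections (P : T1 * T2 -> Prop) :
  {ae (m1 \x m2)%E, forall z, P z} ->
  {ae m1, forall x, {ae m2, forall y, P (x, y)}}.
Proof.
move=> [N [mN N0 PN]].
have mx : measurable_fun setT (fun x => m2 (xsection N x)).
  exact: measurable_fun_xsection.
have : (\int[m1]_x `|m2 (xsection N x)| = 0)%E.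
  by rewrite -[RHS]N0; apply: eq_integral => x _; rewrite gee0_abs.
move=> /(ae_eq_integral_abs m1 measurableT mx); apply: filterS => x /(_ I) Nx0.
exists (xsection N x); split => //; first exact: measurable_xsection.
by move=> y /= nP; rewrite /xsection /= inE; exact: PN.
Qed.

End sections.

Section free_waves.
Variables (R : realType) (d : nat).
Local Notation mR := (measurableTypeR R).
Local Notation space := (d.-tuple mR).
Local Notation Z := (spacetime R d).
Local Notation mu := (@spacetime_measure R d).
Local Notation dt := (@circle_measure R).
Local Notation dx := (torus_measure R d).

Let mu_fin := @spacetime_measure_fin R d.

(* The space-time frequencies (-|k|^2, k) of free Schrodinger waves. *)
Definition paraboloid (m : freq d) : bool :=
  m ord0 == - \sum_(i < d) m (lift ord0 i) ^+ 2.

Lemma finite_measure_lty dT (T : measurableType dT)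
  (m : {finite_measure set T -> \bar R}) : (m setT < +oo)%E.
Proof. by rewrite -ge0_fin_numE// fin_num_measure. Qed.

Lemma cintegral_circle_expi (C : R[i]) (a : int) : a != 0 ->
  cintegral dt (fun t : mR => C * expi (a%:~R * t)) = 0.
Proof.
move=> a0.
have Lf : L2 dt (fun t : mR => C * expi (a%:~R * t)).
  apply: (LB_L2 (finite_measure_lty _)).
  apply: LBZ; split; last by exists 1; apply: aeW => t; rewrite sqn_expi.
  apply: Borel_Lm; apply: Borel_expi.
  by apply: measurable_funM => //; exact: measurable_cst.
have If := cintegrable_L2 (finite_measure_lty _) Lf.
have e : cintegral dt (fun t : mR => C * expi (a%:~R * t)) =
    - cintegral dt (fun t : mR => C * expi (a%:~R * t)).
  rewrite -mulN1r -cintegralZ//.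
  rewrite -(cintegral_preserving (circle_rotation (pi / a%:~R)) If).
  congr cintegral; apply/funext => t /=.
  have [m ->] := red_int (t + pi / a%:~R).
  rewrite (_ : a%:~R * _ = (a%:~R * t + pi) + (a * m)%:~R * (2 * pi)); last first.
    by rewrite intrM; field; rewrite intr_eq0.
  by rewrite expiD2pi expiD expi_pi; ring.
by apply/eqP; rewrite -eqNr -e.
Qed.

Lemma cintegral_prod (g : Z -> R[i]) (phi : mR -> R[i]) : cintegrable mu g ->
  {ae dt, forall t, cintegral dx (fun x => g (t, x)) = phi t} ->
  cintegral mu g = cintegral dt phi.
Proof.
move=> [h [gh hR hI]] gphi; rewrite (cintegral_ae gh).
have E (k : Z -> R) (p : mR -> R) : mu.-integrable setT (EFin \o k) ->
    {ae dt, forall t, (\int[dx]_x k (t, x))%R = p t} ->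
    (\int[mu]_z k z)%R = (\int[dt]_t p t)%R.
  move=> ik kp; rewrite /Rintegral; congr fine.
  rewrite -[LHS](integral12_prod_meas1 ik).
  apply: ae_eq_nonmeasurable_integral.
  apply: filterS2 kp (ae_integrable1 ik) => t <- it.
  rewrite /fubini_F /Rintegral fineK//.
  exact: integrable_fin_num.
have sec : {ae dt, forall t, cintegral dx (fun x => h (t, x)) = phi t}.
  have gt := @ae_sections _ _ _ _ R dt dx (fun z => g z = h z) gh.
  apply: filterS2 gphi gt => t <- gt.
  by apply/esym; apply: cintegral_ae; exact: gt.
rewrite /cintegral; congr (_ +i* _)%C; apply: E => //.
  by apply: filterS sec => t <-.
by apply: filterS sec => t <-.
Qed.

(** Integrating first in x leaves a Fourier coefficient of u0 times e^{iat} with a = -(m_0 + |k|^2),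
    an integer that is non zero off the paraboloid; the integral in t then vanishes. *)
Lemma free_wave_orthogonal (u : Z -> R[i]) m : free_wave u -> ~~ paraboloid m ->
  cintegral mu (fun z => u z * conjc (ee m z)) = 0.
Proof.
move=> [/in_L2P u2 [u0 [_ pu]]] mP.
pose k : d.-tuple int := [tuple m (lift ord0 i) | i < d].
have int_sq : sqnorm R k = (\sum_(i < d) m (lift ord0 i) ^+ 2)%:~R.
  rewrite /sqnorm rmorph_sum; apply: eq_bigr => i _.
  by rewrite tnth_mktuple rmorphXn.
pose a := - (m ord0 + \sum_(i < d) m (lift ord0 i) ^+ 2).
have a0 : a != 0.
  by apply: contra mP; rewrite /a oppr_eq0 addr_eq0.
pose C := ((2 * pi) ^+ d)%:C%C * fourier_coef u0 k.
rewrite (@cintegral_prod _ (fun t => C * expi (a%:~R * t))).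
- exact: cintegral_circle_expi.
- by apply: cintegrableM => //; apply: L2J; exact/LB_L2_st/LB_ee.
apply: (@filterS _ _ (ae_filter_ringOfSetsType dt) _ _ _ pu) => t [/in_L2P ut2 fc].
transitivity (cintegral dx (fun x => expi (- (m ord0)%:~R * t) *
    (u (t, x) * expi (- dotp k x)))).
  congr cintegral; apply/funext => x; rewrite eeJ /ee dotN.
  rewrite /dot big_ord_recl st_coord0 opprD expiD mulNr.
  rewrite mulrCA; congr (_ * (_ * expi (- _))).
  rewrite /dotp; apply: eq_bigr => i _.
  by rewrite st_coordS tnth_mktuple.
have Lk : LB dx (fun x => expi (- dotp k x)).
  split; last by exists 1; apply: aeW => x; rewrite sqn_expi.
  apply/Borel_Lm/Borel_expi/measurable_funN; apply: measurable_sum => i.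
  by apply: measurable_funM; [exact: measurable_cst|exact: measurable_tnth].
rewrite cintegralZ; last first.
  by apply: cintegrableM => //; exact: (LB_L2 (finite_measure_lty _) Lk).
have := fc k; rewrite {1}/fourier_coef => /(congr1 ( *%R ((2 * pi) ^+ d)%:C%C)).
rewrite mulrA -rmorphM divff ?mul1r ?expf_neq0 ?twopi_neq0// => ->.
rewrite (_ : expi (a%:~R * t) =
    expi (- (m ord0)%:~R * t) * expi (- (t * sqnorm R k))); first by rewrite /C; ring.
by rewrite -expiD int_sq; congr expi; rewrite /a rmorphN rmorphD /=; ring.
Qed.

(* Orthogonal projection of an approximating trigonometric polynomial. *)
Lemma free_wave_density (u : Z -> R[i]) (e : R) : free_wave u -> 0 < e ->
  exists v, trig paraboloid v /\ (nn mu (fun z => u z - v z)%R <= e%:E)%E.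
Proof.
move=> fu e0; have [/in_L2P u2 _] := fu.
have [/LmP[g [bg ug]] nu] := u2; rewrite (nn_ae ug) in nu.
(* Truncation reduces to bounded functions, for which [trig_density] holds; on a space of finite
   measure, closeness in L^4 gives closeness in L^2. *)
pose S (n : nat) := [set z | sqn (g z) <= n%:R].
have mS n : measurable (S n).
  rewrite (_ : S n = (fun z => sqn (g z)) @^-1` `]-oo, n%:R]%classic); last first.
    by apply/seteqP; split => z /=; rewrite in_itv.
  rewrite -[X in measurable X]setTI.
  exact: (measurable_sqn bg measurableT (measurable_itv `]-oo, n%:R])).
pose w n z := ind (S n) z * g z.
have bw n : Borel_complex (w n) by apply: BorelM => //; exact: Borel_ind.
have e8 : 0 < e / 8 by rewrite divr_gt0.
have wB n : LB mu (w n).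
  split; first exact: Borel_Lm.
  exists n%:R; apply: aeW => z; rewrite sqnM sqnC indicE.
  case: (boolP (z \in S n)); first by rewrite inE expr1n mul1r.
  by rewrite expr0n mul0r.
have [n wn] : exists n, (nn mu (fun z => u z - w n z)%R <= (e / 8)%:E)%E.
  have [n ne] : exists n, (nn mu (fun z => g z - w n z)%R <= (e / 8)%:E)%E.
    apply: (nn_dominated_approx bw bg bg nu _ _ e8) => [n z|z].
      rewrite /w /ind indicE; case: (z \in S n).
        by rewrite mul1r subrr sqn0 sqn_ge0.
      by rewrite mul0r subr0.
    apply: cvg_near_cst; exists (Num.truncn (sqn (g z))).+1 => // n /= hn.
    rewrite /w /ind indicE (_ : z \in S n) ?mul1r ?subrr ?sqn0//.
    by rewrite inE /S /= (le_trans (ltW (truncnS_gt _)))// ler_nat.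
  exists n; rewrite (@nn_ae _ _ _ _ _ (fun z => g z - w n z))//.
  by apply: filterS ug => z ->.
have m1 : 0 < mass R d + 1 by rewrite ltr_wpDl// mass_ge0.
have e16 : 0 < e / 16 by rewrite divr_gt0.
have [_ /(_ ((e / 16) ^+ 2 / (mass R d + 1)))] := trig_density (wB n).
rewrite divr_gt0 ?exprn_gt0// => /(_ isT)[p [tp wp]].
have Lp := LB_trig tp.
have wp2 : (nn mu (fun z => w n z - p z)%R <= (e / 8)%:E)%E.
  (* With this a, both terms of [nn_le_n4] are at most e / 16. *)
  pose a := e / 16 / (mass R d + 1); have a0 : 0 < a by rewrite divr_gt0.
  apply: (@le_trans _ _ (a%:E * mu setT + a^-1%:E * n4 mu (fun z => w n z - p z)%R)%E).
    exact: nn_le_n4 a0 (LBB (wB n) Lp).1.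
  rewrite (_ : e / 8 = e / 16 + e / 16); last by lra.
  rewrite EFinD -massE leeD//.
    rewrite -EFinM lee_fin /a mulrAC ler_pdivrMr// ler_wpM2l ?(ltW e16)//.
    by rewrite lerDl.
  apply: (@le_trans _ _ (a^-1%:E * ((e / 16) ^+ 2 / (mass R d + 1))%:E)%E).
    by rewrite lee_wpmul2l// lee_fin invr_ge0 ltW.
  rewrite -EFinM lee_fin le_eqVlt; apply/orP; left; apply/eqP.
  by rewrite /a; field; rewrite !gt_eqF.
have up : (nn mu (fun z => u z - p z)%R <= e%:E)%E.
  rewrite (_ : (fun z => u z - p z) = fun z => (u z - w n z) + (w n z - p z)); last first.
    by apply/funext => z; rewrite addrA subrK.
  apply: (le_trans (nnD (LmB u2.1 (wB n).1) (LBB (wB n) Lp).1)).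
  apply: (@le_trans _ _ (2%:E * (e / 8)%:E + 2%:E * (e / 8)%:E)%E).
    by rewrite leeD// lee_pmul2l.
  by rewrite -!EFinM -EFinD lee_fin; lra.
have [N [k [c [kinj _ pE]]]] := trig_normal tp.
pose v z := \sum_(i | paraboloid (k i)) c i * ee (k i) z.
pose r z := \sum_(i | ~~ paraboloid (k i)) c i * ee (k i) z.
have pvr z : p z = v z + r z by rewrite pE (bigID (fun i => paraboloid (k i))).
have Lee (i : 'I_N) : LB mu (fun z => c i * ee (k i) z) by apply: LBZ; exact: LB_ee.
have Lv : L2 mu v by apply: LB_L2_st; exact: LB_sum.
have Lr : L2 mu r by apply: LB_L2_st; exact: LB_sum.
exists v; split.
  by apply: trig_sum => i ki; exact: trig_ee.
apply: (le_trans _ up).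
rewrite (_ : (fun z => u z - p z) = fun z => (u z - v z) - r z); last first.
  by apply/funext => z; rewrite pvr opprD addrA.
have uv2 : L2 mu (fun z => u z - v z) by exact: L2B.
apply: nn_pythagoras => //.
have Ieei f i : L2 mu f -> cintegrable mu (fun z => f z * conjc (ee (k i) z)).
  by move=> f2; apply: cintegrableM => //; apply: L2J; exact/LB_L2_st/LB_ee.
transitivity (cintegral mu (fun z => \sum_(i | ~~ paraboloid (k i))
    conjc (c i) * ((u z - v z) * conjc (ee (k i) z)))).
  congr cintegral; apply/funext => z; move: (u z - v z) => y.
  rewrite /r raddf_sum mulr_sumr.
  by apply: eq_bigr => i _ /=; rewrite rmorphM mulrCA.
rewrite cintegral_sum; last by move=> i; apply: cintegrableZ; exact: Ieei.
rewrite big1// => i ki; rewrite cintegralZ; last exact: Ieei.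
rewrite (_ : cintegral mu _ = 0) ?mulr0//.
transitivity (cintegral mu (fun z => u z * conjc (ee (k i) z) + -1 *
    (\sum_(j | paraboloid (k j)) c j * ee (k j - k i) z))).
  congr cintegral; apply/funext => z; rewrite mulrBl mulN1r /v mulr_suml.
  by congr (_ - _); apply: eq_bigr => j _; rewrite eeB mulrA.
have Is : cintegrable mu (fun z => \sum_(j | paraboloid (k j)) c j * ee (k j - k i) z).
  apply: cintegrable_sum => j; apply: cintegrable_LB; apply: LBZ; exact: LB_ee.
rewrite cintegralD; last 2 first.
- exact: Ieei.
- exact: cintegrableZ.
rewrite free_wave_orthogonal// add0r cintegralZ// cintegral_sum; last first.
  by move=> j; apply: cintegrable_LB; apply: LBZ; exact: LB_ee.
rewrite big1 ?mulr0// => j kj; rewrite cintegralZ; last exact/cintegrable_LB/LB_ee.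
rewrite cintegral_ee ifN ?mulr0// subr_eq0.
by apply: contra ki => /eqP <-.
Qed.

End free_waves.

(** * Approximable multipliers *)

Section approximation.
Context dT (T : measurableType dT) (R : realType).
Variable mu : {measure set T -> \bar R}.
Variables (C U : set (T -> R[i])) (w : (T -> R[i]) -> \bar R).
Hypothesis C_LB : forall g, C g -> LB mu g.
Hypothesis C_cst : forall c, C (fun=> c).
Hypothesis C_D : forall f g, C f -> C g -> C (fun z => f z + g z).
Hypothesis C_M : forall f g, C f -> C g -> C (fun z => f z * g z).
Hypothesis U_Lm : forall u, U u -> Lmeasurable mu u.
Hypothesis U_w : forall u, U u -> (nn mu u <= w u)%E.
Implicit Types f g : T -> R[i].

(** Abstract because it serves twice: for trigonometric polynomials tested on polynomials of the
    paraboloid, with w the squared norm, and for continuous functions tested on the unit ball of the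
    free waves, with w = 1. The bound e is on squared norms. *)
Definition approximable f := LB mu f /\ forall e : R, 0 < e -> exists g,
  C g /\ forall u, U u -> (nn mu (fun z => (f z - g z) * u z)%R <= e%:E * w u)%E.

Let w_ge0 u : U u -> (0 <= w u)%E.
Proof. by move=> /U_w; apply: le_trans; exact: nn_ge0. Qed.

Lemma approx_C f : C f -> approximable f.
Proof.
move=> Cf; split; first exact: C_LB.
move=> e e0; exists f; split => // u Uu.
rewrite (_ : (fun z => _) = fun=> 0); last first.
  by apply/funext => z; rewrite subrr mul0r.
by rewrite nn0 mule_ge0 ?lee_fin ?(ltW e0) ?w_ge0.
Qed.

Lemma approx_cst c : approximable (fun=> c).
Proof. exact: approx_C. Qed.

Lemma approx_ae f g : ae_equal mu f g -> approximable f -> approximable g.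
Proof.
move=> fg [bf df]; split; first exact: LB_ae bf.
move=> e /df[p [tp fp]]; exists p; split => // u /fp.
rewrite (@nn_ae _ _ _ _ _ (fun z => (g z - p z) * u z))//.
by apply: filterS fg => z ->.
Qed.

Lemma approx_close f : LB mu f ->
  (forall e : R, 0 < e -> exists g, approximable g /\
     forall u, U u -> (nn mu (fun z => (f z - g z) * u z)%R <= e%:E * w u)%E) ->
  approximable f.
Proof.
move=> bf df; split => // e e0; have e4 : 0 < e / 4 by rewrite divr_gt0.
have [g [[bg dg] fg]] := df _ e4; have [p [Cp gp]] := dg _ e4.
exists p; split => // u Uu.
rewrite (_ : (fun z => _) = fun z => (f z - g z) * u z + (g z - p z) * u z); last first.
  by apply/funext => z; ring.
apply: (le_trans (nnD (LmM (LBB bf bg).1 (U_Lm Uu)) (LmM (LBB bg (C_LB Cp)).1 (U_Lm Uu)))).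
have e2 : 0 <= 2 * (e / 4) by lra.
rewrite (_ : e%:E = (2 * (e / 4))%:E + (2 * (e / 4))%:E)%E; last first.
  by rewrite -EFinD; congr EFin; lra.
rewrite ge0_muleDl ?lee_fin//.
by rewrite EFinM -muleA leeD// lee_pmul2l// ?fg ?gp.
Qed.

Lemma approx_uniform f : LB mu f ->
  (forall e : R, 0 < e -> exists g, approximable g /\
     {ae mu, forall z, sqn (f z - g z) <= e}) -> approximable f.
Proof.
move=> bf df; apply: approx_close => // e e0.
have [g [ag fg]] := df _ e0; exists g; split => // u Uu.
apply: (le_trans (nnM_le (ltW e0) fg (U_Lm Uu))).
by rewrite lee_wpmul2l ?lee_fin ?(ltW e0)// U_w.
Qed.

Lemma approxD f g : approximable f -> approximable g ->
  approximable (fun z => f z + g z).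
Proof.
move=> [bf df] [bg dg]; split; first exact: LBD.
move=> e e0; have e4 : 0 < e / 4 by rewrite divr_gt0.
have [p [Cp fp]] := df _ e4; have [q [Cq gq]] := dg _ e4.
exists (fun z => p z + q z); split; first exact: C_D.
move=> u Uu.
rewrite (_ : (fun z => _) = fun z => (f z - p z) * u z + (g z - q z) * u z); last first.
  by apply/funext => z; ring.
apply: (le_trans (nnD (LmM (LBB bf (C_LB Cp)).1 (U_Lm Uu))
  (LmM (LBB bg (C_LB Cq)).1 (U_Lm Uu)))).
have e2 : 0 <= 2 * (e / 4) by lra.
rewrite (_ : e%:E = (2 * (e / 4))%:E + (2 * (e / 4))%:E)%E; last first.
  by rewrite -EFinD; congr EFin; lra.
rewrite ge0_muleDl ?lee_fin//.
by rewrite EFinM -muleA leeD// lee_pmul2l// ?fp ?gq.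
Qed.

Lemma approxM f g : approximable f -> approximable g ->
  approximable (fun z => f z * g z).
Proof.
move=> [bf df] [bg dg]; split; first exact: LBM.
move=> e e0; have [mf [M M0 fM]] := (LBP mu f).1 bf.
have small (K : R) : 0 <= K -> 0 < e / (4 * (K + 1)).
  by move=> K0; rewrite divr_gt0// mulr_gt0// ltr_wpDl.
have [q [Cq gq]] := dg _ (small M M0).
have [mq [N N0 qN]] := (LBP mu q).1 (C_LB Cq).
have [p [Cp fp]] := df _ (small N N0).
exists (fun z => p z * q z); split; first exact: C_M.
move=> u Uu; have Lu := U_Lm Uu.
have Lfp := LmM (LBB bf (C_LB Cp)).1 Lu; have Lgq := LmM (LBB bg (C_LB Cq)).1 Lu.
rewrite (_ : (fun z => _) = fun z => f z * ((g z - q z) * u z) +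
  q z * ((f z - p z) * u z)); last by apply/funext => z; ring.
have bound (K : R) x : 0 <= K -> (x <= (e / (4 * (K + 1)))%:E * w u)%E ->
    (K%:E * x <= (e / 4)%:E * w u)%E.
  move=> K0 xe; apply: (@le_trans _ _ (K%:E * ((e / (4 * (K + 1)))%:E * w u))%E).
    by rewrite lee_wpmul2l.
  rewrite muleA lee_wpmul2r ?w_ge0// -EFinM lee_fin.
  have K1 : 0 < K + 1 by rewrite ltr_wpDl.
  have -> : K * (e / (4 * (K + 1))) = e / 4 * (K / (K + 1)).
    by field; rewrite gt_eqF.
  by rewrite ger_pMr ?divr_gt0// ler_pdivrMr// mul1r lerDl.
apply: (le_trans (nnD (LmM mf Lgq) (LmM mq Lfp))).
have e2 : 0 <= 2 * (e / 4) by lra.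
rewrite (_ : e%:E = (2 * (e / 4))%:E + (2 * (e / 4))%:E)%E; last first.
  by rewrite -EFinD; congr EFin; lra.
rewrite ge0_muleDl ?lee_fin//.
rewrite EFinM -muleA leeD// lee_pmul2l//.
  exact: (le_trans (nnM_le M0 fM Lgq) (bound _ _ M0 (gq _ Uu))).
exact: (le_trans (nnM_le N0 qN Lfp) (bound _ _ N0 (fp _ Uu))).
Qed.

Lemma approxZ c f : approximable f -> approximable (fun z => c * f z).
Proof. by apply: approxM; exact: approx_cst. Qed.

Lemma approx_sum (I : Type) (r : seq I) (P : pred I) (F : I -> T -> R[i]) :
  (forall i, approximable (F i)) -> approximable (fun z => \sum_(i <- r | P i) F i z).
Proof.
move=> aF; elim: r => [|i r ih].
  by under eq_fun do rewrite big_nil; exact: approx_cst.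
under eq_fun do rewrite big_cons; case: (P i) => //.
exact: approxD.
Qed.

End approximation.

Section wave_estimates.
Variables (R : realType) (d : nat).
Local Notation mR := (measurableTypeR R).
Local Notation Z := (spacetime R d).
Local Notation mu := (@spacetime_measure R d).

Let mu_fin := @spacetime_measure_fin R d.

(** If v is close to u, then f u is split into f v and f (u - v), and v into u and u - v. Each
    splitting costs a factor 2, whence 4 c; the terms in u - v are negligible because f is
    bounded. *)
Lemma wave_estimate_free (f : Z -> R[i]) (c : R) : LB mu f -> 0 <= c ->
  (forall v, trig (@paraboloid d) v ->
     (nn mu (fun z => f z * v z)%R <= c%:E * nn mu v)%E) ->
  forall u, free_wave u ->
  (nn mu (fun z => f z * u z)%R <= (4 * c)%:E * nn mu u)%E.
Proof.
move=> bf c0 fc u fu; have [mf [M M0 fM]] := (LBP mu f).1 bf.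
have [/in_L2P[mu' nu] _] := fu.
apply/lee_addgt0Pr => e e0.
(* The error terms add up to (4 c + 2 M) times the squared distance from u to v, which is taken to
   be e / K. *)
pose K := 4 * c + 2 * M + 1; have K0 : 0 < K by rewrite ltr_wpDl// addr_ge0// mulr_ge0.
have [v [tv uv]] := free_wave_density fu (divr_gt0 e0 K0).
have Lv := (LB_trig tv).1; have Luv := LmB mu' Lv.
rewrite (_ : (fun z => _) = fun z => f z * v z + f z * (u z - v z)); last first.
  by apply/funext => z; ring.
apply: (le_trans (nnD (LmM mf Lv) (LmM mf Luv))).
have h1 : (nn mu (fun z => f z * v z)%R <=
    c%:E * (2%:E * nn mu u + 2%:E * (e / K)%:E))%E.
  apply: (le_trans (fc _ tv)); rewrite lee_wpmul2l//.
  rewrite (_ : v = fun z => u z - (u z - v z)); last first.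
    by apply/funext => z; rewrite opprB addrC subrK.
  by apply: (le_trans (nnB mu' Luv)); rewrite leeD2l// lee_pmul2l.
have h2 : (nn mu (fun z => f z * (u z - v z))%R <= M%:E * (e / K)%:E)%E.
  apply: (le_trans (nnM_le M0 fM Luv)).
  by rewrite lee_wpmul2l.
apply: (@le_trans _ _ (2%:E * (c%:E * (2%:E * nn mu u + 2%:E * (e / K)%:E)) +
    2%:E * (M%:E * (e / K)%:E))%E).
  by rewrite leeD// lee_pmul2l.
have := nn_ge0 mu u; move: nu; case: (nn mu u) => [x _ _|//|//].
do ![rewrite -EFinM|rewrite -EFinD]; rewrite lee_fin.
have -> : 2 * (c * (2 * x + 2 * (e / K))) + 2 * (M * (e / K)) =
    4 * c * x + (4 * c + 2 * M) * (e / K) by ring.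
rewrite lerD2l mulrA ler_pdivrMr// mulrC ler_wpM2l ?(ltW e0)//.
by rewrite /K lerDl.
Qed.

Lemma torus_box n (B : 'I_n -> set mR) : (forall i, measurable (B i)) ->
  (torus_measure R n [set x | forall i, B i (tnth x i)] =
   \prod_(i < n) circle_measure (B i))%E.
Proof.
elim: n B => [|n IH] B mB.
  rewrite big_ord0 /= diracE (_ : _ \in _ = true)//; apply/mem_set => -[].
  by [].
rewrite big_ord_recl -IH//= /cons_measure /pushforward.
rewrite (_ : _ @^-1` _ = (B ord0) `*` [set x | forall i, B (lift ord0 i) (tnth x i)]).
  apply: product_measure1E => //.
  rewrite (_ : [set x | _] = \bigcap_(i in [set: 'I_n])
      ((fun x : n.-tuple mR => tnth x i) @^-1` B (lift ord0 i))); last first.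
    by apply/seteqP; split => x h i; [move=> _; exact: h|exact: (h i I)].
  apply: fin_bigcap_measurable => // i _.
  by rewrite -[X in measurable X]setTI; apply: measurable_tnth.
apply/seteqP; split => [[t x] h|[t x] [/= h1 h2] i].
  by split => /= [|i]; [have := h ord0; rewrite /= tnth0|have := h (lift ord0 i); rewrite /= tnthS].
by case: (unliftP ord0 i) => [j|] ->; rewrite ?tnthS ?tnth0.
Qed.

Lemma spacetime_box (B : 'I_d.+1 -> set mR) : (forall i, measurable (B i)) ->
  (mu [set z | forall i, B i (st_coord z i)] =
   \prod_(i < d.+1) circle_measure (B i))%E.
Proof.
(* [torus_measure R d.+1] is by definition the image of [mu] under [cons_pair], so the two sides
   agree by computation. *)
move=> mB; rewrite -torus_box//.
Qed.

Lemma circle_measureT : circle_measure [set: mR] = (2 * pi)%:E.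
Proof.
rewrite circle_measureE setTI lebesgue_measure_itv /= lte_fin twopi_gt0.
by rewrite -EFinB subr0.
Qed.

Lemma mass_gt0 : 0 < mass R d.
Proof.
have := @spacetime_box (fun=> setT) (fun=> measurableT).
rewrite (_ : [set z | _] = setT); last by apply/seteqP; split.
rewrite -massE.
under eq_bigr do rewrite circle_measureT.
rewrite prodEFin => -[->]; apply: prodr_gt0 => i _; exact: twopi_gt0.
Qed.

End wave_estimates.

(** * Functions of two variables *)

Section energy.
Variables (R : realType) (d : nat).
Local Notation Z := (spacetime R d).
Local Notation mu := (@spacetime_measure R d).

Lemma Re_le_sqrt (x : R[i]) : complex.Re x <= Normc.normc x.
Proof.
case: x => a b /=; apply: (le_trans (ler_norm a)).
by rewrite -sqrtr_sqr ler_wsqrtr// lerDl sqr_ge0.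
Qed.

Lemma normcJ (x : R[i]) : Normc.normc (conjc x) = Normc.normc x.
Proof. by case: x => a b /=; rewrite sqrrN. Qed.

Lemma Re_sum (I : Type) (r : seq I) (P : pred I) (F : I -> R[i]) :
  complex.Re (\sum_(i <- r | P i) F i) = \sum_(i <- r | P i) complex.Re (F i).
Proof. exact: raddf_sum. Qed.

(** Meant for products of exponentials, whose frequencies k a + k b may coincide; these coincidences
    are what has to be counted. *)
Lemma nn_trig_le (I : finType) (P : pred I) (k : I -> freq d) (c : I -> R[i]) :
  (nn mu (fun z => \sum_(i | P i) c i * ee (k i) z)%R <=
   (mass R d * \sum_(i | P i) \sum_(j | P j)
      (k i == k j)%:R * (Normc.normc (c i) * Normc.normc (c j)))%:E)%E.
Proof.
rewrite nn_sum; last by move=> i; apply: LB_L2_st; apply: LBZ; exact: LB_ee.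
rewrite lee_fin Re_sum mulr_sumr; apply: ler_sum => i Pi.
rewrite Re_sum mulr_sumr; apply: ler_sum => j Pj.
rewrite (_ : cintegral mu _ = c i * conjc (c j) * cintegral mu (ee (k i - k j))).
  rewrite cintegral_ee subr_eq0; case: eqP => _; last first.
    by rewrite mulr0 !mul0r mulr0.
  rewrite mulrC mul1r; apply: (le_trans (Re_le_sqrt _)).
  by rewrite !Normc.normcM normcJ /= expr0n addr0 sqrtr_sqr ger0_norm ?mass_ge0.
rewrite -cintegralZ; last exact/cintegrable_LB/LB_ee.
congr cintegral; apply/funext => z; rewrite eeB rmorphM /=; ring.
Qed.

Section fourth_moment.
Variables (I : finType) (P : pred I) (k : I -> freq d) (c : I -> R[i]).
(* On a circle, Q is satisfied by the sum of two antipodal points. *)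
Variable Q : pred (freq d).
Hypothesis k_inj : injective k.
Hypothesis kQ : forall a b b', P a -> P b -> P b' ->
  Q (k a + k b) -> Q (k a + k b') -> b = b'.
Hypothesis kE : forall a b a' b', P a -> P b -> P a' -> P b' ->
  k a + k b = k a' + k b' -> [|| a == a', a == b' | Q (k a + k b)].

Let x i := Normc.normc (c i).
Let S := \sum_(i | P i) x i ^+ 2.
Let X (p : I * I) := x p.1 * x p.2.
Let PP (p : I * I) := P p.1 && P p.2.
Let phi (p : I * I) := k p.1 + k p.2.

Let X0 p : 0 <= X p.
Proof. by rewrite mulr_ge0 ?normc_ge0. Qed.

Let SX : \sum_(p | PP p) X p ^+ 2 = S ^+ 2.
Proof.
rewrite expr2 /S mulr_suml.
under [RHS]eq_bigr do rewrite mulr_sumr.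
by rewrite pair_big /=; apply: eq_bigr => p _; rewrite exprMn.
Qed.

(** By [kQ], each a has at most one partner b with Q (k a + k b), and x_a x_b <= (x_a^2 + x_b^2) /
    2. *)
Let SQ : \sum_(p | PP p) (Q (phi p))%:R * X p <= S.
Proof.
rewrite -(pair_big P P (fun a b => (Q (phi (a, b)))%:R * X (a, b)))/=.
have le2 a b : (Q (phi (a, b)))%:R * X (a, b) <=
    2^-1 * ((Q (phi (a, b)))%:R * x a ^+ 2) + 2^-1 * ((Q (phi (a, b)))%:R * x b ^+ 2).
  case: (Q _); rewrite ?mul1r ?mul0r ?mulr0 ?addr0// /X /=.
  have := sqr_ge0 (x a - x b); lra.
apply: (@le_trans _ _ (\sum_(a | P a) \sum_(b | P b)
   (2^-1 * ((Q (phi (a, b)))%:R * x a ^+ 2) + 2^-1 * ((Q (phi (a, b)))%:R * x b ^+ 2)))).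
  by apply: ler_sum => a _; apply: ler_sum => b _; exact: le2.
under eq_bigr do rewrite big_split/=.
rewrite big_split/= [X in _ + X]exchange_big/=.
have half : \sum_(a | P a) \sum_(b | P b) 2^-1 * ((Q (phi (a, b)))%:R * x a ^+ 2) <= 2^-1 * S.
  rewrite /S mulr_sumr; apply: ler_sum => a Pa.
  rewrite -mulr_sumr ler_wpM2l// -mulr_suml ler_piMl ?sqr_ge0//.
  have [[b /andP[Pb Qb]]|nb] := pselect (exists b, P b && Q (phi (a, b))).
    rewrite (bigD1 b)//= big1 ?addr0 ?lern1 ?leq_b1// => b' /andP[Pb' bb'].
    case Qb' : (Q _) => //; case/eqP : bb'.
    exact: (kQ Pa Pb' Pb).
  rewrite big1// => b Pb; case Qb : (Q _) => //.
  by exfalso; apply: nb; exists b; rewrite Pb.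
rewrite (_ : S = 2^-1 * S + 2^-1 * S); last by lra.
apply: lerD => //; apply: le_trans half; rewrite le_eqVlt; apply/orP; left; apply/eqP.
by apply: eq_bigr => a _; apply: eq_bigr => b _; rewrite /phi /= addrC.
Qed.

(** The square of the polynomial is indexed by pairs. Two pairs p and q have the same sum only if q
    is p, or p swapped, or if both sums satisfy Q; each possibility contributes at most S^2, whence
    the 3. *)
Lemma fourth_moment :
  (n4 mu (fun z => \sum_(i | P i) c i * ee (k i) z)%R <=
   (3 * S ^+ 2 * mass R d)%:E)%E.
Proof.
rewrite (_ : n4 mu _ = nn mu (fun z => \sum_(p | PP p)
    (c p.1 * c p.2) * ee (phi p) z)); last first.
  congr nn; apply/funext => z; rewrite mulr_suml.
  under eq_bigr do rewrite mulr_sumr.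
  by rewrite pair_big /=; apply: eq_bigr => p _; rewrite eeD; ring.
apply: (le_trans (nn_trig_le _ _ _)).
rewrite lee_fin mulrC ler_wpM2r ?mass_ge0//.
pose swap (p : I * I) := (p.2, p.1).
apply: (@le_trans _ _ (\sum_(p | PP p) \sum_(q | PP q)
  ((q == p)%:R * (X p * X q) + (q == swap p)%:R * (X p * X q) +
   ((Q (phi p))%:R * X p) * ((Q (phi q))%:R * X q)))).
  apply: ler_sum => p /andP[P1 P2]; apply: ler_sum => q /andP[Q1 Q2].
  rewrite !Normc.normcM -/(X p) -/(X q).
  have XX : 0 <= X p * X q by rewrite mulr_ge0.
  rewrite [Y in _ <= _ + Y]mulrACA -!mulrDl ler_wpM2r//.
  case: eqP => [e|_]; last by rewrite !addr_ge0 ?mulr_ge0.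
  have := kE P1 P2 Q1 Q2 e => /or3P[/eqP h|/eqP h|h].
  - have -> : q = p.
      move: e; rewrite /phi h => /addrI/k_inj h2.
      by rewrite [q]surjective_pairing [p]surjective_pairing h h2.
    by rewrite eqxx -addrA lerDl addr_ge0 ?mulr_ge0.
  - have -> : q = swap p.
      move: e; rewrite /phi h [RHS]addrC => /addrI/k_inj h2.
      by rewrite [q]surjective_pairing /swap h h2.
    by rewrite eqxx addrAC lerDr addr_ge0 ?mulr_ge0.
  - by rewrite -/(phi p) in e h *; rewrite -/(phi q) -e h mulr1 lerDr addr_ge0.
have e1 : \sum_(p | PP p) \sum_(q | PP q) (q == p)%:R * (X p * X q) = S ^+ 2.
  rewrite -SX; apply: eq_bigr => p Pp; rewrite (bigD1 p)//= eqxx mul1r -expr2.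
  by rewrite big1 ?addr0// => q /andP[_ /negbTE ->]; rewrite mul0r.
have e2 : \sum_(p | PP p) \sum_(q | PP q) (q == swap p)%:R * (X p * X q) = S ^+ 2.
  rewrite -SX; apply: eq_bigr => p /andP[Pp1 Pp2].
  rewrite (bigD1 (swap p))/=; last by rewrite /PP /= Pp1 Pp2.
  rewrite eqxx mul1r (_ : X (swap p) = X p) -?expr2; last by rewrite /X mulrC.
  by rewrite big1 ?addr0// => q /andP[_ /negbTE ->]; rewrite mul0r.
have e3 : \sum_(p | PP p) \sum_(q | PP q)
   ((Q (phi p))%:R * X p) * ((Q (phi q))%:R * X q) <= S ^+ 2.
  under eq_bigr do rewrite -mulr_sumr.
  rewrite -mulr_suml -expr2 lerXn2r ?nnegrE ?sumr_ge0//.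
  - by move=> p _; rewrite mulr_ge0.
  - by move=> p _; rewrite sqr_ge0.
under eq_bigr do rewrite big_split big_split/=.
rewrite big_split big_split /= e1 e2; lra.
Qed.

End fourth_moment.

End energy.

Section two_variables.
Variables (R : realType) (d : nat).
Local Notation Z := (spacetime R d).
Local Notation mu := (@spacetime_measure R d).
Implicit Types (f h : Z -> R[i]) (s : 'I_d.+1 -> R) (m : freq d).

Let mu_fin := @spacetime_measure_fin R d.

Lemma LB_shift f s : LB mu f -> LB mu (f \o shift_st s).
Proof. exact: LB_preserving (spacetime_rotation s) _. Qed.

Lemma n4_shift f s : LB mu f -> n4 mu (f \o shift_st s) = n4 mu f.
Proof.
move=> [mf _]; exact: (nn_preserving (spacetime_rotation s) (LmM mf mf)).
Qed.

Lemma trig_shift (P : pred (freq d)) f s : trig P f -> trig P (f \o shift_st s).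
Proof.
move=> [t [Pt ->]]; exists [seq (a.1 * expi (dot a.2 s), a.2) | a <- t]; split.
  by rewrite all_map.
apply/funext => z /=; rewrite big_map; apply: eq_bigr => a _.
by rewrite ee_shift mulrA.
Qed.

(** Convexity of the fourth power. Unlike [n4D] it loses no constant, so it can be iterated over the
    frequencies to be removed. *)
Lemma n4_average f g : Lmeasurable mu f -> Lmeasurable mu g ->
  (n4 mu (fun z => 2^-1 * (f z + g z))%R <= 2^-1%:E * n4 mu f + 2^-1%:E * n4 mu g)%E.
Proof.
move=> mf mg; apply: nn_leZ2 => //; try exact: LmM.
apply: aeW => z; rewrite !sqnM -!expr2 -mulrDr.
have -> : sqn (2^-1 : R[i]) = 4^-1.
  by rewrite (_ : 2^-1 = (2^-1)%:C%C) ?sqnC ?fmorphV ?rmorph_nat//; lra.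
have a0 := sqn_ge0 (f z); have b0 := sqn_ge0 (g z).
have s0 := sqn_ge0 (f z + g z); have h := sqnD (f z) (g z).
apply: (@le_trans _ _ ((2^-1 * (sqn (f z) + sqn (g z))) ^+ 2)).
  by rewrite ler_sqr ?nnegrE; lra.
by have := sqr_ge0 (sqn (f z) - sqn (g z)); nra.
Qed.

Definition supported (i j : 'I_d.+1) m := [forall c, (c != i) && (c != j) ==> (m c == 0)].

(* Averaging p with its translate by a half period cancels a frequency that is
   not supported by i and j; by convexity this does not increase the L^4 distance
   to the invariant function f. *)
Lemma kill_frequencies i j f p : LB mu f ->
  (forall s, s i = 0 -> s j = 0 -> ae_equal mu (f \o shift_st s) f) ->
  trig predT p -> exists q, trig (supported i j) q /\
    (n4 mu (fun z => f z - q z)%R <= n4 mu (fun z => f z - p z)%R)%E.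
Proof.
move=> bf fs [t [_ ->]].
(* Induction on the number of frequencies still to be examined, g collecting the supported ones.
   Averaging changes coefficients but creates no frequency. *)
suff main n (t' : seq (R[i] * freq d)) g : size t' = n -> trig (supported i j) g ->
    exists q, trig (supported i j) q /\ (n4 mu (fun z => f z - q z)%R <=
      n4 mu (fun z => f z - (g z + \sum_(a <- t') a.1 * ee a.2 z))%R)%E.
  have [q [tq fq]] := main _ t (fun=> 0) erefl (@trig0 _ _ _).
  exists q; split => //; apply: (le_trans fq).
  by under [X in (n4 _ X <= _)%E]eq_fun do rewrite add0r.
elim: n t' g => [|n IH] [|a t'] g //= st tg.
  by exists g; split => //; under [X in (_ <= n4 _ X)%E]eq_fun do rewrite big_nil addr0.
move: st => [st]; have [sa|nsa] := boolP (supported i j a.2).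
  have [q [tq fq]] := IH t' (fun z => g z + a.1 * ee a.2 z) st (trigD tg (trig_ee _ sa)).
  exists q; split => //; apply: (le_trans fq).
  by under [X in (_ <= n4 _ X)%E]eq_fun do rewrite big_cons addrA.
have [c [ci cj ac]] : exists c, [/\ c != i, c != j & a.2 c != 0].
  apply: contrapT => nc; case/negP : nsa; apply/forallP => c; apply/implyP => /andP[ci cj].
  by apply: contrapT => /negP ac; apply: nc; exists c.
pose s := half_shift R a.2 c.
have si : s i = 0 by rewrite /s /half_shift eq_sym (negbTE ci).
have sj : s j = 0 by rewrite /s /half_shift eq_sym (negbTE cj).
pose g' z := 2^-1 * (g z + g (shift_st s z)).
(* Translating by s multiplies the exponential of frequency b by expi (dot b s); for the frequency
   of a this factor is -1, so that a disappears from the average. *)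
pose t2 := [seq (b.1 * (2^-1 * (1 + expi (dot b.2 s))), b.2) | b <- t'].
have tg' : trig (supported i j) g'.
  by apply: trigZ; apply: trigD => //; exact: trig_shift.
have [|q [tq fq]] := IH t2 g' _ tg'; first by rewrite size_map.
exists q; split => //; apply: (le_trans fq).
pose h z := f z - (g z + \sum_(b <- a :: t') b.1 * ee b.2 z).
have Lh : LB mu h.
  apply: LBB => //; apply: LBD; first exact: LB_trig tg.
  by apply: LB_sum => b; apply: LBZ; exact: LB_ee.
rewrite (@n4_ae _ _ _ _ _ (fun z => 2^-1 * (h z + (h \o shift_st s) z))).
  apply: (le_trans (n4_average Lh.1 (LB_shift s Lh).1)).
  rewrite n4_shift// -ge0_muleDl ?lee_fin ?n4_ge0// -EFinD.
  by rewrite (_ : 2^-1 + 2^-1 = 1) ?mul1e//; lra.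
apply: filterS (fs s si sj) => z /= fsz.
rewrite /h /= fsz !big_cons ee_shift dot_half_shift// expi_pi /g' /t2 big_map.
have half (x : R[i]) : 2^-1 * (x + x) = x.
  by rewrite -mulr2n -(mulr_natl x 2) mulrA mulVf ?mul1r ?pnatr_eq0.
have -> : \sum_(b <- t') b.1 * (2^-1 * (1 + expi (dot b.2 s))) * ee b.2 z =
    2^-1 * (\sum_(b <- t') b.1 * ee b.2 z +
            \sum_(b <- t') b.1 * ee b.2 (shift_st s z)).
  rewrite -big_split mulr_sumr; apply: eq_bigr => b _ /=.
  by rewrite ee_shift; ring.
rewrite -{1}(half (f z)); ring.
Qed.

Lemma block_orthogonal i j h m : LB mu h ->
  (forall s, s i = 0 -> s j = 0 -> ae_equal mu (h \o shift_st s) h) ->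
  ~~ supported i j m -> cintegral mu (fun z => h z * ee m z) = 0.
Proof.
move=> bh hs nsm.
have [c [ci cj mc]] : exists c, [/\ c != i, c != j & m c != 0].
  apply: contrapT => nc; case/negP : nsm; apply/forallP => c; apply/implyP => /andP[ci cj].
  by apply: contrapT => /negP ac; apply: nc; exists c.
apply: (cintegral_invariant (LB_L2_st bh) mc); apply: hs.
  by rewrite /half_shift eq_sym (negbTE ci).
by rewrite /half_shift eq_sym (negbTE cj).
Qed.

(* Two distinct chords of a circle with the same nonzero midpoint coincide. *)
Lemma circle_chords (x1 x2 y1 y2 z1 z2 w1 w2 : int) :
  x1 + y1 = z1 + w1 -> x2 + y2 = z2 + w2 ->
  y1 ^+ 2 + y2 ^+ 2 = x1 ^+ 2 + x2 ^+ 2 -> z1 ^+ 2 + z2 ^+ 2 = x1 ^+ 2 + x2 ^+ 2 ->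
  w1 ^+ 2 + w2 ^+ 2 = x1 ^+ 2 + x2 ^+ 2 ->
  [\/ x1 = z1 /\ x2 = z2, x1 = w1 /\ x2 = w2 | x1 + y1 = 0 /\ x2 + y2 = 0].
Proof.
move=> s1 s2 hy hz hw.
have ew1 : w1 = x1 + y1 - z1 by rewrite s1; ring.
have ew2 : w2 = x2 + y2 - z2 by rewrite s2; ring.
pose a1 := x1 - z1; pose a2 := x2 - z2; pose b1 := y1 - z1; pose b2 := y2 - z2.
have [/andP[/eqP e1 /eqP e2]|na] := boolP ((a1 == 0) && (a2 == 0)).
  by constructor 1; rewrite -(subr0_eq e1) -(subr0_eq e2).
have [/andP[/eqP e1 /eqP e2]|nb] := boolP ((b1 == 0) && (b2 == 0)).
  constructor 2; rewrite ew1 ew2 (subr0_eq e1) (subr0_eq e2); split; ring.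
constructor 3.
have sqz (u v : int) : u ^+ 2 + v ^+ 2 = 0 -> (u == 0) && (v == 0).
  move=> /eqP; rewrite paddr_eq0 ?sqr_ge0// !sqrf_eq0.
  by [].
(* The points x, z, y, w form a parallelogram inscribed in a circle, that is a rectangle: its sides
   a and b at z are orthogonal. *)
have ab : a1 * b1 + a2 * b2 = 0.
  have h2 : 2 * (a1 * b1 + a2 * b2) = 0.
    rewrite (_ : 2 * _ = (w1 ^+ 2 + w2 ^+ 2) - (x1 ^+ 2 + x2 ^+ 2) -
        (y1 ^+ 2 + y2 ^+ 2) + (z1 ^+ 2 + z2 ^+ 2)).
      by rewrite hw hy hz; ring.
    by rewrite ew1 ew2 /a1 /a2 /b1 /b2; ring.
  by move/eqP: h2; rewrite mulf_eq0 /= => /eqP.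
have ua : (x1 + y1) * a1 + (x2 + y2) * a2 = 0.
  rewrite (_ : _ + _ = (x1 ^+ 2 + x2 ^+ 2 - (z1 ^+ 2 + z2 ^+ 2)) + (a1 * b1 + a2 * b2)).
    by rewrite ab hz; ring.
  by rewrite /a1 /a2 /b1 /b2; ring.
have ub : (x1 + y1) * b1 + (x2 + y2) * b2 = 0.
  rewrite (_ : _ + _ = (y1 ^+ 2 + y2 ^+ 2 - (z1 ^+ 2 + z2 ^+ 2)) + (a1 * b1 + a2 * b2)).
    by rewrite ab hz hy; ring.
  by rewrite /a1 /a2 /b1 /b2; ring.
(* The vector x + y is orthogonal to a and b. These are non zero and orthogonal to each other, so D
   does not vanish, by |a|^2 |b|^2 = D^2 + (a.b)^2, and Cramer's rule gives x + y = 0. *)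
pose D := a1 * b2 - a2 * b1.
have D0 : D != 0.
  apply/negP => /eqP D0.
  have : (a1 ^+ 2 + a2 ^+ 2) * (b1 ^+ 2 + b2 ^+ 2) = 0.
    rewrite (_ : _ * _ = D ^+ 2 + (a1 * b1 + a2 * b2) ^+ 2); last by rewrite /D; ring.
    by rewrite D0 ab; ring.
  move/eqP; rewrite mulf_eq0 => /orP[] /eqP /sqz; [exact/negP|exact/negP].
split; apply: (mulIf D0); rewrite mul0r.
  rewrite (_ : _ * D = ((x1 + y1) * a1 + (x2 + y2) * a2) * b2 -
     ((x1 + y1) * b1 + (x2 + y2) * b2) * a2); last by rewrite /D; ring.
  by rewrite ua ub; ring.
rewrite (_ : _ * D = ((x1 + y1) * b1 + (x2 + y2) * b2) * a1 -
   ((x1 + y1) * a1 + (x2 + y2) * a2) * b1); last by rewrite /D; ring.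
by rewrite ua ub; ring.
Qed.

End two_variables.

(** * Coincidences of sums on two-dimensional slices of the paraboloid *)

Section paraboloid_energy.
Variable d : nat.
Implicit Types m n : freq d.

Definition psum m : int := \sum_(x < d) m (lift ord0 x) ^+ 2.

Lemma paraboloidE m : paraboloid m -> m ord0 = - psum m.
Proof. by move/eqP. Qed.

Lemma paraboloid_eq m n : paraboloid m -> paraboloid n ->
  (forall x, m (lift ord0 x) = n (lift ord0 x)) -> m = n.
Proof.
move=> /paraboloidE pm /paraboloidE pn mn; apply/ffunP => c.
case: (unliftP ord0 c) => [x|] ->; first exact: mn.
by rewrite pm pn; congr (- _); apply: eq_bigr => x _; rewrite mn.
Qed.

Definition eq_off (i j : 'I_d.+1) m n := forall c, c != i -> c != j -> m c = n c.

Lemma eq_offP i j m n : eq_off i j m n ->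
  m i = n i -> m j = n j -> m = n.
Proof.
move=> mn mi mj; apply/ffunP => c.
have [->//|ci] := eqVneq c i; have [->//|cj] := eqVneq c j; exact: mn.
Qed.

(** The second free index is either the time or a repetition of the first, which covers functions of
    a single space variable. *)
Lemma psum_off1 x j m n : j = ord0 \/ j = lift ord0 x -> eq_off (lift ord0 x) j m n ->
  psum m - m (lift ord0 x) ^+ 2 = psum n - n (lift ord0 x) ^+ 2.
Proof.
move=> jx mn; rewrite /psum (bigD1 x)//= [in RHS](bigD1 x)//=.
rewrite [LHS]addrC addKr [RHS]addrC addKr; apply: eq_bigr => c cx.
rewrite mn//; case: jx => ->//; by rewrite eq_sym neq_lift.
Qed.

Lemma psum_off2 x y m n : x != y -> eq_off (lift ord0 x) (lift ord0 y) m n ->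
  psum m - (m (lift ord0 x) ^+ 2 + m (lift ord0 y) ^+ 2) =
  psum n - (n (lift ord0 x) ^+ 2 + n (lift ord0 y) ^+ 2).
Proof.
move=> xy mn; rewrite /psum (bigD1 x)//= (bigD1 y)/=; last by rewrite eq_sym.
rewrite [in RHS](bigD1 x)//= [in RHS](bigD1 y)/=; last by rewrite eq_sym.
rewrite !addrA [LHS]addrC addKr [RHS]addrC addKr; apply: eq_bigr => c /andP[cx cy].
by rewrite mn.
Qed.

(** The slice is a parabola: since the time frequency is minus a square plus a constant, equal sums
    give a + b = a' + b' and a^2 + b^2 = a'^2 + b'^2, whence (a - a') (a - b') = 0. *)
Lemma paraboloid_energy_time x m n m' n' :
  paraboloid m -> paraboloid n -> paraboloid m' -> paraboloid n' ->
  eq_off (lift ord0 x) ord0 m n -> eq_off (lift ord0 x) ord0 m m' ->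
  eq_off (lift ord0 x) ord0 m n' -> m + n = m' + n' -> m = m' \/ m = n'.
Proof.
move=> pm pn pm' pn' mn mm' mn' e.
have ec c : m c + n c = m' c + n' c by have /ffunP/(_ c) := e; rewrite !ffunE.
have on := psum_off1 (or_introl erefl) mn.
have om' := psum_off1 (or_introl erefl) mm'.
have on' := psum_off1 (or_introl erefl) mn'.
have e0 := ec ord0; have ex := ec (lift ord0 x).
rewrite !paraboloidE// in e0.
have key y : eq_off (lift ord0 x) ord0 m y -> paraboloid y ->
    m (lift ord0 x) = y (lift ord0 x) -> m = y.
  move=> my py mx; apply: paraboloid_eq => // c.
  have [->|cx] := eqVneq c x; first exact: mx.
  by apply: my => //; rewrite eq_sym neq_lift.
set a := m _ in on om' on' ex key *; set b := n _ in on ex.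
set a' := m' _ in om' ex *; set b' := n' _ in on' ex *.
have : (a - a') * (a - b') = 0.
  have eb : b = a' + b' - a by rewrite -ex; ring.
  have sq : a ^+ 2 + b ^+ 2 = a' ^+ 2 + b' ^+ 2 by lia.
  have h2 : 2 * ((a - a') * (a - b')) = 0.
    rewrite (_ : _ * _ = a ^+ 2 + (a' + b' - a) ^+ 2 - (a' ^+ 2 + b' ^+ 2)).
      by rewrite -eb sq; ring.
    by ring.
  by move/eqP: h2; rewrite mulf_eq0 /= => /eqP.
move/eqP; rewrite mulf_eq0 !subr_eq0 => /orP[] /eqP h; [left|right]; exact: key.
Qed.

(** The time frequency is fixed on the slice, and so is the sum of the squares of the coordinates i
    and j: the slice is a circle. If i = j it consists of at most two opposite points, handled as
    points of a circle with second coordinate 0. *)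
Lemma paraboloid_energy_space x y m n m' n' :
  paraboloid m -> paraboloid n -> paraboloid m' -> paraboloid n' ->
  let i := lift ord0 x in let j := lift ord0 y in
  eq_off i j m n -> eq_off i j m m' -> eq_off i j m n' -> m + n = m' + n' ->
  [\/ m = m', m = n' | (m + n) i = 0 /\ (m + n) j = 0].
Proof.
move=> pm pn pm' pn' i j mn mm' mn' e.
have ec c : m c + n c = m' c + n' c by have /ffunP/(_ c) := e; rewrite !ffunE.
have ps y' : eq_off i j m y' -> paraboloid y' -> psum m = psum y'.
  by move=> my py; apply: oppr_inj; rewrite -!paraboloidE//; exact: my.
have [xy|xy] := eqVneq x y.
  have jE : j = i by rewrite /j -xy.
  have sq y' : eq_off i j m y' -> paraboloid y' -> y' i ^+ 2 + 0 ^+ 2 = m i ^+ 2 + 0 ^+ 2.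
    move=> my py; have := psum_off1 (or_intror jE) my; rewrite (ps _ my py) => h.
    by congr (_ + _); apply: oppr_inj; apply: (addrI (psum y')); rewrite h.
  have [] := @circle_chords (m i) 0 (n i) 0 (m' i) 0 (n' i) 0 (ec i) erefl
    (sq _ mn pn) (sq _ mm' pm') (sq _ mn' pn').
  - by move=> [h _]; constructor 1; apply: (eq_offP mm') => //; rewrite jE.
  - by move=> [h _]; constructor 2; apply: (eq_offP mn') => //; rewrite jE.
  - by move=> [h _]; constructor 3; rewrite jE ffunE.
have sq y' : eq_off i j m y' -> paraboloid y' ->
    y' i ^+ 2 + y' j ^+ 2 = m i ^+ 2 + m j ^+ 2.
  move=> my py; have := psum_off2 xy my; rewrite (ps _ my py) => h.
  by apply: oppr_inj; apply: (addrI (psum y')); rewrite h.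
have [] := @circle_chords _ _ _ _ _ _ _ _ (ec i) (ec j)
    (sq _ mn pn) (sq _ mm' pm') (sq _ mn' pn').
- by move=> [h1 h2]; constructor 1; exact: (eq_offP mm').
- by move=> [h1 h2]; constructor 2; exact: (eq_offP mn').
- by move=> [h1 h2]; constructor 3; rewrite !ffunE.
Qed.

Lemma paraboloid_energy i j m n m' n' :
  paraboloid m -> paraboloid n -> paraboloid m' -> paraboloid n' ->
  eq_off i j m n -> eq_off i j m m' -> eq_off i j m n' -> m + n = m' + n' ->
  [\/ m = m', m = n' | (m + n) i = 0 /\ (m + n) j = 0].
Proof.
move=> pm pn pm' pn'.
have swap p q : eq_off i j p q -> eq_off j i p q by move=> h c ci cj; exact: h.
case: (unliftP ord0 i) swap => [x|] ->; case: (unliftP ord0 j) => [y|] -> swap.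
- exact: paraboloid_energy_space.
- move=> h1 h2 h3 h4.
  by have [->|->] := paraboloid_energy_time pm pn pm' pn' h1 h2 h3 h4;
    [constructor 1|constructor 2].
- move=> /swap h1 /swap h2 /swap h3 h4.
  by have [->|->] := paraboloid_energy_time pm pn pm' pn' h1 h2 h3 h4;
    [constructor 1|constructor 2].
- by move=> _ h _ _; constructor 1; apply: paraboloid_eq => // c; exact: h.
Qed.

End paraboloid_energy.

Section two_variable_theorem.
Variables (R : realType) (d : nat).
Local Notation Z := (spacetime R d).
Local Notation mu := (@spacetime_measure R d).

Definition wave_approximable : (Z -> R[i]) -> Prop :=
  approximable mu [set f | trig predT f] [set v | trig (@paraboloid d) v] (nn mu).

Lemma nn_parseval (I : finType) (P : pred I) (k : I -> freq d) (c : I -> R[i]) :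
  injective k ->
  nn mu (fun z => \sum_(i | P i) c i * ee (k i) z) =
  (mass R d * \sum_(i | P i) sqn (c i))%:E.
Proof.
move=> kinj.
have Lee i : LB mu (fun z => c i * ee (k i) z) by apply: LBZ; exact: LB_ee.
rewrite (nn_orthogonal (F := fun i z => c i * ee (k i) z)); last 2 first.
- by move=> i; exact: LB_L2_st.
- move=> i j _ _ ij.
  transitivity (cintegral mu (fun z => c i * conjc (c j) * ee (k i - k j) z)).
    by congr cintegral; apply/funext => z; rewrite eeB rmorphM /=; ring.
  rewrite cintegralZ; last exact/cintegrable_LB/LB_ee.
  by rewrite cintegral_ee subr_eq0 (inj_eq kinj) (negbTE ij) mulr0.
rewrite mulr_sumr -sumEFin; apply: eq_bigr => i _.
rewrite /nn; under eq_integral do rewrite sqnM sqn_ee mulr1.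
by rewrite integral_cst// EFinM muleC massE.
Qed.

Theorem two_variable_approximable i j (f : Z -> R[i]) : LB mu f ->
  (forall s, s i = 0 -> s j = 0 -> ae_equal mu (f \o shift_st s) f) ->
  wave_approximable f.
Proof.
move=> bf fs; split => // e e0.
have m0 := mass_gt0 R d; pose M := mass R d.
(* The final bound on a class is S g * eta * (1 + 3 * M), to be equal to e * M * S g. *)
pose eta := e * M / (1 + 3 * M).
have M3 : 0 < 1 + 3 * M by rewrite addr_gt0// mulr_gt0.
have eta0 : 0 < eta by rewrite divr_gt0// mulr_gt0.
have [_ /(_ _ (exprn_gt0 2 eta0))[p [tp fp]]] := trig_density bf.
have [q [tq fq]] := kill_frequencies bf fs tp.
have {fq} fq := le_trans fq fp.
exists q; split; first exact: trigT tq.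
move=> u /= /trig_normal[N [k [c [kinj kP ->]]]] {u}.
pose h z := f z - q z.
have bh : LB mu h by apply: LBB => //; exact: LB_trig tq.
have hs s : s i = 0 -> s j = 0 -> ae_equal mu (h \o shift_st s) h.
  move=> si sj; apply: filterS (fs s si sj) => z /= fz; rewrite /h fz; congr (_ - _).
  have [r [Sr ->]] := tq; rewrite !big_seq; apply: eq_bigr => a ar.
  rewrite ee_shift (_ : dot a.2 s = 0) ?expi0 ?mul1r// /dot big1// => x _.
  have /forallP/(_ x)/implyP sx := allP Sr _ ar.
  have [->|xi] := eqVneq x i; first by rewrite si mulr0.
  have [->|xj] := eqVneq x j; first by rewrite sj mulr0.
  by rewrite (eqP (sx _)) ?mul0r// xi xj.
pose same a b := supported i j (k a - k b).
have sameP a b : same a b <-> eq_off i j (k a) (k b).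
  split=> [/forallP h1 x xi xj|h1].
    by have := h1 x; rewrite xi xj /= !ffunE subr_eq0 => /eqP.
  apply/forallP => x; apply/implyP => /andP[xi xj].
  by rewrite !ffunE subr_eq0 h1.
(* A chosen representative of the class of a. The choice depends only on the predicate [same a],
   hence only on the class. *)
pose cls (a : 'I_N) : option 'I_N := [pick b | same a b].
have clsP a b : cls a = cls b -> eq_off i j (k a) (k b).
  rewrite /cls; case: pickP => [x /sameP ax|/(_ a)]; last first.
    by rewrite (_ : same a a)//; exact/sameP.
  case: pickP => [y /sameP by_ [xy] c' ci cj|//].
  by rewrite ax// xy by_.
have clsE a b : same a b -> cls a = cls b.
  move=> /sameP ab; rewrite /cls; apply: eq_pick => x.
  by apply/idP/idP => /sameP h1; apply/sameP => y yi yj; rewrite -h1// ab.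
pose F a z := h z * (c a * ee (k a) z).
have Lce a : LB mu (fun z => c a * ee (k a) z) by apply: LBZ; exact: LB_ee.
have LF a : L2 mu (F a) by apply: LB_L2_st; exact: LBM.
rewrite (_ : nn mu (fun z => (f z - q z) * _) = nn mu (fun z => \sum_a F a z)); last first.
  by congr nn; apply/funext => z; rewrite mulr_sumr.
have bhh : LB mu (fun z => h z * conjc (h z)) by apply: LBM => //; exact: LBJ.
rewrite (nn_blocks (cls := cls) LF); last first.
  move=> a b _ _ nab.
  transitivity (cintegral mu (fun z => c a * conjc (c b) *
      ((h z * conjc (h z)) * ee (k a - k b) z))).
    by congr cintegral; apply/funext => z; rewrite /F eeB !rmorphM /=; ring.
  rewrite cintegralZ; last by apply: cintegrable_LB; apply: LBM => //; exact: LB_ee.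
  rewrite (block_orthogonal (i := i) (j := j)) ?mulr0//.
    move=> s si sj; apply: filterS (hs s si sj) => z /= ->.
    by [].
  by apply: contra nab => /clsE ->.
pose S g := \sum_(a | cls a == g) sqn (c a).
apply: (@le_trans _ _ (\sum_(g : option 'I_N) (e * M * S g)%:E)%E); last first.
  rewrite nn_parseval// sumEFin -EFinM lee_fin -mulr_sumr mulrA.
  by rewrite (partition_big cls predT).
apply: lee_sum => g _.
have S0 : 0 <= S g by rewrite sumr_ge0// => a _; exact: sqn_ge0.
pose v z := \sum_(a | cls a == g) c a * ee (k a) z.
have Lv : LB mu v by apply: LB_sum => a.
rewrite (_ : (fun z => _) = fun z => h z * v z); last first.
  by apply/funext => z; rewrite mulr_sumr.
(* A class without mass is set apart because the weight S g / eta used below has to be positive. *)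
have [Sg0|Sg0] := eqVneq (S g) 0.
  have c0 a : cls a == g -> c a = 0.
    move=> ag; apply: (@Normc.eq0_normc R); apply/eqP; rewrite -sqrf_eq0 sqn_normc.
    apply/eqP; move: Sg0; rewrite /S => /eqP.
    rewrite psumr_eq0 => [|b _]; last exact: sqn_ge0.
    by move=> /allP/(_ a (mem_index_enum _)); rewrite ag => /eqP.
  rewrite (_ : (fun z => _) = fun=> 0) ?nn0.
    by rewrite lee_fin Sg0 mulr0.
  by apply/funext => z; rewrite /v big1 ?mulr0// => a /c0 ->; rewrite mul0r.
have Sgt : 0 < S g by rewrite lt_neqAle eq_sym Sg0.
have v4 : (n4 mu v <= (3 * S g ^+ 2 * M)%:E)%E.
  have := @fourth_moment R d _ (fun a => cls a == g) k c
    (fun m => (m i == 0) && (m j == 0)) kinj.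
  rewrite (_ : \sum_(a | cls a == g) _ = S g); last first.
    by apply: eq_bigr => a _; rewrite sqn_normc.
  apply.
    move=> a b b' /eqP ag /eqP bg /eqP bg'; rewrite !ffunE.
    move=> /andP[/eqP bi /eqP bj] /andP[/eqP bi' /eqP bj'].
    apply: kinj; apply: (@eq_offP _ i j).
    - by apply: clsP; rewrite bg bg'.
    - by apply: (addrI (k a i)); rewrite bi bi'.
    - by apply: (addrI (k a j)); rewrite bj bj'.
  move=> a b a' b' /eqP ag /eqP bg /eqP ag' /eqP bg' kk.
  have := @paraboloid_energy _ i j _ _ _ _ (kP a) (kP b) (kP a') (kP b')
   (clsP _ _ (etrans ag (esym bg))) (clsP _ _ (etrans ag (esym ag')))
   (clsP _ _ (etrans ag (esym bg'))) kk.
  move=> [/kinj ->|/kinj ->|[-> ->]]; by rewrite !eqxx ?orbT.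
(* The weight [S g / eta] balances the two fourth moments. *)
have d0 : 0 < S g / eta by rewrite divr_gt0.
apply: (@le_trans _ _ ((S g / eta)%:E * n4 mu h + (S g / eta)^-1%:E * n4 mu v)%E).
  apply: nn_leZ2; rewrite ?invr_ge0 ?(ltW d0)//.
  - exact: LmM bh.1 bh.1.
  - exact: LmM Lv.1 Lv.1.
  apply: aeW => z; rewrite !sqnM -!expr2.
  have := sqn_ge0 (h z); have := sqn_ge0 (v z).
  move: (sqn (h z)) (sqn (v z)) => x y y0 x0.
  move: (S g / eta) d0 => r r0.
  have : 0 <= r * (x - r^-1 * y) ^+ 2 by rewrite mulr_ge0 ?sqr_ge0 ?ltW.
  rewrite (_ : r * _ = r * x ^+ 2 + r^-1 * y ^+ 2 - 2 * (x * y)); last first.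
    by field; rewrite gt_eqF.
  have : 0 <= x * y by rewrite mulr_ge0.
  lra.
apply: (@le_trans _ _ ((S g / eta)%:E * (eta ^+ 2)%:E +
    (S g / eta)^-1%:E * (3 * S g ^+ 2 * M)%:E)%E).
  by rewrite leeD// lee_wpmul2l ?lee_fin ?invr_ge0 ?(ltW d0).
rewrite -!EFinM -EFinD lee_fin le_eqVlt; apply/orP; left; apply/eqP.
rewrite (_ : _ + _ = S g * (eta * (1 + 3 * M))); last first.
  by field; rewrite !gt_eqF.
by rewrite /eta divfK ?gt_eqF//; ring.
Qed.

End two_variable_theorem.

(** * Resonances *)

Section clusters.
Variables (R : realType) (d : nat).
Local Notation Z := (spacetime R d).
Local Notation mu := (@spacetime_measure R d).
Implicit Types (m n : freq d) (N : nat).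

(** Integer vectors with entries in [-N, N], shifted to natural numbers so as to form a finite
    type. *)
Definition box N := {ffun 'I_d -> 'I_N.*2.+1}.

Definition boxval N (x : box N) (i : 'I_d) : int := (x i)%:Z - N%:Z.

Lemma boxvalP N (f : 'I_d -> int) : (forall i, `|f i| <= N%:Z) ->
  exists x : box N, boxval x =1 f.
Proof.
move=> fN; exists [ffun i => inord (absz (f i + N%:Z))] => i.
have h := fN i; rewrite /boxval ffunE inordK; lia.
Qed.

Definition sdot m (f : 'I_d -> int) : int := \sum_i m (lift ord0 i) * f i.

(* The integer vectors of size at most N that are nearly orthogonal to m; on
   the paraboloid these are the possible small differences of frequencies. *)
Definition resonant N m (x : box N) : bool := (`|sdot m (boxval x)| <= (N * N)%:Z).
Arguments resonant : clear implicits.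

Definition row_int (f : 'I_d -> int) : 'rV[rat]_d := \row_i (f i)%:~R.

(** The space V_j(m) for N = N_j, as a rational space: its dimension is at most d and the dot
    product is positive definite. *)
Definition resonance N m : {vspace 'rV[rat]_d} :=
  <<[seq row_int (boxval x) | x : box N in resonant N m]>>%VS.

Definition signature_type N := {ffun box N -> option 'I_(N * N).*2.+1}.

(** This is the kind of m. A product with a resonant vector lies in [-N^2, N^2], so the number of
    kinds depends on N and d only; [None] makes equal kinds have the same resonant vectors. *)
Definition signature N m : signature_type N :=
  [ffun x => if resonant N m x then
     Some (inord (absz (sdot m (boxval x) + (N * N)%:Z))) else None].

Lemma signature_eq N m n (x : box N) : signature N m = signature N n ->
  resonant N m x -> sdot m (boxval x) = sdot n (boxval x).
Proof.
move=> /ffunP/(_ x); rewrite !ffunE /resonant => + rm; rewrite rm.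
case: ifP => // rn [] /(congr1 (@nat_of_ord _)); rewrite !inordK; lia.
Qed.

Lemma signature_rigid N m n : signature N m = signature N n ->
  row_int (fun i => m (lift ord0 i) - n (lift ord0 i)) \in resonance N m ->
  forall i, m (lift ord0 i) = n (lift ord0 i).
Proof.
move=> smn; set f := fun i => _; set r := row_int f => rV i.
pose phi : 'Hom('rV[rat]_d, 'M[rat]_1) := linfun (mulmxr r^T).
have phiE (g : 'I_d -> int) : phi (row_int g) = (\sum_j (g j * f j)%:~R)%:M.
  rewrite lfunE /=; apply/matrixP => a b; rewrite !ord1 !mxE eqxx mulr1n.
  by apply: eq_bigr => j _; rewrite !mxE intrM.
(* r is orthogonal to every resonant vector, hence to itself. *)
have : r \in lker phi.
  suff /subvP : (resonance N m <= lker phi)%VS by apply.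
  rewrite /resonance; apply/span_subvP => _ /mapP[x + ->]; rewrite mem_enum => rx.
  rewrite memv_ker phiE -(rmorph_sum (intmul 1)) (_ : \sum_j _ = 0) ?mulr0z ?raddf0//.
  have e := signature_eq smn rx.
  transitivity (sdot m (boxval x) - sdot n (boxval x)); last by rewrite e subrr.
  rewrite /sdot -sumrB; apply: eq_bigr => j _; rewrite /f; ring.
rewrite memv_ker phiE => /eqP/matrixP/(_ ord0 ord0); rewrite !mxE eqxx mulr1n.
move=> /eqP; rewrite -(rmorph_sum (intmul 1)) intr_eq0 psumr_eq0; last first.
  by move=> j _; rewrite -expr2 sqr_ge0.
move=> /allP/(_ i (mem_index_enum _)); rewrite /= -expr2 sqrf_eq0 subr_eq0.
by move/eqP.
Qed.

Lemma resonance_mono N N' m : (N <= N')%N -> (resonance N m <= resonance N' m)%VS.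
Proof.
move=> NN; rewrite /resonance; apply/span_subvP => _ /mapP[x + ->].
rewrite mem_enum => rx; apply: memv_span.
have [|x' xx'] := @boxvalP N' (boxval x).
  by move=> i; rewrite /boxval; move: (nat_of_ord (x i)) (ltn_ord (x i)) => a; lia.
apply/mapP; exists x'; last by congr row_int; apply/funext => i; rewrite xx'.
rewrite mem_enum; move: rx; change (resonant N m x -> resonant N' m x').
rewrite /resonant /sdot.
under [X in _ -> `|X| <= _]eq_bigr do rewrite xx'.
by move=> /le_trans; apply; rewrite lez_nat leq_mul.
Qed.

Lemma resonance_jumps (Ns : nat -> nat) J m : (forall j, (Ns j <= Ns j.+1)%N) ->
  (\sum_(j < J) (resonance (Ns j) m != resonance (Ns j.+1) m) <= d)%N.
Proof.
(* The bound by the dimension of the last space is the one that can be proved by induction: every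
   jump raises it. *)
move=> NsS; apply: (@leq_trans (\dim (resonance (Ns J) m))); last first.
  have := dimvS (subvf (resonance (Ns J) m)).
  by rewrite dimvf /dim /= mul1n.
elim: J => [|J IH]; first by rewrite big_ord0.
rewrite big_ord_recr /=; have sub := resonance_mono m (NsS J).
case: eqVneq => [<-|ne]; first by rewrite addn0.
rewrite addn1; apply: (leq_ltn_trans IH).
by rewrite ltn_neqAle dimvS// andbT dimv_leqif_eq.
Qed.

(** These weights make Cauchy-Schwarz inductive: adding one term to a sum of n terms with constant n
    gives (n + 1) / n * n = n + 1. *)
Lemma sqnD_weighted (n : nat) (x y : R[i]) : (0 < n)%N ->
  sqn (x + y) <= n.+1%:R * sqn x + n.+1%:R / n%:R * sqn y.
Proof.
move=> n0; have {n0} n0 : 0 < n%:R :> R by rewrite ltr0n.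
rewrite -natr1; move: (n%:R) n0 => q q0.
rewrite -subr_ge0 (_ : _ - _ = ((q * complex.Re x - complex.Re y) ^+ 2 +
    (q * complex.Im x - complex.Im y) ^+ 2) / q).
  by rewrite divr_ge0 ?addr_ge0 ?sqr_ge0// ltW.
by rewrite /sqn cReD cImD; field; rewrite gt_eqF.
Qed.

Lemma nn_sum_le (I : Type) (r : seq I) (F : I -> Z -> R[i]) :
  (forall i, Lmeasurable mu (F i)) ->
  (nn mu (fun z => \sum_(i <- r) F i z)%R <=
    (size r)%:R%:E * \sum_(i <- r) nn mu (F i))%E.
Proof.
move=> mF; elim: r => [|i r IH].
  by rewrite big_nil mule0; under eq_fun do rewrite big_nil; rewrite nn0.
have S0 : (0 <= \sum_(j <- r) nn mu (F j))%E by apply: sume_ge0 => j _; exact: nn_ge0.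
under eq_fun do rewrite big_cons; rewrite big_cons /=.
have mS : Lmeasurable mu (fun z => \sum_(j <- r) F j z) by exact: Lm_sum.
(* A single term is treated apart, since the weight (n + 1) / n requires n > 0. *)
case: r => [|a r] in IH S0 mS *.
  under eq_fun do rewrite big_nil addr0; by rewrite big_nil adde0 mul1e.
set n := size (a :: r) in IH *; have n0 : 0 < n%:R :> R by rewrite ltr0n.
have := @nn_leZ2 _ _ _ mu n.+1%:R (n.+1%:R / n%:R)
  (fun z => F i z + \sum_(j <- a :: r) F j z) (F i)
  (fun z => \sum_(j <- a :: r) F j z) (ler0n _ _) _ (mF i) mS _.
move=> h; apply: (le_trans (h _ _)).
- by rewrite divr_ge0.
- by apply: aeW => z; exact: sqnD_weighted.
rewrite (ge0_muleDr n.+1%:R%:E (nn_ge0 mu (F i)) S0); apply: leeD2l.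
apply: (@le_trans _ _ ((n.+1%:R / n%:R)%:E * (n%:R%:E * \sum_(j <- a :: r) nn mu (F j)))%E).
  by rewrite lee_wpmul2l// lee_fin divr_ge0.
by rewrite muleA -EFinM divfK// gt_eqF.
Qed.

(* Within a cluster of frequencies of equal signature, the products of p with the
   exponentials are orthogonal. *)
Lemma cluster_bound N N' D (s : seq (R[i] * freq d)) (I : finType) (P : pred I)
    (k : I -> freq d) (c : I -> R[i]) (p := fun z => \sum_(a <- s) a.1 * ee a.2 z) :
  (d.+1 * D <= N')%N ->
  (forall a b i, a \in s -> b \in s -> `|a.2 i - b.2 i| <= D%:Z) ->
  injective k -> (forall a, paraboloid (k a)) ->
  (forall a, P a -> resonance N (k a) = resonance N' (k a)) ->
  (nn mu (fun z => p z * \sum_(a | P a) c a * ee (k a) z)%R <=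
    (#|signature_type N|%:R * \sum_(a | P a) sqn (c a))%:E * nn mu p)%E.
Proof.
move=> DN sD kinj kP kV.
have Lp : LB mu p by apply: LB_sum => a; apply: LBZ; exact: LB_ee.
pose F a z := p z * (c a * ee (k a) z).
have Lce a : LB mu (fun z => c a * ee (k a) z) by apply: LBZ; exact: LB_ee.
have LF a : LB mu (F a) by exact: LBM.
pose sg a := signature N (k a).
rewrite (_ : nn mu _ = nn mu (fun z => \sum_(g : signature_type N)
    \sum_(a | P a && (sg a == g)) F a z)); last first.
  congr nn; apply/funext => z; rewrite mulr_sumr.
  by rewrite (partition_big sg predT).
apply: (le_trans (nn_sum_le _ _)).
  by move=> g; have [] : LB mu (fun z => \sum_(a | P a && (sg a == g)) F a z)
    by apply: LB_sum.
have -> : size (index_enum (signature_type N)) = #|{: signature_type N}|.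
  by rewrite cardT enumT [index_enum _]unlock.
rewrite EFinM -muleA lee_wpmul2l//.
rewrite (partition_big sg predT)//= -sumEFin ge0_sume_distrl; last first.
  by move=> g _; rewrite lee_fin sumr_ge0// => a _; exact: sqn_ge0.
apply: lee_sum => g _.
rewrite (nn_orthogonal (F := F)).
- rewrite -sumEFin ge0_sume_distrl; last by move=> a _; rewrite lee_fin sqn_ge0.
  apply: lee_sum => a _; apply: nn_leZ; [exact: sqn_ge0|exact: Lp.1|].
  by apply: aeW => z; rewrite /F !sqnM sqn_ee mulr1 mulrC.
- by move=> a; exact: LB_L2_st.
move=> a b /andP[Pa /eqP ga] /andP[Pb /eqP gb] ab.
transitivity (cintegral mu (fun z => \sum_(x <- s) \sum_(y <- s)
   (c a * conjc (c b) * (x.1 * conjc y.1)) * ee (x.2 - y.2 + (k a - k b)) z)).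
  congr cintegral; apply/funext => z; rewrite /F /p !rmorphM /= rmorph_sum.
  rewrite mulrACA mulr_suml mulr_suml; apply: eq_bigr => x _.
  rewrite mulr_sumr mulr_suml; apply: eq_bigr => y _.
  by rewrite eeD !eeB rmorphM /=; ring.
have Ixy (x y : R[i] * freq d) : cintegrable mu (fun z =>
   (c a * conjc (c b) * (x.1 * conjc y.1)) * ee (x.2 - y.2 + (k a - k b)) z).
  by apply: cintegrable_LB; apply: LBZ; exact: LB_ee.
rewrite cintegral_sum; last by move=> x; exact: cintegrable_sum.
rewrite big_seq big1// => x xs; rewrite cintegral_sum// big_seq big1// => y ys.
rewrite cintegralZ; last exact/cintegrable_LB/LB_ee.
rewrite cintegral_ee; case: eqP => [e|_]; last by rewrite mulr0.
(* Only here do a and b interact: their difference is a difference of frequencies of p, hence at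
   most D in each coordinate. *)
have kab i : k a i - k b i = y.2 i - x.2 i.
  have /ffunP/(_ i) := e; rewrite !ffunE => e'.
  by apply: (addrI (x.2 i - y.2 i)); rewrite e'; ring.
have kD i : `|k a i - k b i| <= D%:Z by rewrite kab; exact: sD.
case/eqP : ab; apply: kinj; apply: paraboloid_eq => //.
apply: (@signature_rigid N); first exact: etrans ga (esym gb).
rewrite kV//; apply: memv_span.
have DN' : (D <= N')%N by apply: leq_trans DN; rewrite leq_pmull.
have [|x' xx'] := @boxvalP N' (fun i => k a (lift ord0 i) - k b (lift ord0 i)).
  by move=> i; apply: (le_trans (kD _)); rewrite lez_nat.
apply/mapP; exists x'; last by congr row_int; apply/funext => i; rewrite xx'.
rewrite mem_enum; change (is_true (resonant N' (k a) x')); rewrite /resonant /sdot.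
under eq_bigr do rewrite xx'.
pose f i := k a (lift ord0 i) - k b (lift ord0 i).
pose B := \sum_i k a (lift ord0 i) * f i.
(* With f = k a - k b in space, |k b|^2 = |k a|^2 - 2 B + |f|^2, while the time frequencies differ
   by at most D. So 2 |B| <= d D^2 + D <= N'^2, and f is resonant for k a at size N'. *)
have psb : psum (k b) = psum (k a) - 2 * B + \sum_i f i ^+ 2.
  rewrite /psum /B mulr_sumr -sumrB -big_split; apply: eq_bigr => i _.
  by rewrite /f /=; ring.
have f2 : \sum_i f i ^+ 2 <= (d * (D * D))%:Z.
  apply: (@le_trans _ _ (\sum_(i < d) (D * D)%:Z)); last first.
    by rewrite sumr_const card_ord -mulr_natl PoszM natz.
  apply: ler_sum => i _; have := kD (lift ord0 i); rewrite -/(f i) => h.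
  by rewrite -real_normK ?num_real// PoszM -expr2 lerXn2r ?nnegrE.
have f20 : 0 <= \sum_i f i ^+ 2 by apply: sumr_ge0 => i _; exact: sqr_ge0.
have := kD ord0; rewrite !paraboloidE// psb => h0.
have DD : (d * (D * D) + D <= N' * N')%N.
  apply: (@leq_trans ((d.+1 * D) * (d.+1 * D))); last exact: leq_mul.
  nia.
change (`|B| <= (N' * N')%:Z).
move: f2 f20 h0; clear psb; move: (\sum_i f i ^+ 2) B => A B; lia.
Qed.

End clusters.

Section wave_algebra.
Variables (R : realType) (d : nat).
Local Notation Z := (spacetime R d).
Local Notation mu := (@spacetime_measure R d).
Implicit Types f g : Z -> R[i].

Let C : set (Z -> R[i]) := [set f | trig predT f].
Let U : set (Z -> R[i]) := [set v | trig (@paraboloid d) v].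

Let C_LB f : C f -> LB mu f. Proof. exact: LB_trig. Qed.
Let U_Lm f : U f -> Lmeasurable mu f. Proof. by move=> /LB_trig[]. Qed.
Let C_cst c : C (fun=> c). Proof. exact: trig_cst. Qed.
Let C_D f g : C f -> C g -> C (fun z => f z + g z). Proof. exact: trigD. Qed.
Let C_M f g : C f -> C g -> C (fun z => f z * g z). Proof. exact: trigM. Qed.
Let U_w f : U f -> (nn mu f <= nn mu f)%E. Proof. by []. Qed.

Lemma wave_LB f : wave_approximable f -> LB mu f. Proof. by case. Qed.

Lemma wave_ae f g : ae_equal mu f g -> wave_approximable f -> wave_approximable g.
Proof. exact: approx_ae. Qed.

Lemma wave_cst c : wave_approximable (fun _ : Z => c).
Proof. exact: approx_cst. Qed.

Lemma wave_close f : LB mu f ->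
  (forall e : R, 0 < e -> exists g, wave_approximable g /\
     forall u, trig (@paraboloid d) u ->
       (nn mu (fun z => (f z - g z) * u z)%R <= e%:E * nn mu u)%E) ->
  wave_approximable f.
Proof. exact: approx_close. Qed.

Lemma waveD f g : wave_approximable f -> wave_approximable g ->
  wave_approximable (fun z => f z + g z).
Proof. exact: approxD. Qed.

Lemma waveM f g : wave_approximable f -> wave_approximable g ->
  wave_approximable (fun z => f z * g z).
Proof. exact: approxM. Qed.

Lemma waveZ c f : wave_approximable f -> wave_approximable (fun z => c * f z).
Proof. by apply: waveM; exact: wave_cst. Qed.

Lemma wave_sum (I : Type) (r : seq I) (P : pred I) (F : I -> Z -> R[i]) :
  (forall i, wave_approximable (F i)) ->
  wave_approximable (fun z => \sum_(i <- r | P i) F i z).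
Proof. exact: approx_sum. Qed.

Lemma wave_prod (I : Type) (r : seq I) (P : pred I) (F : I -> Z -> R[i]) :
  (forall i, wave_approximable (F i)) ->
  wave_approximable (fun z => \prod_(i <- r | P i) F i z).
Proof.
move=> aF; elim: r => [|i r ih].
  by under eq_fun do rewrite big_nil; exact: wave_cst.
by under eq_fun do rewrite big_cons; case: (P i) => //; exact: waveM.
Qed.

End wave_algebra.

(** * Step functions on approximable sets *)

Section step_functions.
Variables (R : realType) (d : nat).
Local Notation Z := (spacetime R d).
Local Notation mu := (@spacetime_measure R d).
Implicit Types l u h : Z -> R.

(** A partition almost everywhere with a value on each part, rather than a sum of indicators: the
    maximum of two such functions is then read off from the common refinement. *)
Definition wave_step l := exists (I : finType) (a : I -> R) (A : I -> set Z),
  (forall i, wave_approximable (ind (A i))) /\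
  {ae mu, forall z, exists i, [/\ A i z, forall j, A j z -> j = i & l z = a i]}.

Lemma wave_stepW l : wave_step l -> wave_approximable (fun z => (l z)%:C%C).
Proof.
move=> [I [a [A [wA lA]]]].
apply: (@wave_ae _ _ (fun z => \sum_i (a i)%:C%C * ind (A i) z)); last first.
  by apply: wave_sum => i; exact: waveZ.
apply: filterS lA => z [i [Ai iA ->]].
rewrite (bigD1 i)//= big1 ?addr0 => [|j ji].
  by rewrite /ind indicE mem_set// mulr1.
rewrite /ind indicE memNset ?mulr0// => /iA ji'.
by rewrite ji' eqxx in ji.
Qed.

Lemma wave_step_max l u : wave_step l -> wave_step u ->
  wave_step (fun z => Num.max (l z) (u z)).
Proof.
move=> [I [a [A [wA lA]]]] [J [b [B [wB uB]]]].
exists (I * J)%type, (fun p => Num.max (a p.1) (b p.2)), (fun p => A p.1 `&` B p.2).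
split; first by move=> p; rewrite indI; exact: waveM.
apply: filterS2 lA uB => z [i [Ai iA ->]] [j [Bj jB ->]].
by exists (i, j); split => // -[i' j'] [/= /iA -> /jB ->].
Qed.

Lemma wave_step_gap l u : wave_step l -> wave_step u ->
  wave_approximable (fun z => (u z - l z)%:C%C).
Proof.
move=> sl su.
rewrite (_ : (fun z => _) = fun z => (u z)%:C%C + (-1) * (l z)%:C%C).
  by apply: waveD; [exact: wave_stepW|apply: waveZ; exact: wave_stepW].
by apply/funext => z; rewrite rmorphB /= mulN1r.
Qed.

Lemma wave_step_bigmax (l0 : Z -> R) (l : nat -> Z -> R) J : wave_step l0 ->
  (forall j, wave_step (l j)) ->
  wave_step (fun z => \big[Num.max/l0 z]_(j < J) l j z).
Proof.
move=> s0; elim: J l => [|J ih] l sl.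
  by under eq_fun do rewrite big_ord0.
under eq_fun do rewrite big_ord_recl; apply: wave_step_max => //.
by apply: (ih (fun j => l j.+1)) => j; exact: sl.
Qed.

End step_functions.

(** * The multiscale argument *)

Section multiscale.
Variables (R : realType) (d : nat).
Local Notation Z := (spacetime R d).
Local Notation mu := (@spacetime_measure R d).
Implicit Types l u h : Z -> R.

Definition tseval (s : seq (R[i] * freq d)) (z : Z) : R[i] := \sum_(a <- s) a.1 * ee a.2 z.

Lemma freq_spread (s : seq (R[i] * freq d)) : exists D : nat,
  forall a b i, a \in s -> b \in s -> `|a.2 i - b.2 i| <= D%:Z.
Proof.
pose F (a b : R[i] * freq d) := (\max_i absz (a.2 i - b.2 i : int))%N.
exists (\max_(a <- s) \max_(b <- s) F a b)%N => a b i as_ bs.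
rewrite -abszE lez_nat.
apply: leq_trans (@leq_bigmax_seq _ s predT (fun a => \max_(b <- s) F a b)%N a as_ isT).
apply: leq_trans (@leq_bigmax_seq _ s predT (F a) b bs isT).
exact: (leq_bigmax (F := fun i => absz (a.2 i - b.2 i))).
Qed.

Variables (h : Z -> R) (M : R).
Hypothesis M0 : 0 <= M.
Hypothesis bh : LB mu (fun z => (h z)%:C%C).
Hypothesis sandwich : forall eta : R, 0 < eta -> exists l u,
  [/\ wave_step l, wave_step u, {ae mu, forall z, l z <= h z <= u z},
      {ae mu, forall z, `|l z| <= M /\ `|u z| <= M} &
      (nn mu (fun z => (u z - l z)%:C%C) <= eta%:E)%E].

(** The data attached to a size N: the two step functions, a polynomial s close to their gap, and
    the next size N'. The norm of s compensates the number of kinds at size N, and N' exceeds the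
    spread of the frequencies of s as [cluster_bound] requires. *)
Definition scale (e : R) N (q : (Z -> R) * (Z -> R) * seq (R[i] * freq d) * nat) :=
  let: (l, u, s, N') := q in
  [/\ wave_step l /\ wave_step u, {ae mu, forall z, l z <= h z <= u z},
      {ae mu, forall z, `|l z| <= M /\ `|u z| <= M},
      ((#|signature_type d N|%:R)%:E * nn mu (tseval s) <= e%:E)%E &
      [/\ (forall v, trig (@paraboloid d) v ->
            (nn mu (fun z => ((u z - l z)%:C%C - tseval s z) * v z)%R <= e%:E * nn mu v)%E),
          (N <= N')%N &
          exists2 D, (d.+1 * D <= N')%N &
            forall a b i, a \in s -> b \in s -> `|a.2 i - b.2 i| <= D%:Z]].

Lemma scale_exists (e : R) N : 0 < e -> exists q, scale e N q.
Proof.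
move=> e0; pose B : R := #|signature_type d N|%:R + 1.
have B0 : 0 < B by rewrite ltr_wpDl.
have m0 := mass_ge0 R d.
have [l [u [sl su lhu lu wlu]]] := sandwich (divr_gt0 e0 (mulr_gt0 (ltr0n R 4) B0 : 0 < 4 * B)).
set w := fun z => (u z - l z)%:C%C in wlu.
have aw : wave_approximable w by exact: wave_step_gap.
(* The polynomial s has squared norm at most 2 * e / (4 * B) + 2 * e2 * mass, which has to be at
   most e / B. *)
pose e2 := e / (4 * B * (mass R d + 1)).
have e20 : 0 < e2 by rewrite divr_gt0// !mulr_gt0// ltr_wpDl.
have e2e : e2 <= e.
  rewrite /e2 ler_pdivrMr ?mulr_gt0// ?ltr_wpDl// ler_peMr ?(ltW e0)//.
  have B1 : 1 <= B by rewrite lerDr.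
  nra.
have [p [[s [_ ps]] wp]] := aw.2 _ e20.
have [D sD] := freq_spread s.
exists (l, u, s, N + d.+1 * D)%N; split => //; last first.
  split; last by exists D => //; rewrite leq_addl.
    move=> v tv; rewrite -/(w _); have := wp v tv; rewrite ps => /le_trans; apply.
    by rewrite lee_wpmul2r ?nn_ge0// lee_fin.
  exact: leq_addr.
have bw := wave_LB aw.
have Lp : LB mu (tseval s) by apply: LB_sum => a; apply: LBZ; exact: LB_ee.
(* The constant 1 is itself a wave, of frequency 0, so that the operator bound contains an L^2
   bound. *)
have wp1 : (nn mu (fun z => w z - tseval s z)%R <= (e2 * mass R d)%:E)%E.
  rewrite (_ : (fun z => _) = fun z => (w z - p z) * 1); last first.
    by apply/funext => z; rewrite mulr1 ps.
  rewrite EFinM -nn1; apply: wp.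
  have := @trig_ee R d (@paraboloid d) 1 0; rewrite (_ : (fun z => _) = fun=> 1).
    by apply; rewrite /paraboloid ffunE big1 ?oppr0// => x _; rewrite ffunE expr0n.
  by apply/funext => z; rewrite ee0 mulr1.
have np : (nn mu (tseval s) <= (e / B)%:E)%E.
  rewrite (_ : tseval s = fun z => w z - (w z - tseval s z)); last first.
    by apply/funext => z; rewrite subKr.
  apply: (le_trans (nnB bw.1 (LBB bw Lp).1)).
  apply: (@le_trans _ _ (2%:E * (e / (4 * B))%:E + 2%:E * (e2 * mass R d)%:E)%E).
    by rewrite leeD// lee_wpmul2l// lee_fin.
  rewrite -!EFinM -EFinD lee_fin -subr_ge0.
  rewrite (_ : _ - _ = e / B / 2 / (mass R d + 1)); last first.
    by rewrite /e2; field; rewrite !gt_eqF// ltr_wpDl.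
  by rewrite !divr_ge0// ?(ltW e0) ?(ltW B0)// addr_ge0.
apply: (@le_trans _ _ (B%:E * (e / B)%:E)%E).
  by apply: lee_pmul; rewrite ?lee_fin ?nn_ge0// lerDl.
by rewrite -EFinM mulrC divfK ?gt_eqF.
Qed.

(** Pigeonhole: by [resonance_jumps] each frequency is counted for at most d values of j, so the J
    masses add up to at most d times the total mass. *)
Lemma bad_scale (Ns : nat -> nat) J (n : nat) (k : 'I_n -> freq d) (x : 'I_n -> R) :
  (0 < J)%N -> (forall j, (Ns j <= Ns j.+1)%N) -> (forall i, 0 <= x i) ->
  exists j : 'I_J, J%:R * \sum_(i | resonance (Ns j) (k i) != resonance (Ns j.+1) (k i)) x i
    <= d%:R * \sum_i x i.
Proof.
move=> J0 NsS x0; pose S (j : 'I_J) :=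
  \sum_(i | resonance (Ns j) (k i) != resonance (Ns j.+1) (k i)) x i.
apply: contrapT => H.
have lt j : d%:R * \sum_i x i < J%:R * S j.
  by rewrite ltNge; apply/negP => h'; apply: H; exists j.
have : \sum_(j < J) S j <= d%:R * \sum_i x i.
  rewrite /S (eq_bigr (fun j : 'I_J => \sum_i
     (resonance (Ns j) (k i) != resonance (Ns j.+1) (k i))%:R * x i)); last first.
    by move=> j _; rewrite big_mkcond; apply: eq_bigr => i _; case: ifP; rewrite ?mul1r ?mul0r.
  rewrite exchange_big mulr_sumr; apply: ler_sum => i _ /=.
  by rewrite -mulr_suml ler_wpM2r// -natr_sum ler_nat resonance_jumps.
apply/negP; rewrite -ltNge.
have JR : 0 < J%:R :> R by rewrite ltr0n.
rewrite -(ltr_pM2l JR) [ltRHS]mulr_sumr -[J in J%:R * _ < _]card_ord.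
rewrite mulr_natl -sumr_const; apply: ltr_sum => //.
by apply/hasP; exists (Ordinal J0); rewrite ?mem_index_enum.
Qed.

Theorem sandwich_approximable : wave_approximable (fun z => (h z)%:C%C).
Proof.
apply: wave_close => // e e0.
have m0 := mass_gt0 R d; set m := mass R d in m0.
(* The frequencies without a jump cost 4 * e1 * (1 + m) times their mass, which is half of the
   allowed e * m. *)
pose e1 := e * m / (8 * (1 + m)).
have e10 : 0 < e1 by rewrite divr_gt0 ?mulr_gt0 ?addr_gt0.
have [q qN] := choice (fun N => scale_exists N e10).
pose Ns j := iter j (fun N => (q N).2) 0%N.
pose l j := (q (Ns j)).1.1.1; pose u j := (q (Ns j)).1.1.2.
pose s j := (q (Ns j)).1.2.
have qj j : scale e1 (Ns j) (l j, u j, s j, Ns j.+1).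
  by have := qN (Ns j); rewrite /l /u /s /Ns /=; case: (q _) => [[[]]].
have NsS j : (Ns j <= Ns j.+1)%N by have [_ _ _ _ []] := qj j.
(* The frequencies with a jump cost 8 * M^2 times m times their mass, and they carry at most the
   fraction d / J of it: this J keeps them within the other half. *)
pose J := (Num.truncn (16 * M ^+ 2 * d%:R / e)).+1.
have JM : 16 * M ^+ 2 * d%:R <= e * J%:R.
  by rewrite [leRHS]mulrC -ler_pdivrMr//; apply: ltW; exact: truncnS_gt.
(* The scale j will depend on the wave whereas the approximant must not; the maximum is at least as
   close to h as every l_j. *)
pose g z := \big[Num.max/l 0 z]_(j < J) l j z.
have sg : wave_step g.
  by apply: wave_step_bigmax => [|j]; [have [[]] := qj 0%N|have [[]] := qj j].
exists (fun z => (g z)%:C%C); split; first exact: wave_stepW.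
move=> _ /trig_normal[n [k [c [kinj kP ->]]]].
have J0 : (0 < J)%N by [].
have [j bad] := bad_scale k J0 NsS (fun i => sqn_ge0 (c i)).
pose bd i := resonance (Ns j) (k i) != resonance (Ns j.+1) (k i).
pose v (P : pred 'I_n) z := \sum_(i | P i) c i * ee (k i) z.
have Lv P : LB mu (v P).
  by apply: LB_sum => i; apply: LBZ; exact: LB_ee.
have Lg := wave_LB (wave_stepW sg).
pose w z := (u j z - l j z)%:C%C.
have Hae : {ae mu, forall z, sqn ((h z)%:C%C - (g z)%:C%C) <= sqn (w z) /\
    sqn ((h z)%:C%C - (g z)%:C%C) <= 4 * M ^+ 2}.
  have A1 : {ae mu, forall z, forall i, l i z <= h z <= u i z}.
    by apply/ae_foralln => i; have [] := qj i.
  have A2 : {ae mu, forall z, forall i, `|l i z| <= M /\ `|u i z| <= M}.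
    by apply/ae_foralln => i; have [] := qj i.
  apply: filterS2 A1 A2 => z lhu lu.
  have gh : g z <= h z.
    by apply: bigmax_le => [|i _]; [have /andP[] := lhu 0%N|have /andP[] := lhu i].
  have lg : l j z <= g z by exact: (le_bigmax _ (fun i : 'I_J => l i z)).
  have /andP[_ hu] := lhu j; have [] := lu j.
  rewrite !ler_norml => /andP[lM _] /andP[_ uM].
  rewrite -rmorphB /w !sqnC (_ : 4 * M ^+ 2 = (2 * M) ^+ 2); last by ring.
  by rewrite !lerXn2r ?nnegrE; lra.
have [_ _ _ cs [ws _ [D DN sD]]] := qj j.
have Lhg : LB mu (fun z => (h z)%:C%C - (g z)%:C%C) by exact: LBB.
have Lw : LB mu w by have [[sl su] _ _ _ _] := qj j; exact/wave_LB/wave_step_gap.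
have Ls : LB mu (tseval (s j)) by apply: LB_sum => a; apply: LBZ; exact: LB_ee.
pose gd i := ~~ bd i.
pose S (P : pred 'I_n) := \sum_(i | P i) sqn (c i).
have S0 P : 0 <= S P by apply: sumr_ge0 => i _; exact: sqn_ge0.
have nnv P : nn mu (v P) = (m * S P)%:E by rewrite nn_parseval.
have vgb : v predT = fun z => v gd z + v bd z.
  by apply/funext => z; rewrite /v (bigID bd)/= addrC.
have SE : S predT = S gd + S bd by rewrite /S (bigID bd)/= addrC.
have good1 : (nn mu (fun z => tseval (s j) z * v gd z)%R <= (S gd * e1)%:E)%E.
  have Pgd a : gd a -> resonance (Ns j) (k a) = resonance (Ns j.+1) (k a).
    by rewrite /gd /bd negbK => /eqP.
  apply: (le_trans (cluster_bound c DN sD kinj kP Pgd)).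
  by rewrite mulrC !EFinM -muleA; apply: lee_wpmul2l; rewrite ?lee_fin; first exact: S0.
have good2 : (nn mu (fun z => (w z - tseval (s j) z) * v gd z)%R <= (e1 * (m * S gd))%:E)%E.
  rewrite EFinM -nnv; apply: ws; apply: trig_sum => i _; exact: trig_ee.
have good : (nn mu (fun z => ((h z)%:C%C - (g z)%:C%C) * v gd z)%R <=
    2%:E * (S gd * e1)%:E + 2%:E * (e1 * (m * S gd))%:E)%E.
  apply: (@le_trans _ _ (nn mu (fun z => w z * v gd z)%R)).
    apply: nn_le; apply: filterS Hae => z [hw _].
    by rewrite !sqnM ler_wpM2r// sqn_ge0.
  rewrite (_ : (fun z => w z * v gd z) = fun z => tseval (s j) z * v gd z +
      (w z - tseval (s j) z) * v gd z); last by apply/funext => z; ring.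
  apply: (le_trans (nnD (LBM Ls (Lv gd)).1 (LBM (LBB Lw Ls) (Lv gd)).1)).
  by rewrite leeD// lee_wpmul2l// lee_fin.
have badb : (nn mu (fun z => ((h z)%:C%C - (g z)%:C%C) * v bd z)%R <=
    (4 * M ^+ 2)%:E * (m * S bd)%:E)%E.
  rewrite -nnv; apply: nnM_le; [by rewrite mulr_ge0 ?sqr_ge0| |exact: (Lv bd).1].
  by apply: filterS Hae => z [].
change (nn mu (fun z => ((h z)%:C%C - (g z)%:C%C) * v predT z)%R <= e%:E * nn mu (v predT))%E.
rewrite nnv (_ : (fun z => _) = fun z => ((h z)%:C%C - (g z)%:C%C) * v gd z +
  ((h z)%:C%C - (g z)%:C%C) * v bd z); last by apply/funext => z; rewrite vgb mulrDr.
apply: (le_trans (nnD (LBM Lhg (Lv gd)).1 (LBM Lhg (Lv bd)).1)).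
apply: (@le_trans _ _ (2%:E * (2%:E * (S gd * e1)%:E + 2%:E * (e1 * (m * S gd))%:E) +
   2%:E * ((4 * M ^+ 2)%:E * (m * S bd)%:E))%E).
  by rewrite leeD// lee_wpmul2l// lee_fin.
do ![rewrite -EFinM|rewrite -EFinD]; rewrite lee_fin.
have Sb : 8 * M ^+ 2 * S bd <= e / 2 * S predT.
  have J0' : 0 < J%:R :> R by rewrite ltr0n.
  rewrite -(ler_pM2l J0').
  apply: (@le_trans _ _ (8 * M ^+ 2 * (d%:R * S predT))).
    rewrite mulrCA ler_wpM2l ?mulr_ge0 ?sqr_ge0//.
  have := ler_wpM2r (S0 predT) JM; lra.
have e1E : 4 * e1 * (1 + m) = e / 2 * m.
  by rewrite /e1; field; rewrite gt_eqF// addr_gt0.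
rewrite (_ : _ + _ = 4 * e1 * (1 + m) * S gd + m * (8 * M ^+ 2 * S bd)); last by ring.
rewrite e1E; have := ler_wpM2l (ltW m0) Sb.
have : e / 2 * m * S gd <= e / 2 * m * S predT.
  by rewrite ler_wpM2l ?mulr_ge0 ?divr_ge0 ?(ltW e0) ?(ltW m0)// SE lerDl.
lra.
Qed.

End multiscale.

(** * Riemann integrable functions *)

Section squeeze.
Context dT (T : measurableType dT) (R : realType) (mu : {measure set T -> \bar R}).

(** The supremum of the l_n is Borel and equals h wherever the infimum of the gaps vanishes; that
    infimum has integral 0, hence vanishes almost everywhere. *)
Lemma squeeze_Lmeasurable (h : T -> R) (l u : nat -> T -> R) :
  (forall n, measurable_fun setT (l n)) -> (forall n, measurable_fun setT (u n)) ->
  (forall n, {ae mu, forall z, l n z <= h z <= u n z}) ->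
  (forall n, (\int[mu]_z `|u n z - l n z|%:E <= (n.+1%:R^-1)%:E)%E) ->
  Lmeasurable mu (fun z => (h z)%:C%C).
Proof.
move=> ml mu_ lhu gap.
pose F z := einfs (fun n => `|u n z - l n z|%:E) 0%N.
pose L z := fine (esups (fun n => (l n z)%:E) 0%N).
have mF : measurable_fun setT F.
  apply: (@measurable_fun_einfs _ _ _ setT (fun n z => `|u n z - l n z|%:E)) => n.
  apply/measurable_EFinP; apply: measurableT_comp => //.
  exact: measurable_funB.
have Fle n z : (F z <= `|u n z - l n z|%:E)%E by apply: ereal_inf_lbound; exists n.
have F0 z : (0 <= F z)%E.
  by apply/ereal_infP => _ [n _ <-]; rewrite lee_fin.
have iF : (\int[mu]_z `|F z| = 0)%E.
  apply/eqP; rewrite eq_le integral_ge0 ?andbT//; apply/lee_addgt0Pr => e e0.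
  rewrite add0e; pose n := Num.truncn e^-1.
  apply: (@le_trans _ _ (\int[mu]_z `|u n z - l n z|%:E)%E).
    apply: ge0_ae_le_nonmeasurable_integral => [z|z|].
    - exact: abse_ge0.
    - by rewrite lee_fin.
    - by apply: aeW => z; rewrite gee0_abs.
  apply: (le_trans (gap n)); rewrite lee_fin.
  by rewrite -[leRHS]invrK lef_pV2 ?posrE ?invr_gt0//; apply/ltW/truncnS_gt.
have F00 := (ae_eq_integral_abs mu measurableT mF).1 iF.
have lhu' : {ae mu, forall z, forall n, l n z <= h z <= u n z} by exact/ae_foralln.
apply/LmP; exists (fun z => (L z)%:C%C); split.
  apply: BorelC; apply: measurableT_comp; first exact: fine_measurable.
  apply: (@measurable_fun_esups _ _ _ setT (fun n z => (l n z)%:E)) => n.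
  exact/measurable_EFinP.
apply: filterS2 F00 lhu' => z /(_ I) Fz {}lhu; congr (_%:C)%C; rewrite /L.
suff -> : esups (fun n => (l n z)%:E) 0%N = (h z)%:E by [].
apply/eqP; rewrite eq_le; apply/andP; split.
  by apply/ereal_supP => _ [n _ <-]; rewrite lee_fin; have /andP[] := lhu n.
apply/lee_addgt0Pr => e e0.
have [n le] : exists n, `|u n z - l n z| < e.
  apply: contrapT => H.
  have : (e%:E <= F z)%E.
    apply/ereal_infP => _ [n _ <-]; rewrite lee_fin leNgt; apply/negP => ?.
    by apply: H; exists n.
  by rewrite Fz lee_fin leNgt e0.
apply: (@le_trans _ _ ((l n z)%:E + e%:E)%E); last first.
  by rewrite leeD2r//; apply: ereal_sup_ubound; exists n.
have /andP[_ hu] := lhu n; rewrite -EFinD lee_fin.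
by have := ltW (le_lt_trans (ler_norm _) le); lra.
Qed.

End squeeze.

Section partitions.
Variable R : realType.
Implicit Types (a b x : R) (s : seq R).

Lemma partition_nth_le a b s m n : itv_partition a b s -> (m <= n <= size s)%N ->
  nth 0 (a :: s) m <= nth 0 (a :: s) n.
Proof.
move=> [ps _] /andP[mn ns].
have ss : sorted <=%R (a :: s) by exact: sub_path (@ltW _ _) _ _ ps.
apply: (sorted_leq_nth le_trans lexx 0 ss) => //; rewrite inE /= ltnS//.
exact: leq_trans ns.
Qed.

Lemma partition_nth_size a b s : itv_partition a b s -> nth 0 (a :: s) (size s) = b.
Proof. exact: itv_partition_nth_size. Qed.

Lemma partition_cell a b s x : itv_partition a b s -> a <= x < b ->
  exists k : 'I_(size s), nth 0 (a :: s) k <= x < nth 0 (a :: s) k.+1.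
Proof.
elim: s a => [a /itv_partition_nil -> /andP[ax xb]|y s ih a ps /andP[ax xb]].
  by have := le_lt_trans ax xb; rewrite ltxx.
case: (ltP x y) => xy; first by exists ord0; rewrite /= ax xy.
have [|k hk] := ih y (itv_partition_cons ps); first by rewrite xy.
by exists (lift ord0 k).
Qed.

Lemma partition_cell_uniq a b s x (j k : 'I_(size s)) : itv_partition a b s ->
  nth 0 (a :: s) j <= x < nth 0 (a :: s) j.+1 ->
  nth 0 (a :: s) k <= x < nth 0 (a :: s) k.+1 -> j = k.
Proof.
move=> ps /andP[jx xj] /andP[kx xk]; apply/val_inj/eqP; rewrite eqn_leq.
apply/andP; split; rewrite leqNgt; apply/negP => lt.
  have := @partition_nth_le _ _ _ k.+1 j ps; rewrite lt (ltnW (ltn_ord j)).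
  by move=> /(_ isT); have := lt_le_trans xk (le_trans _ jx); lra.
have := @partition_nth_le _ _ _ j.+1 k ps; rewrite lt (ltnW (ltn_ord k)).
by move=> /(_ isT); lra.
Qed.

End partitions.

Section step_functions_of_grids.
Variables (R : realType) (d : nat).
Local Notation mR := (measurableTypeR R).
Local Notation Z := (spacetime R d).
Local Notation mu := (@spacetime_measure R d).

Variable P : 'I_d.+1 -> seq R.
Hypothesis gP : grid P.
Implicit Types (k : cell_index P) (a : cell_index P -> R).

Definition side k i : set mR := `[node P i (k i), node P i (k i).+1[%classic.

(** The closed cells of the Darboux sums share faces; the half-open ones partition the fundamental
    cell. *)
Definition half_open_cell k : set Z := [set z | forall i, side k i (st_coord z i)].

Lemma half_open_cell_sub k : half_open_cell k `<=` cell k.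
Proof.
move=> z kz i; have := kz i; rewrite /side /= in_itv /= => /andP[-> /ltW ->].
by [].
Qed.

Lemma node_le k i : node P i (k i) <= node P i (k i).+1.
Proof. by apply: partition_nth_le (gP i) _; rewrite leqnSn ltn_ord. Qed.

Lemma half_open_cells_ae : {ae mu, forall z, exists k, half_open_cell k z /\
  forall j, half_open_cell j z -> j = k}.
Proof.
apply: filterS (ae_fundamental_cell R d) => z zc.
have [K hK] := fin_all_exists (fun i => partition_cell (gP i) (zc i)).
exists [ffun i => K i]; split=> [i|j jz].
  by rewrite /side /= in_itv /= ffunE; exact: hK.
apply/ffunP => i; rewrite ffunE; apply: (partition_cell_uniq (gP i) _ (hK i)).
by have := jz i; rewrite /side /= in_itv.
Qed.

Lemma measurable_half_open_cell k : measurable (half_open_cell k).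
Proof.
rewrite (_ : half_open_cell k = \bigcap_(i in [set: 'I_d.+1])
    ((fun z => st_coord z i : mR) @^-1` side k i)); last first.
  by apply/seteqP; split => z h i; [move=> _; exact: h|exact: h].
apply: fin_bigcap_measurable => // i _; rewrite -[X in measurable X]setTI.
by apply: measurable_st_coord => //; exact: measurable_itv.
Qed.

Lemma measure_half_open_cell k : mu (half_open_cell k) = (cell_volume k)%:E.
Proof.
rewrite spacetime_box => [|i]; last exact: measurable_itv.
rewrite /cell_volume -prodEFin; apply: eq_bigr => i _.
rewrite circle_measureE setIidl.
  rewrite lebesgue_measure_itv /= lte_fin; case: ltP => // le.
  by rewrite (le_anti (introT andP (conj le (node_le k i)))) subrr.
move=> x; rewrite /side /= !in_itv /= => /andP[kx xk]; apply/andP; split.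
  apply: le_trans kx; apply: (@partition_nth_le _ _ _ _ 0 (k i) (gP i)).
  by rewrite leq0n ltnW.
apply: (lt_le_trans xk); rewrite -(partition_nth_size (gP i)).
by apply: partition_nth_le (gP i) _; rewrite leqnn ltn_ord.
Qed.

(** A box is a product of slabs, and the indicator of a slab depends on one variable, so that the
    two-variable theorem applies with i = j. *)
Lemma wave_half_open_cell k : wave_approximable (ind (half_open_cell k)).
Proof.
rewrite (_ : ind _ = fun z => \prod_i ind [set z : Z | side k i (st_coord z i)] z).
  apply: wave_prod => i; apply: (@two_variable_approximable _ _ i i).
    apply: LB_ind; rewrite -[X in measurable X]setTI.
    by apply: measurable_st_coord => //; exact: measurable_itv.
  (* The slab is not periodic, but inside the fundamental cell a translation with s i = 0 leaves the
     coordinate i unchanged. *)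
  move=> s si _; apply: filterS (ae_fundamental_cell R d) => z zc.
  rewrite /ind /= !indicE; congr ((nat_of_bool _)%:R%:C)%C.
  change (`[<side k i (st_coord (shift_st s z) i)>] = `[<side k i (st_coord z i)>]).
  by rewrite st_coord_shift si addr0 red_id.
apply/funext => z; rewrite /ind.
have [kz|kz] := pselect (half_open_cell k z).
  rewrite indicE mem_set// big1// => i _; rewrite indicE mem_set//; exact: kz.
rewrite indicE memNset//.
have [i iz] : exists i, ~ side k i (st_coord z i) by exact/existsNP.
by rewrite (bigD1 i)//= indicE memNset ?mul0r.
Qed.

Definition grid_step a (z : Z) : R := \sum_k a k * \1_(half_open_cell k) z.

Lemma grid_step_ae a : {ae mu, forall z, exists k, [/\ half_open_cell k z,
  forall j, half_open_cell j z -> j = k & grid_step a z = a k]}.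
Proof.
apply: filterS half_open_cells_ae => z [k [kz jk]]; exists k; split => //.
rewrite /grid_step (bigD1 k)//= big1 ?addr0 => [|j ne].
  by rewrite indicE mem_set// mulr1.
rewrite indicE memNset ?mulr0// => /jk ejk.
by rewrite ejk eqxx in ne.
Qed.

Lemma wave_grid_step a : wave_step (grid_step a).
Proof.
exists (cell_index P), a, half_open_cell; split; first exact: wave_half_open_cell.
exact: grid_step_ae.
Qed.

Lemma integrable_half_open_cell k :
  mu.-integrable setT (fun z => (\1_(half_open_cell k) z)%:E).
Proof.
have mk := measurable_half_open_cell k.
apply/integrableP; split; first exact/measurable_EFinP.
under eq_integral do rewrite gee0_abs//.
rewrite integral_indic// setIT.
by rewrite [ltLHS](measure_half_open_cell k) ltry.
Qed.

Lemma integrable_grid_term a k :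
  mu.-integrable setT (fun z => (a k)%:E * (\1_(half_open_cell k) z)%:E)%E.
Proof. by apply: integrableZl => //; exact: integrable_half_open_cell. Qed.

Lemma grid_stepE a : EFin \o grid_step a =
  fun z => (\sum_k (a k)%:E * (\1_(half_open_cell k) z)%:E)%E.
Proof. by apply/funext => z; rewrite /= /grid_step -sumEFin. Qed.

Lemma integrable_grid_step a : mu.-integrable setT (EFin \o grid_step a).
Proof.
rewrite grid_stepE; apply: integrable_sum => // k _; exact: integrable_grid_term.
Qed.

Lemma integral_grid_step a :
  (\int[mu]_z (grid_step a z)%:E = (\sum_k a k * cell_volume k)%:E)%E.
Proof.
transitivity (\int[mu]_z (\sum_k (a k)%:E * (\1_(half_open_cell k) z)%:E))%E.
  by rewrite -grid_stepE.
rewrite integral_sum//; last by move=> k; exact: integrable_grid_term.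
rewrite -sumEFin; apply: eq_bigr => k _.
rewrite integralZl//; last first.
  exact: integrable_half_open_cell.
rewrite integral_indic ?setIT//; last exact: measurable_half_open_cell.
by rewrite EFinM; congr (_ * _)%E; exact: measure_half_open_cell.
Qed.

Lemma measurable_grid_step a : measurable_fun setT (grid_step a).
Proof. by apply/measurable_EFinP; exact: measurable_int (integrable_grid_step a). Qed.

End step_functions_of_grids.

Section riemann.
Variables (R : realType) (d : nat).
Local Notation Z := (spacetime R d).
Local Notation mu := (@spacetime_measure R d).
Implicit Types P Q : 'I_d.+1 -> seq R.

Variables (h : Z -> R) (M : R).
Hypothesis hM : forall z, `|h z| <= M.

Let M0 : 0 <= M.
Proof. exact: le_trans (normr_ge0 _) (hM (0, [tuple 0 | _ < d])). Qed.

Definition upper_step P : Z -> R := grid_step (fun k : cell_index P => sup (h @` cell k)).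
Definition lower_step P : Z -> R := grid_step (fun k : cell_index P => inf (h @` cell k)).

Lemma cell_bounds P (k : cell_index P) z : grid P -> cell k z ->
  [/\ inf (h @` cell k) <= h z, h z <= sup (h @` cell k),
      `|inf (h @` cell k)| <= M & `|sup (h @` cell k)| <= M].
Proof.
move=> gP kz.
have ub : ubound (h @` cell k) M.
  by move=> _ [y _ <-]; have := hM y; rewrite ler_norml => /andP[].
have lb : lbound (h @` cell k) (- M).
  by move=> _ [y _ <-]; have := hM y; rewrite ler_norml => /andP[].
have hz : (h @` cell k) (h z) by exists z.
have i1 : inf (h @` cell k) <= h z by apply: ge_inf => //; exists (- M).
have i2 : h z <= sup (h @` cell k) by apply: ub_le_sup => //; exists M.
have := hM z; rewrite ler_norml => /andP[z1 z2].
split => //; rewrite ler_norml; apply/andP; split.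
- by apply: lb_le_inf => //; exists (h z).
- exact: le_trans i1 z2.
- exact: le_trans z1 i2.
- by apply: ge_sup => //; exists (h z).
Qed.

Lemma upper_step_ae P : grid P ->
  {ae mu, forall z, h z <= upper_step P z /\ `|upper_step P z| <= M}.
Proof.
move=> gP; apply: filterS (grid_step_ae gP (fun k => sup (h @` cell k))).
move=> z [k [kz _ e]]; rewrite /upper_step e.
by have [] := cell_bounds gP (half_open_cell_sub kz).
Qed.

Lemma lower_step_ae P : grid P ->
  {ae mu, forall z, lower_step P z <= h z /\ `|lower_step P z| <= M}.
Proof.
move=> gP; apply: filterS (grid_step_ae gP (fun k => inf (h @` cell k))).
move=> z [k [kz _ e]]; rewrite /lower_step e.
by have [] := cell_bounds gP (half_open_cell_sub kz).
Qed.

Lemma integral_gap P Q : grid P -> grid Q ->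
  (\int[mu]_z `|upper_step P z - lower_step Q z|%:E =
    (upper_sum P h - lower_sum Q h)%:E)%E.
Proof.
move=> gP gQ.
transitivity (\int[mu]_z ((upper_step P z)%:E - (lower_step Q z)%:E))%E.
  apply: ae_eq_nonmeasurable_integral.
  apply: filterS2 (upper_step_ae gP) (lower_step_ae gQ) => z [hu _] [lh _].
  by rewrite ger0_norm// subr_ge0; exact: le_trans lh hu.
rewrite integralB_EFin//; [|exact: integrable_grid_step|exact: integrable_grid_step].
by rewrite !integral_grid_step.
Qed.

(** Both sums are integrals of step functions, which are compared almost everywhere; this replaces a
    common refinement of P and Q. *)
Lemma lower_le_upper P Q : grid P -> grid Q -> lower_sum Q h <= upper_sum P h.
Proof.
move=> gP gQ; rewrite -subr_ge0 -lee_fin -integral_gap//.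
by apply: integral_ge0 => z _; rewrite lee_fin.
Qed.

Lemma darboux_gap (eta : R) : darboux_integrable h -> 0 < eta ->
  exists P Q, [/\ grid P, grid Q & upper_sum P h - lower_sum Q h <= eta].
Proof.
move=> dh eta0; have eta2 : 0 < eta / 2 by rewrite divr_gt0.
pose P0 (i : 'I_d.+1) : seq R := [:: 2 * pi].
have gP0 : grid P0 by move=> i; apply: itv_partition1; exact: twopi_gt0.
have [|_ [P gP <-] Ph] := @inf_adherent _ [set upper_sum P h | P in @grid R d] _ eta2.
  split; first by exists (upper_sum P0 h), P0.
  by exists (lower_sum P0 h) => _ [P gP <-]; exact: lower_le_upper.
have [|_ [Q gQ <-] Qh] := @sup_adherent _ [set lower_sum P h | P in @grid R d] _ eta2.
  split; first by exists (lower_sum P0 h), P0.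
  by exists (upper_sum P0 h) => _ [P' gP' <-]; exact: lower_le_upper.
exists P, Q; split => //.
move: dh; rewrite /darboux_integrable => dh; move: Ph Qh; rewrite dh.
by lra.
Qed.

Lemma darboux_approximable : darboux_integrable h ->
  wave_approximable (fun z => (h z)%:C%C).
Proof.
move=> dh; apply: (@sandwich_approximable _ _ _ _ M0) => [|eta eta0].
  split; last first.
    exists (M ^+ 2); apply: aeW => z; rewrite sqnC -real_normK ?num_real//.
    by rewrite lerXn2r ?nnegrE.
  have n0 (n : nat) : 0 < n.+1%:R^-1 :> R by rewrite invr_gt0.
  have gap (n : nat) : exists S, [/\ grid S.1, grid S.2 &
      upper_sum S.1 h - lower_sum S.2 h <= n.+1%:R^-1].
    by have [P [Q PQ]] := darboux_gap dh (n0 n); exists (P, Q).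
  have [S hS] := choice gap.
  apply: (@squeeze_Lmeasurable _ _ _ _ _ (fun n => lower_step (S n).2)
      (fun n => upper_step (S n).1)) => n; have [gP gQ PQ] := hS n.
  - exact: measurable_grid_step.
  - exact: measurable_grid_step.
  - apply: filterS2 (upper_step_ae gP) (lower_step_ae gQ) => z [hu _] [lh _].
    by rewrite lh hu.
  by rewrite integral_gap// lee_fin.
(* As both step functions are bounded by M, the squared gap is at most 2 * M times the gap, whose
   integral is a difference of Darboux sums. *)
have e0 : 0 < eta / (2 * M + 1) by rewrite divr_gt0// ltr_wpDl// mulr_ge0.
have [P [Q [gP gQ PQ]]] := darboux_gap dh e0.
exists (lower_step Q), (upper_step P); split.
- exact: wave_grid_step.
- exact: wave_grid_step.
- apply: filterS2 (upper_step_ae gP) (lower_step_ae gQ) => z [hu _] [lh _].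
  by rewrite lh hu.
- by apply: filterS2 (upper_step_ae gP) (lower_step_ae gQ) => z [_ ?] [_ ?].
apply: (@le_trans _ _ (\int[mu]_z ((2 * M) * `|upper_step P z - lower_step Q z|)%:E)%E).
  apply: ge0_ae_le_nonmeasurable_integral => [z|z|].
  - by rewrite lee_fin sqn_ge0.
  - by rewrite lee_fin !mulr_ge0.
  apply: filterS2 (upper_step_ae gP) (lower_step_ae gQ) => z [_ uM] [_ lM].
  rewrite sqnC lee_fin -real_normK ?num_real// expr2 ler_wpM2r//.
  by apply: (le_trans (ler_normB _ _)); lra.
under eq_integral do rewrite EFinM.
rewrite ge0_integralZl_EFin//; last 2 first.
- apply/measurable_EFinP; apply: measurableT_comp => //.
  by apply: measurable_funB; exact: measurable_grid_step.
- by rewrite mulr_ge0.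
rewrite integral_gap// -EFinM lee_fin.
apply: (le_trans (ler_wpM2l _ PQ)); first by rewrite mulr_ge0.
rewrite mulrA ler_pdivrMr ?ltr_wpDl ?mulr_ge0//; nra.
Qed.

End riemann.

Lemma riemann_approximable (R : realType) (d : nat) (f : spacetime R d -> R[i]) :
  riemann_integrable f -> wave_approximable f.
Proof.
move=> [[M fM] dR dI].
have RM z : `|complex.Re (f z)| <= M /\ `|complex.Im (f z)| <= M.
  have := fM z; case: (f z) => a b /=; move=> le.
  by split; apply: le_trans le; rewrite -sqrtr_sqr ler_wsqrtr// ?lerDl ?lerDr sqr_ge0.
rewrite (_ : f = fun z => (complex.Re (f z))%:C%C + 'i%C * (complex.Im (f z))%:C%C).
  apply: waveD; last apply: waveZ.
    by apply: (@darboux_approximable _ _ _ M) => // z; have [] := RM z.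
  by apply: (@darboux_approximable _ _ _ M) => // z; have [] := RM z.
by apply/funext => z; case: (f z) => a b; apply: ReIm_inj; rewrite /= ?mul0r ?mul1r; ring.
Qed.

(** * Continuous functions and the multiplier algebra *)

Section complex_continuity.
Variable R : realType.

Lemma normc_complex (x : R[i]) : `|x| = (Normc.normc x)%:C%C.
Proof. by case: x. Qed.

Lemma Re_le_normc (x : R[i]) : `|complex.Re x| <= Normc.normc x.
Proof. by case: x => a b /=; rewrite -sqrtr_sqr ler_wsqrtr// lerDl sqr_ge0. Qed.

Lemma Im_le_normc (x : R[i]) : `|complex.Im x| <= Normc.normc x.
Proof. by case: x => a b /=; rewrite -sqrtr_sqr ler_wsqrtr// lerDr sqr_ge0. Qed.

Lemma normc_le_ReIm (x : R[i]) :
  Normc.normc x <= `|complex.Re x| + `|complex.Im x|.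
Proof.
rewrite normc_le ?addr_ge0// /sqn.
rewrite -(real_normK (num_real (complex.Re x))) -(real_normK (num_real (complex.Im x))).
have := normr_ge0 (complex.Re x); have := normr_ge0 (complex.Im x); nra.
Qed.

Lemma complex_continuousP (V : topologicalType) (f : V -> R[i]) :
  continuous (f : V -> R[i]^o) <->
  continuous (fun v => complex.Re (f v)) /\ continuous (fun v => complex.Im (f v)).
Proof.
split=> [cf|[cR cI] v].
  split=> v; apply/cvgrPdist_lt => e e0.
    have /cvgrPdist_lt/(_ e%:C%C) := cf v; rewrite ltcR => /(_ e0).
    apply: filterS => y; rewrite normc_complex ltcR; apply: le_lt_trans.
    by apply: le_trans (Re_le_normc _); rewrite cReD cReN.
  have /cvgrPdist_lt/(_ e%:C%C) := cf v; rewrite ltcR => /(_ e0).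
  apply: filterS => y; rewrite normc_complex ltcR; apply: le_lt_trans.
  by apply: le_trans (Im_le_normc _); rewrite cImD cImN.
(* A positive element of R[i] is real, so the radius e is determined by its real part. *)
apply/cvgrPdist_lt => e; rewrite ltcE /= => /andP[/eqP e1 e0].
have e2 : 0 < complex.Re e / 2 by rewrite divr_gt0.
have /cvgrPdist_lt/(_ _ e2) hR := cR v; have /cvgrPdist_lt/(_ _ e2) hI := cI v.
apply: filterS2 hR hI => y hR hI; rewrite normc_complex ltcE /= e1 eqxx /=.
apply: (le_lt_trans (normc_le_ReIm _)); rewrite cReD cReN cImD cImN; lra.
Qed.

End complex_continuity.

Section torus_continuity.
Variables (R : realType) (d : nat).
Local Notation mR := (measurableTypeR R).
Local Notation Z := (spacetime R d).
Local Notation mu := (@spacetime_measure R d).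

Definition to_row (z : Z) : 'rV[R]_d.+1 := \row_i st_coord z i.

Lemma to_rowK z : of_row (to_row z) = z.
Proof.
case: z => t x; rewrite /of_row /to_row mxE st_coord0; congr pair.
by apply: eq_from_tnth => i; rewrite tnth_mktuple mxE st_coordS.
Qed.

Lemma st_coord_of_row (w : 'rV[R]_d.+1) i : st_coord (of_row w) i = w ord0 i.
Proof.
case: (unliftP ord0 i) => [j|] ->; last by rewrite st_coord0.
by rewrite st_coordS /= tnth_mktuple.
Qed.

Definition grid_point (n : nat) (m : freq d) : Z :=
  of_row (\row_i ((m i)%:~R / n.+1%:R)).

(** Rounding to a grid of step 1 / (n + 1) makes any function constant on countably many boxes,
    hence Borel; a continuous function is the pointwise limit of its rounded versions. *)
Definition round_down n (z : Z) : Z :=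
  grid_point n [ffun i => Num.floor (n.+1%:R * st_coord z i)].

Lemma measurable_round_down (h : Z -> R) n :
  measurable_fun setT (fun z => h (round_down n z)).
Proof.
move=> _ B mB; rewrite setTI.
pose A (m : freq d) : set Z := if h (grid_point n m) \in B then
  \bigcap_(i in [set: 'I_d.+1])
    ((fun z => st_coord z i : mR) @^-1` `[(m i)%:~R / n.+1%:R, (m i + 1)%:~R / n.+1%:R[)
  else set0.
have n0 : 0 < n.+1%:R :> R by [].
rewrite (_ : _ @^-1` B = \bigcup_m A m).
  apply: countable_bigcupT_measurable; first exact: countableP.
  move=> m; rewrite /A; case: ifP => // _.
  apply: fin_bigcap_measurable => // i _; rewrite -[X in measurable X]setTI.
  by apply: measurable_st_coord => //; exact: measurable_itv.
apply/seteqP; split => [z Bz|z [m _]].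
  exists [ffun i => Num.floor (n.+1%:R * st_coord z i)] => //.
  rewrite /A mem_set// => i _; rewrite /= in_itv /= !ffunE.
  rewrite ler_pdivrMr// ltr_pdivlMr// mulrC; exact: floor_itv.
rewrite /A; case: ifP => // /set_mem Bm zm.
rewrite /= /round_down (_ : finfun _ = m)//; apply/ffunP => i; rewrite ffunE.
have := zm i I; rewrite /= in_itv /= ler_pdivrMr// ltr_pdivlMr// mulrC.
by move=> ?; apply/eqP; rewrite floor_eq.
Qed.

Lemma round_down_cvg (h : Z -> R) z : continuous (fun w => h (of_row w)) ->
  (fun n => h (round_down n z)) @ \oo --> h z.
Proof.
move=> ch; rewrite -[z in h z]to_rowK.
pose w n : 'rV[R]_d.+1 :=
  \row_i ((Num.floor (n.+1%:R * st_coord z i))%:~R / n.+1%:R).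
rewrite (_ : (fun n => _) = (fun w => h (of_row w)) \o w); last first.
  apply/funext => n /=; congr h; rewrite /round_down /grid_point; congr of_row.
  by apply/rowP => i; rewrite !mxE ffunE.
apply: continuous_cvg; first exact: ch.
apply/cvg_ballP => e e0; near=> n; split => // i j; rewrite !mxE.
have n0 : 0 < n.+1%:R :> R by [].
have /andP[f1 f2] := floor_itv (n.+1%:R * st_coord z j).
rewrite /ball /= ltr_norml.
have ne : n.+1%:R^-1 < e by near: n; exact: near_infty_natSinv_lt (PosNum e0).
rewrite -ler_pdivrMl// mulrC in f1.
rewrite intrD -ltr_pdivlMl// mulrDr mulr1 [_^-1 * _]mulrC in f2.
move: ((Num.floor (n.+1%:R * st_coord z j))%:~R / n.+1%:R) f1 f2 => q f1 f2.
move: (st_coord z j) (n.+1%:R^-1) ne f1 f2 => x r ne f1 f2.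
by apply/andP; split; lra.
Unshelve. all: by end_near. Qed.


Lemma Borel_continuous (f : Z -> R[i]) :
  continuous (fun w : 'rV[R]_d.+1 => f (of_row w) : R[i]^o) -> Borel_complex f.
Proof.
move=> /complex_continuousP[cR cI]; split.
  apply: (@measurable_fun_cvg _ _ _ _ (fun n z => complex.Re (f (round_down n z)))).
    by move=> n; exact: (measurable_round_down (fun z => complex.Re (f z))).
  by move=> z _; exact: (@round_down_cvg (fun z => complex.Re (f z))).
apply: (@measurable_fun_cvg _ _ _ _ (fun n z => complex.Im (f (round_down n z)))).
  by move=> n; exact: (measurable_round_down (fun z => complex.Im (f z))).
by move=> z _; exact: (@round_down_cvg (fun z => complex.Im (f z))).
Qed.

Lemma continuous_bounded_on_cell (h : Z -> R) : continuous (fun w => h (of_row w)) ->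
  exists M : R, forall z, (forall i, 0 <= st_coord z i < 2 * pi) -> `|h z| <= M.
Proof.
move=> ch.
have cK : compact [set w : 'rV[R]_d.+1 | forall i, `[0, 2 * pi]%classic (w ord0 i)].
  by apply: (@rV_compact _ _ (fun=> `[0, 2 * pi]%classic)) => i; exact: segment_compact.
have /compact_bounded[M [_ hM]] :=
  continuous_compact (continuous_subspaceT ch) cK.
exists (M + 1) => z zc; apply: (hM (M + 1)); first by rewrite ltrDl.
exists (to_row z); last by rewrite to_rowK.
by move=> i; rewrite /= in_itv /= mxE; have /andP[-> /ltW ->] := zc i.
Qed.

Lemma LB_continuous (f : Z -> R[i]) : continuous_on_torus f -> LB mu f.
Proof.
move=> [_ cf]; split; first exact/Borel_Lm/Borel_continuous.
have /complex_continuousP[cR cI] := cf.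
have [M hM] := continuous_bounded_on_cell (h := fun z => complex.Re (f z)) cR.
have [N hN] := continuous_bounded_on_cell (h := fun z => complex.Im (f z)) cI.
exists (M ^+ 2 + N ^+ 2); apply: filterS (ae_fundamental_cell R d) => z zc.
have sq (a B : R) : `|a| <= B -> a ^+ 2 <= B ^+ 2.
  by move=> aB; rewrite -(real_normK (num_real a)) lerXn2r ?nnegrE//; exact: le_trans aB.
by apply: lerD; apply: sq; [exact: hM|exact: hN].
Qed.

Lemma continuous_on_torus_cst c : continuous_on_torus (fun _ : Z => c).
Proof.
by split=> //; apply/complex_continuousP; split; exact: cst_continuous.
Qed.

Lemma continuous_on_torusD (f g : Z -> R[i]) :
  continuous_on_torus f -> continuous_on_torus g ->
  continuous_on_torus (fun z => f z + g z).
Proof.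
move=> [pf /complex_continuousP[fR fI]] [pg /complex_continuousP[gR gI]]; split.
  by move=> z z' zz; rewrite (pf _ _ zz) (pg _ _ zz).
apply/complex_continuousP; split.
  under eq_fun do rewrite cReD; move=> w; exact: (cvgD (fR w) (gR w)).
under eq_fun do rewrite cImD; move=> w; exact: (cvgD (fI w) (gI w)).
Qed.

Lemma continuous_on_torusM (f g : Z -> R[i]) :
  continuous_on_torus f -> continuous_on_torus g ->
  continuous_on_torus (fun z => f z * g z).
Proof.
move=> [pf /complex_continuousP[fR fI]] [pg /complex_continuousP[gR gI]]; split.
  by move=> z z' zz; rewrite (pf _ _ zz) (pg _ _ zz).
apply/complex_continuousP; split.
  under eq_fun do rewrite cReM.
  move=> w; exact: (cvgB (cvgM (fR w) (gR w)) (cvgM (fI w) (gI w))).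
under eq_fun do rewrite cImM.
move=> w; exact: (cvgD (cvgM (fR w) (gI w)) (cvgM (fI w) (gR w))).
Qed.

Lemma continuous_on_torus_ee m : continuous_on_torus (ee m : Z -> R[i]).
Proof.
split; first by move=> z z'; exact: ee_periodic.
have cd : continuous (fun w : 'rV[R]_d.+1 => dot m (st_coord (of_row w))).
  apply: continuous_big => [|i _]; first exact: add_continuous.
  under eq_fun do rewrite st_coord_of_row.
  by move=> w; exact: (cvgM (cvg_cst _) (@coord_continuous R 1 d.+1 ord0 i w)).
apply/complex_continuousP; split => w /=.
  by apply: continuous_comp; [exact: cd|exact: continuous_cos].
by apply: continuous_comp; [exact: cd|exact: continuous_sin].
Qed.

Lemma continuous_on_torus_trig P (f : Z -> R[i]) : trig P f -> continuous_on_torus f.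
Proof.
move=> [s [_ ->]]; elim: s => [|a s ih].
  by under eq_fun do rewrite big_nil; exact: continuous_on_torus_cst.
under eq_fun do rewrite big_cons; apply: continuous_on_torusD => //.
apply: continuous_on_torusM; first exact: continuous_on_torus_cst.
exact: continuous_on_torus_ee.
Qed.

End torus_continuity.

Section multiplier_algebra.
Variables (R : realType) (d : nat).
Local Notation Z := (spacetime R d).
Local Notation mu := (@spacetime_measure R d).
Implicit Types f g u : Z -> R[i].

Definition torus_approximable f := approximable mu (@continuous_on_torus R d)
  [set u | free_wave u /\ (nn mu u <= 1)%E] (fun=> 1%E) f.

Lemma free_wave_L2 u : free_wave u -> L2 mu u.
Proof. by move=> [/in_L2P]. Qed.

Lemma bounded_mul_operator f : LB mu f -> bounded_operator (mul_operator f).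
Proof.
move=> bf; split.
- by move=> u /free_wave_L2 u2; apply/in_L2P; exact: L2M.
- by move=> u v _ _; apply: filterS => z; rewrite /mul_operator => ->.
- by move=> c u v _ _; apply: aeW => z; rewrite /mul_operator; ring.
have [_ [M M0 fM]] := (LBP mu f).1 bf.
exists (Num.sqrt M) => u /free_wave_L2[mu_ nu].
apply: cLnorm2_leM; [exact: sqrtr_ge0|exact: nu|].
by rewrite sqr_sqrtr//; exact: nnM_le.
Qed.

Lemma operator_norm_le f g (e : R) : 0 <= e ->
  (operator_norm (fun u z => (mul_operator f u z - mul_operator g u z)%R) <= e%:E)%E <->
  forall u, free_wave u -> (nn mu u <= 1)%E ->
    (nn mu (fun z => (f z - g z) * u z)%R <= (e ^+ 2)%:E)%E.
Proof.
move=> e0.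
have mulE u : (fun z => mul_operator f u z - mul_operator g u z) =
    fun z => (f z - g z) * u z.
  by apply/funext => z; rewrite /mul_operator mulrBl.
have one u : (cLnorm mu 2%:E u <= 1)%E = (nn mu u <= 1)%E.
  by rewrite cLnorm2_le// expr1n.
split=> [h u fu u1|h].
  rewrite -cLnorm2_le// -mulE; apply: le_trans h; apply: ereal_sup_ubound.
  by exists u => //; split; rewrite ?one.
apply/ereal_supP => _ [u [fu u1] <-]; rewrite mulE cLnorm2_le//.
by apply: h => //; rewrite -one.
Qed.

(** Approximability bounds squared norms and the operator norm does not, so the accuracy e on one
    side corresponds to its square root on the other. *)
Lemma Y0_LinftyP f : Y0_Linfty f <-> torus_approximable f.
Proof.
split=> [[[_ fa] /in_LyP bf]|[bf fa]].
  split => // e e0; have se : 0 < Num.sqrt e by rewrite sqrtr_gt0.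
  have [g [cg /(operator_norm_le _ _ (ltW se)) fg]] := fa _ se.
  exists g; split => // u [fu u1]; rewrite mule1.
  by have := fg u fu u1; rewrite sqr_sqrtr// ltW.
split; last exact/in_LyP.
split; first exact: bounded_mul_operator.
move=> e e0; have [g [cg fg]] := fa _ (exprn_gt0 2 e0); exists g; split => //.
apply/(operator_norm_le _ _ (ltW e0)) => u fu u1.
by have := fg u (conj fu u1); rewrite mule1.
Qed.

Lemma wave_Y0_Linfty f : wave_approximable f -> Y0_Linfty f.
Proof.
move=> [bf fa]; apply/Y0_LinftyP; split => // e e0.
have e4 : 0 < e / 4 by rewrite divr_gt0.
have [p [tp fp]] := fa _ e4; exists p; split; first exact: continuous_on_torus_trig tp.
move=> u [fu u1].
apply: le_trans (wave_estimate_free (LBB bf (LB_trig tp)) (ltW e4) fp fu) _.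
rewrite mulrC divfK ?pnatr_eq0//; apply: lee_wpmul2l => //.
by rewrite lee_fin ltW.
Qed.

Lemma Y0_Linfty_closed_subalgebra : closed_subalgebra_Linfty (@Y0_Linfty R d).
Proof.
have C_LB := @LB_continuous R d.
have C_cst := @continuous_on_torus_cst R d.
have C_D := @continuous_on_torusD R d.
have C_M := @continuous_on_torusM R d.
have U_Lm u : free_wave u /\ (nn mu u <= 1)%E -> Lmeasurable mu u.
  by move=> [/free_wave_L2[]].
have U_w u : free_wave u /\ (nn mu u <= 1)%E -> (nn mu u <= 1)%E by case.
split.
- by move=> f [].
- move=> f g _ fg /Y0_LinftyP af; apply/Y0_LinftyP; exact: approx_ae fg af.
- split.
  + by apply/Y0_LinftyP; exact: (approx_cst C_LB C_cst U_w).
  + move=> c f g /Y0_LinftyP af /Y0_LinftyP ag; apply/Y0_LinftyP.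
    exact: (approxD C_LB C_D U_Lm (approxZ C_LB C_cst C_M U_Lm U_w c af) ag).
  + move=> f g /Y0_LinftyP af /Y0_LinftyP ag; apply/Y0_LinftyP.
    exact: (approxM C_LB C_M U_Lm U_w af ag).
- move=> f /in_LyP bf fa; apply/Y0_LinftyP; apply: (approx_uniform C_LB U_Lm U_w bf) => e e0.
  have se : 0 < Num.sqrt e by rewrite sqrtr_gt0.
  have [g [/Y0_LinftyP ag fg]] := fa _ se; exists g; split => //.
  move/(cLnormy_le _ _ (ltW se)) : fg; apply: filterS => z.
  by rewrite normc_le ?sqrtr_ge0// sqr_sqrtr// ltW.
Qed.

Lemma two_variables_shift i j f : torus_periodic f ->
  (forall z z', st_coord z i = st_coord z' i -> st_coord z j = st_coord z' j ->
    f z = f z') ->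
  forall s, s i = 0 -> s j = 0 -> f \o shift_st s = f.
Proof.
move=> pf fij s si sj; apply/funext => z /=.
(* [shift_st] also reduces every coordinate to the cell, so the comparison is with the translate by
   0, which agrees with z modulo 2 pi; periodicity does the rest. *)
rewrite (fij _ (shift_st (fun=> 0) z)); last 2 first.
- by rewrite !st_coord_shift si.
- by rewrite !st_coord_shift sj.
by apply: pf => c; rewrite st_coord_shift addr0; exact: red_int.
Qed.

End multiplier_algebra.

Theorem theorem1p10 (R : realType) (d : nat) (hd : (1 <= d)%N) :
  [/\ closed_subalgebra_Linfty (@Y0_Linfty R d),
      (forall f : spacetime R d -> R[i],
        torus_periodic f -> bounded_function f -> riemann_integrable f ->
        Y0_Linfty f)
    & (forall f : spacetime R d -> R[i],
        torus_periodic f -> bounded_function f ->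
        Lmeasurable (@spacetime_measure R d) f ->
        depends_on_at_most_two_variables f ->
        Y0_Linfty f)].
Proof.
split; first exact: Y0_Linfty_closed_subalgebra.
  by move=> f _ _ rf; apply: wave_Y0_Linfty; exact: riemann_approximable.
move=> f pf [M fM] mf [i [j fij]]; apply: wave_Y0_Linfty.
apply: (@two_variable_approximable _ _ i j) => [|s si sj]; last first.
  by rewrite (two_variables_shift pf fij si sj); exact: aeW.
split => //; exists (M ^+ 2); apply: aeW => z.
by rewrite -normc_le//; exact: le_trans (normc_ge0 _) (fM z).
Qed.
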